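(* Let $W$ be a finite complex reflection group generated by reflections of order $2$, with pure braid group $P$, $\Bbbk$ a field of characteristic $0$, $K=\Bbbk((h))$, $K^\sigma=\Bbbk((h^2))$. Let $\rho:W\to\mathrm{GL}_N(\Bbbk)$ be an orthogonal representation, i.e. ${}^t\rho(w)\rho(w)=1$ for all $w\in W$, and let $\Psi:B\to\mathrm{GL}_N(K)$ be the associated representation of the braid group. Let $\widehat{\Psi(P)}$ denote the Zariski closure of $\Psi(P)$ inside the $K$-group $\mathrm{GL}_N(K)$, and $\overline{\Psi(P)}$ the Zariski closure of $\Psi(P)$ inside $\mathrm{GL}_N(K)$ considered as a $K^\sigma$-group. Then $\overline{\Psi(P)}$ is the connected component of the identity of $\widehat{\Psi(P)}\cap U_N^\sigma(K)$ (as an algebraic group over $K^\sigma$).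
   Context: $\sigma\in\mathrm{Aut}(K)$ is $f(h)\mapsto f(-h)$, with fixed field $K^\sigma$. $\mathrm{GL}_N(K)$ is viewed as an algebraic group over $K^\sigma$ by restriction of scalars along the quadratic extension $K/K^\sigma$, and closed $K$-subgroups are thereby also closed $K^\sigma$-subgroups. $U_N^\sigma(K)=\{M\in\mathrm{GL}_N(K)\mid M\,{}^t\sigma(M)=1\}$, a closed $K^\sigma$-subgroup. $W\subset\mathrm{GL}_n(\mathbb{C})$, $\mathcal{R}$ is the set of reflections of $W$, $X=\mathbb{C}^n\setminus\bigcup_{s\in\mathcal{R}}\mathrm{Ker}(s-1)$, $B=\pi_1(X/W)$, $P=\pi_1(X)=\mathrm{Ker}(B\to W)$. A braided reflection of $B$ attached to $s\in\mathcal{R}$ is a distinguished generator of the monodromy around the image of $\mathrm{Ker}(s-1)$ in $\mathbb{C}^n/W$; it maps to $s\in W$. The holonomy Lie algebra $\mathcal{T}$ over $\Bbbk$ is generated by $t_s$, $s\in\mathcal{R}$, with relations $[t_s,\sum_{u\in\mathcal{R},\,\mathrm{Ker}(u-1)\supset Z}t_u]=0$ for each codimension-$2$ intersection $Z$ of reflecting hyperplanes and each $s\in\mathcal{R}$ with $\mathrm{Ker}(s-1)\supset Z$. It is graded with $\deg t_s=1$, with completion $\widehat{\mathcal{T}}$, and $W$ acts by $w\cdot t_s=t_{wsw^{-1}}$. One fixes a morphism $\Phi:B\to W\ltimes\exp\widehat{\mathcal{T}}$ such that, for each braided reflection $\mathfrak{s}$ attached to $s$, $\Phi(\mathfrak{s})$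 is conjugate to $s\exp(t_s)$ by an element of $\exp\widehat{\mathcal{T}}$ (for $\Bbbk=\mathbb{C}$ such a $\Phi$ is provided by the monodromy of $\frac{1}{i\pi}\sum_s t_s\,\frac{d\alpha_s}{\alpha_s}$, $\alpha_s$ a linear form with kernel $\mathrm{Ker}(s-1)$). The representation $\Psi$ associated to $\rho$ is the composition of $\Phi$ with the morphism $W\ltimes\exp\widehat{\mathcal{T}}\to\mathrm{GL}_N(\Bbbk[[h]])$ given by $w\mapsto\rho(w)$, $t_s\mapsto h\rho(s)$. *)

(* Defs.v *)
From HB Require Import structures.
From mathcomp Require Import all_boot all_order all_algebra all_fingroup all_character.
From mathcomp Require Import complex generic_quotient.
From mathcomp Require Import all_classical all_reals all_analysis.
From mathcomp.multinomials Require mpoly.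

Set Implicit Arguments.
Unset Strict Implicit.
Unset Printing Implicit Defensive.

Import Order.TTheory GRing.Theory Num.Theory.
Import numFieldNormedType.Exports.

Local Open Scope classical_set_scope.
Local Open Scope ring_scope.

Definition fps (k : fieldType) : Type := nat -> k.

HB.instance Definition _ (k : fieldType) :=
  GRing.Zmodule.copy (fps k) (nat -> k).

Section PowerSeries.
Variable k : fieldType.
Implicit Types f g : fps k.

Definition fps_const (c : k) : fps k := fun n => if n == 0%N then c else 0.
Definition fps_h : fps k := fun n => (n == 1%N)%:R.
Definition fps_mul f g : fps k :=
  fun n => \sum_(i < n.+1) f i * g (n - i)%N.

Let trunc n f : {poly k} := \poly_(i < n.+1) f i.

Let coef_trunc n f i : (i <= n)%N -> (trunc n f)`_i = f i.
Proof. by move=> le_in; rewrite coef_poly ltnS le_in. Qed.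

Let coef_mul n f g i : (i <= n)%N ->
  (trunc n f * trunc n g)`_i = fps_mul f g i.
Proof.
move=> le_in; rewrite coefM; apply: eq_bigr => j _.
have le_ji : (j <= i)%N by rewrite -ltnS.
by rewrite !coef_trunc // ?(leq_trans (leq_subr _ _)) // (leq_trans le_ji).
Qed.

Lemma fps_mulC : commutative fps_mul.
Proof.
by move=> f g; apply/funext => n; rewrite -!(@coef_mul n) // mulrC.
Qed.

Lemma fps_mulA : associative fps_mul.
Proof.
move=> f g e; apply/funext => n.
have le_ord (i : 'I_n.+1) : (i <= n)%N by rewrite -ltnS.
transitivity ((trunc n f * (trunc n g * trunc n e))`_n).
  rewrite coefM; apply: eq_bigr => i _.
  by rewrite coef_trunc // coef_mul // leq_subr.
rewrite mulrA coefM; apply: eq_bigr => i _.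
by rewrite coef_trunc ?leq_subr // coef_mul.
Qed.

Lemma fps_mul1 : left_id (fps_const 1) fps_mul.
Proof.
move=> f; apply/funext => n; rewrite /fps_mul big_ord_recl /= subn0 mul1r.
by rewrite big1 ?addr0 // => i _; rewrite /fps_const mul0r.
Qed.

Lemma fps_mulDl : left_distributive fps_mul +%R.
Proof.
move=> f g e; apply/funext => n.
transitivity (fps_mul f e n + fps_mul g e n) => //.
by rewrite -big_split; apply: eq_bigr => i _; exact: mulrDl.
Qed.

Lemma fps_1neq0 : fps_const 1 != 0 :> fps k.
Proof.
by apply/eqP => /(congr1 (@^~ 0%N)) /= /eqP; rewrite /fps_const oner_eq0.
Qed.

HB.instance Definition _ := GRing.Zmodule_isComNzRing.Build (fps k)
  fps_mulA fps_mulC fps_mul1 fps_mulDl fps_1neq0.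

Lemma fps_mulE f g n : (f * g) n = \sum_(i < n.+1) f i * g (n - i)%N.
Proof. by []. Qed.

Let fps_unit : pred (fps k) := [pred f | `[< exists g, g * f = 1 >]].
Let fps_inv f : fps k :=
  if pselect (exists g, g * f = 1) is left e then sval (cid e) else f.

Let fps_mulVr : {in fps_unit, left_inverse 1 fps_inv *%R}.
Proof.
move=> f /asboolP ef; rewrite /fps_inv; case: pselect => // e.
by case: (cid e).
Qed.

Let fps_unitPl f g : g * f = 1 -> fps_unit f.
Proof. by move=> e; apply/asboolP; exists g. Qed.

Let fps_invr_out : {in [predC fps_unit], fps_inv =1 id}.
Proof.
move=> f nf; rewrite /fps_inv; case: pselect => // e.
by case/negP: nf; apply/asboolP.
Qed.

HB.instance Definition _ := GRing.ComNzRing_hasMulInverse.Build (fps k)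
  fps_mulVr fps_unitPl fps_invr_out.

Lemma fps_mulf_eq0 f g : f * g = 0 -> (f == 0) || (g == 0).
Proof.
have ord e : e != 0 :> fps k ->
    exists2 n, e n != 0 & forall i, (i < n)%N -> e i = 0.
  move=> e0; have ex : exists n, e n != 0.
    apply: contrapT => /forallNP e_0; move/eqP: e0; apply; apply/funext => n.
    by apply/eqP; move/negP: (e_0 n); rewrite negbK.
  exists (ex_minn ex); first by case: ex_minnP.
  move=> i; case: ex_minnP => n _ min_n lt_in; apply/eqP/negPn/negP => /min_n.
  by rewrite leqNgt lt_in.
move=> fg0; apply/norP => -[/ord[m fm f0] /ord[n gn g0]].
have /eqP := congr1 (@^~ (m + n)%N) fg0; rewrite /= fps_mulE.
have lt_m : (m < (m + n).+1)%N by rewrite ltnS leq_addr.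
rewrite (bigD1 (Ordinal lt_m)) //= addKn big1 ?addr0.
  by rewrite mulf_eq0 (negPf fm) (negPf gn).
move=> i; rewrite -val_eqE /= => im.
case: (ltnP i m) => [/f0 -> |le_mi]; first by rewrite mul0r.
have lt_mi : (m < i)%N by rewrite ltn_neqAle eq_sym im.
rewrite g0 ?mulr0 // ltn_subLR; last by rewrite -ltnS.
by rewrite ltn_add2r.
Qed.

HB.instance Definition _ :=
  GRing.ComUnitRing_isIntegral.Build (fps k) fps_mulf_eq0.

Definition fps_sigma f : fps k := fun n => (-1) ^+ n * f n.

Lemma fps_sigma_zmod : zmod_morphism fps_sigma.
Proof.
move=> f g; apply/funext => n.
by rewrite /fps_sigma /GRing.add/= /GRing.opp/= mulrBr.
Qed.

Lemma fps_sigma_monoid : monoid_morphism fps_sigma.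
Proof.
split=> [|f g]; apply/funext => n; rewrite /fps_sigma.
  rewrite /GRing.one/= /fps_const; case: n => [|n]; last by rewrite mulr0.
  by rewrite mulr1.
rewrite !fps_mulE mulr_sumr; apply: eq_bigr => i _.
by rewrite mulrACA -exprD subnKC // -ltnS.
Qed.

HB.instance Definition _ :=
  GRing.isZmodMorphism.Build (fps k) (fps k) fps_sigma fps_sigma_zmod.
HB.instance Definition _ :=
  GRing.isMonoidMorphism.Build (fps k) (fps k) fps_sigma fps_sigma_monoid.

Lemma fps_sigmaK : involutive fps_sigma.
Proof.
by move=> f; apply/funext => n; rewrite /fps_sigma signrMK.
Qed.

End PowerSeries.

(* k((h)) is the fraction field of k[[h]]. *)
Definition laurent (k : fieldType) : fieldType := {fraction fps k}.

Section Laurent.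
Variable k : fieldType.
Local Notation K := (laurent k).

Definition tolaurent (f : fps k) : K := FracField.tofrac f.

HB.instance Definition _ := GRing.RMorphism.copy tolaurent
  (@FracField.tofrac (fps k)).

Definition sigma (x : K) : K :=
  tolaurent (fps_sigma (frac (repr x)).1)
  / tolaurent (fps_sigma (frac (repr x)).2).


Lemma tolaurent_eq0 (f : fps k) : (tolaurent f == 0) = (f == 0).
Proof. exact: tofrac_eq0. Qed.

Lemma laurent_numden (x : K) :
  x = tolaurent (frac (repr x)).1 / tolaurent (frac (repr x)).2.
Proof.
have d0 : tolaurent (frac (repr x)).2 != 0.
  by rewrite tolaurent_eq0 denom_ratioP.
apply: (mulIf d0); rewrite mulfVK // -[x in LHS]reprK.
rewrite /tolaurent; unlock FracField.tofrac.
rewrite -[LHS]FracField.pi_mul; apply/eqmodP; rewrite /= FracField.equivfE.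
rewrite /FracField.mulf !numden_Ratio ?mulf_neq0 ?denom_ratioP ?oner_neq0 //.
by rewrite reprK !mulr1 mulrC.
Qed.

Lemma fps_sigma_eq0 (f : fps k) : (fps_sigma f == 0) = (f == 0).
Proof. by rewrite -(inj_eq (can_inj (@fps_sigmaK k))) fps_sigmaK rmorph0. Qed.

Lemma sigmaE (f g : fps k) : g != 0 ->
  sigma (tolaurent f / tolaurent g)
    = tolaurent (fps_sigma f) / tolaurent (fps_sigma g).
Proof.
move=> g0; set x : K := tolaurent f / tolaurent g; rewrite /sigma.
have := laurent_numden x; move: (denom_ratioP (repr x)).
move: (frac (repr x)).1 (frac (repr x)).2 => a b b0.
have nz e : e != 0 -> tolaurent e != 0 by rewrite tolaurent_eq0.
move/eqP; rewrite /x eqr_div ?nz // -!rmorphM tofrac_eq => /eqP fb.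
apply/eqP; rewrite eqr_div ?nz ?fps_sigma_eq0 // -!rmorphM.
by rewrite fb.
Qed.

Lemma sigma_tolaurent f : sigma (tolaurent f) = tolaurent (fps_sigma f).
Proof.
have := @sigmaE f 1 (oner_neq0 _).
by rewrite !rmorph1 !divr1.
Qed.

Lemma sigma_zmod : zmod_morphism sigma.
Proof.
move=> x y; rewrite (laurent_numden x) (laurent_numden y).
move: (denom_ratioP (repr x)) (denom_ratioP (repr y)).
move: (frac (repr x)) (frac (repr y)) => [a b] [c d] /= b0 d0.
have nz e : e != 0 -> tolaurent e != 0 by rewrite tolaurent_eq0.
rewrite -mulNr addf_div ?nz // -rmorphN -!rmorphM -rmorphD !sigmaE ?mulf_neq0 //.
rewrite -[in RHS]mulNr addf_div ?nz ?fps_sigma_eq0 //.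
by rewrite -rmorphN -!rmorphM -rmorphD !rmorphM !rmorphD !rmorphM !rmorphN.
Qed.

Lemma sigma_monoid : monoid_morphism sigma.
Proof.
split=> [|x y].
  by rewrite -(rmorph1 tolaurent) sigma_tolaurent (rmorph1 (@fps_sigma k)).
rewrite (laurent_numden x) (laurent_numden y).
move: (denom_ratioP (repr x)) (denom_ratioP (repr y)).
move: (frac (repr x)) (frac (repr y)) => [a b] [c d] /= b0 d0.
by rewrite mulf_div -!rmorphM !sigmaE ?mulf_neq0 // !rmorphM mulf_div.
Qed.

HB.instance Definition _ := GRing.isZmodMorphism.Build K K sigma sigma_zmod.
HB.instance Definition _ := GRing.isMonoidMorphism.Build K K sigma sigma_monoid.

Definition Ksigma : {pred K} := [pred x | sigma x == x].

Lemma Ksigma_subring : subring_closed Ksigma.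
Proof.
split=> [|x y /eqP xK /eqP yK|x y /eqP xK /eqP yK]; apply/eqP.
- exact: rmorph1.
- by rewrite rmorphB /= xK yK.
- by rewrite rmorphM /= xK yK.
Qed.

HB.instance Definition _ := GRing.isSubringClosed.Build K Ksigma Ksigma_subring.

Definition Kfull : {pred K} := predT.

HB.instance Definition _ := GRing.isSubringClosed.Build K Kfull
  (And3 isT (fun _ _ _ _ => isT) (fun _ _ _ _ => isT)).

End Laurent.

(* The space T, endowed with coordinates c : T -> F^m and with the topology
   whose closed sets are the zero loci of polynomials in these coordinates with
   coefficients in the subring S of F. *)
Definition zariski_space (F : fieldType) (S : subringClosed F) (m : nat)
  (T : choiceType) (c : T -> 'rV[F]_m) : Type := T.

Section Zariski.
Import -(notations) mpoly.
Variables (F : fieldType) (S : subringClosed F) (m : nat) (T : choiceType).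
Variable c : T -> 'rV[F]_m.

HB.instance Definition _ := Choice.on (zariski_space S c).

Definition zero_locus (E : set (mpoly m F)) : set (zariski_space S c) :=
  [set x | forall p, E p -> meval (fun i => c x 0 i) p = 0].

Definition zariski_closed (Z : set (zariski_space S c)) : Prop :=
  exists2 E : set (mpoly m F),
    (forall p, E p -> p \is a mpolyOver m S) & Z = zero_locus E.

Definition zariski_open (U : set (zariski_space S c)) : Prop :=
  zariski_closed (~` U).

Let zariski_openT : zariski_open setT.
Proof.
exists [set (1 : mpoly m F)]; first by move=> p ->; rewrite rpred1.
rewrite setCT; apply/seteqP; split=> // x /(_ _ erefl) /eqP.
by rewrite meval1 oner_eq0.
Qed.

Let zariski_openI (U V : set (zariski_space S c)) :
  zariski_open U -> zariski_open V -> zariski_open (U `&` V).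
Proof.
move=> [E ES EU] [G GS GV].
exists [set p * q | p in E & q in G].
  by move=> _ [p Ep [q Gq <-]]; apply: rpredM; [exact: ES|exact: GS].
rewrite setCI EU GV; apply/seteqP; split=> [x [xE|xG] _ [p Ep [q Gq <-]]|x xEG].
- by rewrite mevalM (xE p) ?mul0r.
- by rewrite mevalM (xG q) ?mulr0.
- apply: contrapT => /not_orP[/existsNP[p /not_implyP[Ep px]]].
  move=> /existsNP[q /not_implyP[Gq qx]].
  have /eqP : meval (fun i => c x 0 i) (p * q) = 0.
    by apply: xEG; exists p => //; exists q.
  by rewrite mevalM mulf_eq0 => /orP[] /eqP.
Qed.

Let zariski_open_bigU (I : Type) (U : I -> set (zariski_space S c)) :
  (forall i, zariski_open (U i)) -> zariski_open (\bigcup_i U i).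
Proof.
move=> Uo; have /choice[E EU] i : exists E : set (mpoly m F),
    (forall p, E p -> p \is a mpolyOver m S) /\ ~` U i = zero_locus E.
  by have [E ES UE] := Uo i; exists E.
exists (\bigcup_i E i); first by move=> p [i _]; exact: (EU i).1.
rewrite setC_bigcup; apply/seteqP; split=> [x Ux p [i _ Ep]|x xE i _].
  by have := Ux i Logic.I; rewrite (EU i).2; exact.
by rewrite (EU i).2 => p Ep; apply: xE; exists i.
Qed.

HB.instance Definition _ := @isOpenTopological.Build (zariski_space S c)
  zariski_open zariski_openT zariski_openI zariski_open_bigU.

End Zariski.

Section GLZariski.
Variables (k : fieldType) (N : nat).
Local Notation K := (laurent k).

Definition GL : set 'M[K]_N := [set M | M \in unitmx].

Definition coord_K (M : 'M[K]_N) : 'rV[K]_(N * N) := mxvec M.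

(* Restriction of scalars along K / K^sigma, in the basis (1, h) of K:
   x = (x + sigma x) / 2 + h * ((x - sigma x) / (2 h)). *)
Definition coord_Ksigma (M : 'M[K]_N) : 'rV[K]_(N * N + N * N) :=
  row_mx (mxvec (2^-1 *: (M + map_mx (@sigma k) M)))
         (mxvec ((2 * tolaurent (fps_h k))^-1 *: (M - map_mx (@sigma k) M))).

Definition zariski_K : topologicalType := zariski_space (@Kfull k) coord_K.
Definition zariski_Ksigma : topologicalType :=
  zariski_space (@Ksigma k) coord_Ksigma.

(* A Zariski closed subset of GL_N is the trace of one of M_N: the denominators
   det^-1 can be cleared. *)
Definition zclosure_K (A : set 'M[K]_N) : set 'M[K]_N :=
  GL `&` closure (A : set zariski_K).
Definition zclosure_Ksigma (A : set 'M[K]_N) : set 'M[K]_N :=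
  GL `&` closure (A : set zariski_Ksigma).

Definition unitary_sigma : set 'M[K]_N :=
  [set M | GL M /\ M *m (map_mx (@sigma k) M)^T = 1%:M].

(* Algebraic groups over K^sigma are identified with their groups of
   K^sigma-points, which are subgroups of GL_N(K). *)
Definition identity_component_Ksigma (A : set 'M[K]_N) : set 'M[K]_N :=
  connected_component (A : set zariski_Ksigma) (1%:M : 'M[K]_N).

End GLZariski.

(* k<<L>>, the degree completion of the free associative k-algebra on L; an
   element is given by its coefficients on the words in L. *)
Definition nc_series (k : fieldType) (L : Type) : Type := seq L -> k.

HB.instance Definition _ (k : fieldType) (L : Type) :=
  GRing.Lmodule.copy (nc_series k L) (seq L -> k^o).

Section NCSeries.
Variables (k : fieldType) (L : eqType).
Local Notation A := (nc_series k L).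
Implicit Types (a b c : A) (w : seq L).

Definition nc_one : A := fun w => (size w == 0)%:R.
Definition nc_mul a b : A :=
  fun w => \sum_(i < (size w).+1) a (take i w) * b (drop i w).

Lemma nc_mulA : associative nc_mul.
Proof.
move=> a b c; apply/funext => w; set n := size w.
pose G i m := a (take i w) * (b (take (m - i) (drop i w)) * c (drop m w)).
transitivity (\sum_(0 <= i < n.+1) \sum_(0 <= m < n.+1 | (i <= m)%N) G i m).
  rewrite big_mkord; apply: eq_bigr => i _.
  have le_in : (i <= n)%N by rewrite -ltnS.
  rewrite -[RHS](@big_nat_widenl _ _ _ i 0 n.+1 xpredT) //.
  transitivity (\sum_(0 + i <= m < n.+1) G i m) => //; rewrite big_addn subSn // -(size_drop i w) big_mkord mulr_sumr.
  by apply: eq_bigr => j _; rewrite /G addnK drop_drop.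
rewrite (exchange_big_dep_nat xpredT) //= big_mkord; apply: eq_bigr => m _.
have le_mn : (m <= n)%N by rewrite -ltnS.
rewrite -(@big_nat_widen _ _ _ 0 m.+1 n.+1 xpredT) // big_mkord.
rewrite /nc_mul size_takel // mulr_suml; apply: eq_bigr => i _.
have le_im : (i <= m)%N by rewrite -ltnS.
by rewrite /G mulrA take_takel // take_drop subnK.
Qed.

Lemma nc_mul1l : left_id nc_one nc_mul.
Proof.
move=> a; apply/funext => w; rewrite /nc_mul big_ord_recl take0 drop0 mul1r.
rewrite big1 ?addr0 // => i _.
by rewrite /nc_one size_takel ?ltn_ord //= mul0r.
Qed.

Lemma nc_mul1r : right_id nc_one nc_mul.
Proof.
move=> a; apply/funext => w; rewrite /nc_mul big_ord_recr take_size drop_size.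
rewrite mulr1 big1 => [|i _]; first exact: add0r.
by rewrite /nc_one size_drop subn_eq0 leqNgt /= ltn_ord mulr0.
Qed.

Lemma nc_mulDl : left_distributive nc_mul +%R.
Proof.
move=> a b c; apply/funext => w.
transitivity (nc_mul a c w + nc_mul b c w) => //.
by rewrite -big_split; apply: eq_bigr => i _; exact: mulrDl.
Qed.

Lemma nc_mulDr : right_distributive nc_mul +%R.
Proof.
move=> a b c; apply/funext => w.
transitivity (nc_mul a b w + nc_mul a c w) => //.
by rewrite -big_split; apply: eq_bigr => i _; exact: mulrDr.
Qed.

Lemma nc_1neq0 : nc_one != 0 :> A.
Proof. by apply/eqP => /(congr1 (@^~ [::])) /= /eqP; rewrite oner_eq0. Qed.

HB.instance Definition _ := GRing.Zmodule_isNzRing.Build A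
  nc_mulA nc_mul1l nc_mul1r nc_mulDl nc_mulDr nc_1neq0.

Definition nc_letter (s : L) : A := fun w => (w == [:: s])%:R.

Definition homogeneous_part (d : nat) a : A :=
  fun w => if size w == d then a w else 0.

(* Used only for a without constant term, in which case (a ^+ m) w = 0 as soon
   as m > size w. *)
Definition nc_exp a : A :=
  fun w => \sum_(m < (size w).+1) (m`!%:R)^-1 * (a ^+ m) w.

Inductive lie_polynomial : A -> Prop :=
| Lie0 : lie_polynomial 0
| LieLetter s : lie_polynomial (nc_letter s)
| LieAdd a b : lie_polynomial a -> lie_polynomial b -> lie_polynomial (a + b)
| LieScale (x : k) a : lie_polynomial a -> lie_polynomial (x *: a)
| LieBracket a b : lie_polynomial a -> lie_polynomial b ->
    lie_polynomial (a * b - b * a).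

Definition lie_series a : Prop :=
  forall d, lie_polynomial (homogeneous_part d a).

Inductive ideal_span (r : set A) : A -> Prop :=
| Ideal0 : ideal_span r 0
| IdealGen a : r a -> ideal_span r a
| IdealAdd a b : ideal_span r a -> ideal_span r b -> ideal_span r (a + b)
| IdealMul a b c : ideal_span r b -> ideal_span r (a * b * c).

Definition closed_ideal (r : set A) a : Prop :=
  forall d, ideal_span r (homogeneous_part d a).

End NCSeries.

Definition Cplx (R : realType) : numClosedFieldType := R[i].

Section Paths.
Variables (R : realType) (T : topologicalType).
Implicit Types (A : set T) (x y : T) (g : R -> T).

(* A path is parametrised by [0, 1]; its values outside [0, 1] are
   irrelevant. *)
Definition is_path A x y g : Prop :=
  [/\ {within `[0, 1], continuous g}, g @` `[0, 1] `<=` A, g 0 = x & g 1 = y].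

Definition path_concat g1 g2 : R -> T :=
  fun t => if t <= 2^-1 then g1 (2 * t) else g2 (2 * t - 1).

Definition path_rev g : R -> T := fun t => g (1 - t).

Definition path_homotopic A g1 g2 : Prop :=
  exists H : R * R -> T,
    [/\ {within `[0, 1] `*` `[0, 1], continuous H},
        H @` (`[0, 1] `*` `[0, 1]) `<=` A,
        forall t, t \in `[0, 1] -> H (0, t) = g1 t /\ H (1, t) = g2 t
      & forall u, u \in `[0, 1] -> H (u, 0) = g1 0 /\ H (u, 1) = g1 1].

End Paths.

Section ReflectionGroup.
Variables (R : realType) (gT : finGroupType) (n : nat).
(* W is the finite group [set: gT], acting on column vectors through V. *)
Variable V : mx_representation (Cplx R) [set: gT]%SET n.
Local Notation C := (Cplx R).
Local Notation Cn := 'cV[C]_n.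

Definition reflections : {set gT} :=
  [set s | \rank (V s - 1%:M) == 1%N]%SET.

(* The row space of this matrix is the space of transposes of vectors of
   Ker(s - 1). *)
Definition hyperplane (s : gT) : 'M[C]_n := eigenspace (V s)^T 1.

Definition is_2reflection_group : Prop :=
  mx_faithful V /\ <<[set s in reflections | #[s]%g == 2]%SET>>%g = [set: gT]%SET.

Definition hyp_complement : set Cn :=
  [set x | forall s, s \in reflections -> V s *m x <> x].

Definition orbit_rel : rel Cn := fun x y => [exists w, y == V w *m x].

Lemma orbit_rel_refl : reflexive orbit_rel.
Proof. by move=> x; apply/existsP; exists 1%g; rewrite repr_mx1 mul1mx. Qed.

Lemma orbit_rel_sym : symmetric orbit_rel.
Proof.
suff imp x y : orbit_rel x y -> orbit_rel y x.
  by move=> x y; apply/idP/idP; exact: imp.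
move=> /existsP[w /eqP->]; apply/existsP; exists (w^-1)%g.
by rewrite mulmxA -repr_mxM ?inE // mulVg repr_mx1 mul1mx.
Qed.

Lemma orbit_rel_trans : transitive orbit_rel.
Proof.
move=> y x z /existsP[w /eqP->] /existsP[w' /eqP->].
by apply/existsP; exists (w' * w)%g; rewrite mulmxA -repr_mxM ?inE.
Qed.

Canonical orbit_equiv :=
  EquivRel orbit_rel orbit_rel_refl orbit_rel_sym orbit_rel_trans.

Definition orbit_space : topologicalType :=
  quotient_topology {eq_quot orbit_equiv}%qT.

Definition orbit_proj (x : Cn) : orbit_space :=
  (\pi_(quotient_topology {eq_quot orbit_equiv}%qT) x)%qT.

(* X / W, an open subset of C^n / W. *)
Definition hyp_complement_quotient : set orbit_space :=
  orbit_proj @` hyp_complement.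

Variable x0 : Cn.

(* Representatives of the elements of B = pi_1(X / W, x0). The product of B is
   induced by path_concat; with the action on the left, the loop which is the
   image of a path of X from x0 to w x0 maps to w under B -> W. *)
Definition braid_loop : set (R -> orbit_space) :=
  is_path hyp_complement_quotient (orbit_proj x0) (orbit_proj x0).

Definition braid_homotopic : (R -> orbit_space) -> (R -> orbit_space) -> Prop :=
  path_homotopic hyp_complement_quotient.

(* The image of P = pi_1(X, x0) in B. *)
Definition pure_braid_loop : set (R -> orbit_space) :=
  [set b | braid_loop b /\ exists g : R -> Cn,
     is_path hyp_complement x0 x0 g /\ braid_homotopic b (orbit_proj \o g)].

Definition half_turn (z v : Cn) : R -> Cn :=
  fun t => z + ((cos (pi * t) +i* sin (pi * t))%C : C) *: v.

(* z is a point of Ker(s - 1) on no other reflecting hyperplane, v spans the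
   line Im(s - 1), and g goes from x0 to z + v, close to z: the disc
   z + D v meets the arrangement in z only. *)
Definition braided_reflection (s : gT) (b : R -> orbit_space) : Prop :=
  s \in reflections /\ braid_loop b /\
  exists (z v : Cn) (g : R -> Cn),
    [/\ V s *m z = z,
        V s *m v = - v,
        forall l : C, 0 < `|l| <= 1 -> hyp_complement (z + l *: v),
        forall r, r \in reflections -> V r *m z = z ->
          (hyperplane r :=: hyperplane s)%MS
      & is_path hyp_complement x0 (z + v) g /\
        braid_homotopic b (orbit_proj \o
          path_concat (path_concat g (half_turn z v))
                      (path_rev (fun t => V s *m g t)))].

Definition refl : Type := {s : gT | s \in reflections}.

HB.instance Definition _ := Finite.on refl.

Lemma reflectionsJ (s w : gT) : (s ^ w \in reflections)%g = (s \in reflections).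
Proof.
rewrite !inE; have -> : V (s ^ w)%g - 1%:M = V (w^-1)%g *m (V s - 1%:M) *m V w.
  rewrite mulmxBr mulmxBl mulmx1 -!repr_mxM ?inE // mulVg repr_mx1.
  by rewrite -mulgA -conjgE.
have fw u : row_full (V u) by rewrite row_full_unit repr_mx_unit ?inE.
have ff u : row_free (V u) by rewrite row_free_unit repr_mx_unit ?inE.
by rewrite mxrankMfree // eqmxMfull.
Qed.

Definition refl_conj (w : gT) (s : refl) : refl :=
  exist _ (val s ^ w)%g (etrans (reflectionsJ (val s) w) (valP s)).

Variable k : fieldType.
Local Notation A := (nc_series k refl).
Local Notation t_ := (@nc_letter k refl).

(* The defining relations of T, indexed by families F of reflections for which
   the intersection Z of the Ker(a - 1), a in F, has codimension 2. *)
Definition holonomy_relation : set A :=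
  [set r | exists (F : {set refl}) (s : refl),
     let Z := (\bigcap_(a in F) hyperplane (val a))%MS in
     let S := \sum_(u : refl | (Z <= hyperplane (val u))%MS) t_ u in
     [/\ ((\rank Z).+2 = n)%N, (Z <= hyperplane (val s))%MS
       & r = t_ s * S - S * t_ s]].

(* The completed enveloping algebra of T is the quotient of k<<t_s>> by the
   closed ideal generated by the relations. It is handled through this
   congruence. By the Poincare-Birkhoff-Witt theorem T^ is the image in it of
   the Lie series. *)
Definition holonomy_cong (a b : A) : Prop :=
  closed_ideal holonomy_relation (a - b).

Definition in_exp_holonomy (a : A) : Prop :=
  exists2 x : A, lie_series x & holonomy_cong a (nc_exp x).

(* w . t_s = t_(w s w^-1) *)
Definition W_act (w : gT) (a : A) : A := fun u => a (map (refl_conj w) u).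

(* (w, a) stands for the product w a in W |x U(T)^, hence
   (w a) (w' a') = (w w') (w'^-1 . a) a'. *)
Definition sd_mul (p q : gT * A) : gT * A :=
  ((p.1 * q.1)%g, W_act q.1^-1%g p.2 * q.2).

Definition sd_cong (p q : gT * A) : Prop :=
  p.1 = q.1 /\ holonomy_cong p.2 q.2.

(* A morphism B -> W |x exp(T^), given on representatives of both sides. The
   last clause is Phi(b) g = g s exp(t_s) with g in exp(T^). *)
Definition holonomy_morphism (Phi : (R -> orbit_space) -> gT * A) : Prop :=
  [/\ forall b, braid_loop b -> in_exp_holonomy (Phi b).2,
      forall b c, braid_loop b -> braid_loop c -> braid_homotopic b c ->
        sd_cong (Phi b) (Phi c),
      forall b c, braid_loop b -> braid_loop c ->
        sd_cong (Phi (path_concat b c)) (sd_mul (Phi b) (Phi c))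
    & forall (s : refl) b, braided_reflection (val s) b ->
        exists2 x : A, lie_series x &
          sd_cong (sd_mul (Phi b) (1%g, nc_exp x))
                  (sd_mul (1%g, nc_exp x) (val s, nc_exp (t_ s)))].

Variables (N : nat) (rho : mx_representation k [set: gT]%SET N).

(* The extension of t_s |-> h rho(s) to series. *)
Definition series_rep (a : A) : 'M[fps k]_N :=
  \matrix_(i, j) fun d => \sum_(w : d.-tuple refl)
    a w * (\big[mulmx/1%:M]_(s <- w) rho (val s)) i j.

Definition sd_rep (p : gT * A) : 'M[laurent k]_N :=
  map_mx (@tolaurent k)
    (map_mx (@fps_const k) (rho p.1) *m series_rep p.2).

Definition orthogonal_rep : Prop := forall w : gT, (rho w)^T *m rho w = 1%:M.

End ReflectionGroup.

(* Main.v *)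
From HB Require Import structures.
Require Import Defs.
From mathcomp Require Import all_boot all_order all_algebra all_fingroup all_character.
From mathcomp Require Import complex generic_quotient.
From mathcomp Require Import all_classical all_reals all_analysis.
From mathcomp.multinomials Require mpoly.
From mathcomp Require Import ring lra.

Set Implicit Arguments.
Unset Strict Implicit.
Unset Printing Implicit Defensive.

Import Order.TTheory GRing.Theory Num.Theory.
Import numFieldNormedType.Exports.
Local Open Scope classical_set_scope.
Local Open Scope ring_scope.

(* The image of P in W must first be shown trivial, from the meridian relations
   alone. Since W is generated by reflections of order 2, each of them is
   x |-> x - 2 u_s(x) v_s for a linear form u_s normalised by u_s(x0) = 1. The
   cones where all Re(theta_s u_s) are positive are convex, so that transport
   along segments of X defines a cocycle; the half turns show that it extends
   across each half hyperplane u_s < 0, hence that it is a coboundary.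

   For a Lie series x, Psi(exp x) is unitary, since t |-> - t on letters extends
   to an antiautomorphism which is - id on Lie series and which the orthogonal
   representation turns into the transpose of sigma. Hence Psi(P) lies in U. On
   U the coordinates of sigma(A) = (tA)^-1 are rational in those of A, so the
   closure of Psi(P) over K^sigma is the trace on U of its closure over K.
   Finally every element g of Psi(P) is 1 modulo h: the coefficients of the
   entries of g^n are polynomial in n, so that a polynomial equation satisfied
   by infinitely many powers of g holds for all of them. The powers of g thus
   form a connected set containing 1, and Psi(P) is a union of such sets. *)

(** The hypothesis on [Phi] prescribes its component in W on braided reflections only, so its
    triviality on P is a topological statement. Instead of exhibiting generators of P, the proof
    builds a potential: a function [E] on X with [T c c' * E c' = E c] for nearby points, where [T]
    is transport along segments. Following [E] along a loop of X shows that its transport is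
    trivial. Since the segment from [c] to [x0] may meet the arrangement, [E c] is read off at a
    generic point near [c]. The normalisation u_s(x0) = 1 keeps this elementary. Translation by i y
    x0 adds y to all imaginary parts simultaneously; from a point where these are nonzero, and
    distinct for distinct forms, the half hyperplanes are therefore met one form at a time, and each
    crossing is a computation in the plane of values of a single form. On the algebraic side,
    K^sigma-polynomials and K-polynomials are compared on U only, where a power of the determinant
    clears denominators. Characteristic 0 enters through the factorials of the exponential and
    through the infinitely many integers of k, on which a nonzero polynomial cannot vanish. *)

(** * Continuity on the unit interval and the unit square *)

Section ContinuousGluing.
Variable R : realType.

Lemma continuous_pair (S T U : topologicalType) (f : S -> T) (g : S -> U) :
  continuous f -> continuous g -> continuous (fun x => (f x, g x)).
Proof. by move=> cf cg x; apply: (cvg_pair (cf x) (cg x)). Qed.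

Lemma continuous_glue (S T : topologicalType) (h : S -> R) (c : R)
    (f g : S -> T) :
  continuous h -> continuous f -> continuous g ->
  (forall x, h x = c -> f x = g x) ->
  continuous (fun x => if h x <= c then f x else g x).
Proof.
move=> ch cf cg fg; set k := fun x => _.
suff : {within (h @^-1` [set t | t <= c]) `|` (h @^-1` [set t | c <= t]),
    continuous k}.
  have -> : h @^-1` [set t | t <= c] `|` h @^-1` [set t | c <= t] = setT.
    by apply/seteqP; split=> // x _ /=; case: (lerP (h x) c); [left|right; exact: ltW].
  by rewrite continuous_subspace_setT.
apply: withinU_continuous.
- by apply: closed_comp => [x _|]; [exact: ch|exact: closed_le].
- by apply: closed_comp => [x _|]; [exact: ch|exact: closed_ge].
- apply: (@subspace_eq_continuous _ _ _ f); last exact: continuous_subspaceT.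
  by move=> x; rewrite inE /from_subspace /k /= => ->.
- apply: (@subspace_eq_continuous _ _ _ g); last exact: continuous_subspaceT.
  move=> x; rewrite inE /from_subspace /k /= => cx; case: ifP => // hc.
  by rewrite fg //; apply/eqP; rewrite eq_le hc cx.
Qed.

Lemma continuous_maxr (f g : R -> R) : continuous f -> continuous g ->
  continuous (fun t => Num.max (f t) (g t)).
Proof. by move=> cf cg t; apply: continuous_max; [exact: cf|exact: cg]. Qed.

Lemma continuous_minr (f g : R -> R) : continuous f -> continuous g ->
  continuous (fun t => Num.min (f t) (g t)).
Proof. by move=> cf cg t; apply: continuous_min; [exact: cf|exact: cg]. Qed.

(** Composing with this retraction of the line onto the unit interval turns continuity on a subspace
    into continuity on the whole line, where the gluing lemmas for total functions apply. *)
Definition clamp (t : R) : R := Num.max 0 (Num.min 1 t).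

Lemma clamp01 t : clamp t \in `[0, 1].
Proof.
rewrite in_itv /= /clamp le_max lexx /= ge_max ler01 ge_min lexx //.
Qed.

Lemma clampE t : t \in `[0, 1] -> clamp t = t.
Proof.
rewrite in_itv /= => /andP[t0 t1]; rewrite /clamp.
by rewrite (min_idPr t1) (max_idPr t0).
Qed.

Lemma continuous_clamp : continuous clamp.
Proof.
apply: continuous_maxr; first exact: cst_continuous.
by apply: continuous_minr; [exact: cst_continuous|move=> t; exact: cvg_id].
Qed.

Lemma within01P (T : topologicalType) (p : R -> T) :
  {within `[0, 1], continuous p} <-> continuous (p \o clamp).
Proof.
split=> [cp t|cp].
  apply: (@cvg_comp _ _ _ clamp p _ (nbhs (clamp t : subspace `[0, 1]))); last exact: cp.
  apply/subspace_cvgP; first exact: clamp01.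
  move=> A; rewrite /= withinE => -[B tB AB].
  have tcB : nbhs t (clamp @^-1` B) by exact: continuous_clamp.
  apply: (@filterS _ (nbhs t) _ (clamp @^-1` B) (clamp @^-1` A)) tcB => s Bs.
  have : (A `&` `[0, 1]) (clamp s) by rewrite AB; split=> //; exact: clamp01.
  by case.
apply: (@subspace_eq_continuous _ _ _ (p \o clamp)).
  by move=> t; rewrite inE /= => t01; rewrite clampE.
exact: continuous_subspaceT.
Qed.

Lemma within_square (T : topologicalType) (H : R * R -> T) :
  {within `[0, 1] `*` `[0, 1], continuous H} <->
  continuous (fun x => H (clamp x.1, clamp x.2)).
Proof.
pose c2 (x : R * R) := (clamp x.1, clamp x.2).
have cc2 : continuous c2.
  apply: continuous_pair => x.
    apply: continuous_comp; [exact: cvg_fst|exact: continuous_clamp].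
  apply: continuous_comp; [exact: cvg_snd|exact: continuous_clamp].
have c2J x : (`[0, 1] `*` `[0, 1]) (c2 x) by split; exact: clamp01.
split=> [cp t|cp].
  apply: (@cvg_comp _ _ _ c2 H _ (nbhs (c2 t : subspace (`[0, 1] `*` `[0, 1])))); last exact: cp.
  apply/subspace_cvgP; first exact: c2J.
  move=> A; rewrite /= withinE => -[B tB AB].
  have tcB : nbhs t (c2 @^-1` B) by exact: cc2.
  apply: (@filterS _ (nbhs t) _ (c2 @^-1` B) (c2 @^-1` A)) tcB => s Bs.
  have : (A `&` (`[0, 1] `*` `[0, 1])) (c2 s) by rewrite AB; split=> //; exact: c2J.
  by case.
apply: (@subspace_eq_continuous _ _ _ (H \o c2)).
  by move=> [t u]; rewrite inE /c2 /= => -[/= t01 u01]; rewrite !clampE.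
exact: continuous_subspaceT.
Qed.

End ContinuousGluing.

(** * Homotopies of paths *)

Section PathHomotopy.
Variables (R : realType) (T : topologicalType) (A : set T).
Local Notation J := (`[0, 1]%classic : set R).
Local Notation homotopic := (@path_homotopic R T A).
Implicit Types (p q : R -> T) (H F G : R * R -> T).

Lemma mem01P (t : R) : reflect (0 <= t <= 1) (t \in `[0, 1]).
Proof. by rewrite in_itv /=; apply: idP. Qed.

Let half1 : (1 <= 2^-1 :> R) = false.
Proof. by apply/negP; lra. Qed.

Lemma within_square_swap F : {within J `*` J, continuous F} ->
  {within J `*` J, continuous (fun x => F (x.2, x.1))}.
Proof.
rewrite !within_square => cF x.
apply: (@continuous_comp _ _ _ (fun x => (x.2, x.1))
  (fun x => F (clamp x.1, clamp x.2))); last exact: cF.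
by apply: continuous_pair => y; [exact: cvg_snd|exact: cvg_fst].
Qed.

Lemma within_square_comp p (r : R * R -> R) : {within J, continuous p} ->
  {within J `*` J, continuous r} -> (forall x, (J `*` J) x -> r x \in `[0, 1]) ->
  {within J `*` J, continuous (p \o r)}.
Proof.
rewrite within01P !within_square => cp cr rJ x.
have -> : (fun x => (p \o r) (clamp x.1, clamp x.2)) =
          (p \o @clamp R) \o (fun x => r (clamp x.1, clamp x.2)).
  apply/funext => y /=; rewrite (clampE (rJ _ _)) //.
  by split; exact: clamp01.
by apply: continuous_comp; [exact: cr|exact: cp].
Qed.

Lemma within_square_slice F u : u \in `[0, 1] ->
  {within J `*` J, continuous F} -> {within J, continuous (fun t => F (u, t))}.
Proof.
move=> uJ; rewrite within_square within01P => cF x.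
have -> : (fun t => F (u, t)) \o @clamp R =
          (fun x => F (clamp x.1, clamp x.2)) \o (fun t => (u, t)).
  by apply/funext => y /=; rewrite (clampE uJ).
apply: continuous_comp; last exact: cF.
by apply: continuous_pair => y; [exact: cst_continuous|exact: cvg_id].
Qed.

(** This serves twice: as it stands it concatenates homotopies along the path variable, and after a
    swap of coordinates it composes them along the deformation variable. *)
Lemma within_square_glue F G :
  {within J `*` J, continuous F} -> {within J `*` J, continuous G} ->
  (forall u, u \in `[0, 1] -> F (u, 1) = G (u, 0)) ->
  {within J `*` J, continuous
    (fun x => if x.2 <= 2^-1 then F (x.1, 2 * x.2) else G (x.1, 2 * x.2 - 1))}.
Proof.
rewrite !within_square => cF cG FG.
pose F' := (fun x : R * R => F (clamp x.1, clamp x.2)).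
pose G' := (fun x : R * R => G (clamp x.1, clamp x.2)).
have cc2 : continuous (fun x : R * R => clamp x.2).
  by move=> x; apply: continuous_comp; [exact: cvg_snd|exact: continuous_clamp].
have c2 : continuous (fun x : R * R => 2 * clamp x.2).
  by move=> x; apply: cvgM; [exact: cvg_cst|exact: cc2].
rewrite [X in continuous X](_ : _ = fun x =>
  if clamp x.2 <= 2^-1 then F' (x.1, 2 * clamp x.2) else G' (x.1, 2 * clamp x.2 - 1)).
  apply: continuous_glue => //.
  - move=> x; apply: (@continuous_comp _ _ _ (fun x => (x.1, 2 * clamp x.2)) F'); last exact: cF.
    by apply: continuous_pair => // y; exact: cvg_fst.
  - move=> x; apply: (@continuous_comp _ _ _ (fun x => (x.1, 2 * clamp x.2 - 1)) G'); last exact: cG.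
    apply: continuous_pair => y; first exact: cvg_fst.
    by apply: cvgB; [exact: c2|exact: cvg_cst].
  - move=> x ->; rewrite mulfV ?subrr // /F' /G' /=.
    rewrite !(clampE (t := 1)) ?(clampE (t := 0)) ?FG ?clamp01 //;
      by apply/mem01P; lra.
apply/funext => x; rewrite /F' /G' /=.
have /mem01P := clamp01 x.2; move: (clamp x.2) => t t01.
move: (clamp x.1) => u.
by case: (lerP t 2^-1) => ht; rewrite clampE //; apply/mem01P; lra.
Qed.

Lemma within_square_snd p : {within J, continuous p} ->
  {within J `*` J, continuous (fun x => p x.2)}.
Proof.
move=> cp; apply: (@within_square_comp p snd) => // [|[u t] []] //.
by apply: continuous_subspaceT => x; exact: cvg_snd.
Qed.

Lemma path_homotopic_eq p q : {within J, continuous p} ->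
  (forall t, t \in `[0, 1] -> A (p t)) ->
  (forall t, t \in `[0, 1] -> p t = q t) -> homotopic p q.
Proof.
move=> cp pA pq; exists (fun x => p x.2); split.
- exact: within_square_snd.
- by move=> _ [[u t] [_ /= t01] <-]; exact: pA.
- by move=> t t01; rewrite pq.
- by move=> u u01; split.
Qed.

Lemma path_homotopic_sym p q : p 0 = q 0 -> p 1 = q 1 ->
  homotopic p q -> homotopic q p.
Proof.
move=> pq0 pq1 [H [cH HA H01 Hpq]].
have r01 (u : R) : u \in `[0, 1] -> 1 - u \in `[0, 1].
  by move=> /mem01P ?; apply/mem01P; lra.
exists (fun x => H (1 - x.1, x.2)); split.
- rewrite !within_square in cH *.
  rewrite [X in continuous X](_ : _ = (fun x => H (clamp x.1, clamp x.2)) \o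
     (fun x : R * R => (1 - clamp x.1, x.2))); last first.
    by apply/funext => x /=; rewrite (@clampE _ (1 - _)) // r01 // clamp01.
  move=> x; apply: continuous_comp; last exact: cH.
  apply: continuous_pair => y; last exact: cvg_snd.
  apply: cvgB; first exact: cvg_cst.
  by apply: (@continuous_comp _ _ _ fst (@clamp R)); [exact: cvg_fst|exact: continuous_clamp].
- move=> _ [[u t] [/= u01 t01] <-]; apply: HA; exists (1 - u, t) => //.
  by split=> //=; exact: r01.
- by move=> t t01; rewrite subrr subr0; have [] := H01 t t01.
- by move=> u u01; rewrite -pq0 -pq1; apply: Hpq; exact: r01.
Qed.

Lemma path_homotopic_trans p q r : q 0 = p 0 -> q 1 = p 1 ->
  homotopic p q -> homotopic q r -> homotopic p r.
Proof.
move=> qp0 qp1 [F [cF FA F01 Fpq]] [G [cG GA G01 Gpq]].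
have FG u : u \in `[0, 1] -> F (1, u) = G (0, u).
  by move=> u01; rewrite (F01 u u01).2 (G01 u u01).1.
have /within_square_swap cH :=
  within_square_glue (within_square_swap cF) (within_square_swap cG) FG.
eexists; split; first exact: cH.
- move=> _ [[u t] [/= /mem01P u01 t01] <-]; case: (lerP u 2^-1) => hu.
    by apply: FA; exists (2 * u, t) => //; split=> //=; apply/mem01P; lra.
  by apply: GA; exists (2 * u - 1, t) => //; split=> //=; apply/mem01P; lra.
- move=> t t01 /=; rewrite invr_ge0 ler0n mulr0 mulr1.
  rewrite half1.
  by rewrite (_ : 2 - 1 = 1) ?(F01 t t01).1 ?(G01 t t01).2 //; lra.
- move=> u /mem01P u01 /=; case: (lerP u 2^-1) => hu.
    by apply: Fpq; apply/mem01P; lra.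
  by rewrite -qp0 -qp1; apply: Gpq; apply/mem01P; lra.
Qed.

Lemma path_homotopic_concat p p' q q' : p 1 = q 0 ->
  homotopic p p' -> homotopic q q' ->
  homotopic (path_concat p q) (path_concat p' q').
Proof.
move=> pq [F [cF FA F01 Fpq]] [G [cG GA G01 Gpq]].
have FG u : u \in `[0, 1] -> F (u, 1) = G (u, 0).
  by move=> u01; rewrite (Fpq u u01).2 (Gpq u u01).1.
have cH := within_square_glue cF cG FG.
eexists; split; first exact: cH.
- move=> _ [[u t] [/= u01 /mem01P t01] <-]; case: (lerP t 2^-1) => ht.
    by apply: FA; exists (u, 2 * t) => //; split=> //=; apply/mem01P; lra.
  by apply: GA; exists (u, 2 * t - 1) => //; split=> //=; apply/mem01P; lra.
- move=> t /mem01P t01 /=; rewrite /path_concat; case: (lerP t 2^-1) => ht.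
    by apply: F01; apply/mem01P; lra.
  by apply: G01; apply/mem01P; lra.
- move=> u u01 /=; rewrite /path_concat invr_ge0 ler0n mulr0 mulr1.
  rewrite half1.
  rewrite (_ : 2 - 1 = 1); last by lra.
  by rewrite (Fpq u u01).1 (Gpq u u01).2.
Qed.

(** The interval is convex, so the linear interpolation between the two parameters stays inside
    it. *)
Lemma path_homotopic_reparam p (r1 r2 : R -> R) :
  {within J, continuous p} -> (forall t, t \in `[0, 1] -> A (p t)) ->
  continuous r1 -> continuous r2 ->
  (forall t, t \in `[0, 1] -> r1 t \in `[0, 1] /\ r2 t \in `[0, 1]) ->
  r1 0 = r2 0 -> r1 1 = r2 1 -> homotopic (p \o r1) (p \o r2).
Proof.
move=> cp pA c1 c2 r01 r0 r1E.
pose r (x : R * R) := (1 - x.1) * r1 x.2 + x.1 * r2 x.2.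
have rJ x : (J `*` J) x -> r x \in `[0, 1].
  case: x => u t [/= /mem01P u01 t01].
  have [/mem01P h1 /mem01P h2] := r01 t t01; apply/mem01P; rewrite /r /=; nra.
exists (p \o r); split.
- apply: within_square_comp => //; apply: continuous_subspaceT => x.
  apply: cvgD; apply: cvgM.
  - by apply: cvgB; [exact: cvg_cst|exact: cvg_fst].
  - by apply: continuous_comp; [exact: cvg_snd|exact: c1].
  - exact: cvg_fst.
  - by apply: continuous_comp; [exact: cvg_snd|exact: c2].
- by move=> _ [x xJ <-]; apply: pA; exact: rJ.
- by move=> t t01; rewrite /r /= subr0 subrr !mul1r !mul0r addr0 add0r.
- move=> u u01; rewrite /r /= -r0 -r1E -!mulrDl; split; congr p; ring.
Qed.

Lemma is_path_concat x y z p q : is_path A x y p -> is_path A y z q ->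
  is_path A x z (path_concat p q).
Proof.
move=> [cp pA p0 p1] [cq qA q0 q1]; split.
- have := within_square_glue (within_square_snd cp) (within_square_snd cq).
  move=> /(_ (fun _ _ => etrans p1 (esym q0))).
  by move/(@within_square_slice _ 0); apply; apply/mem01P; lra.
- move=> _ [t /mem01P t01 <-]; rewrite /path_concat; case: (lerP t 2^-1) => ht.
    by apply: pA; exists (2 * t) => //; apply/mem01P; lra.
  by apply: qA; exists (2 * t - 1) => //; apply/mem01P; lra.
- by rewrite /path_concat invr_ge0 ler0n mulr0.
- rewrite /path_concat mulr1 half1.
  by rewrite (_ : 2 - 1 = 1) //; lra.
Qed.

Lemma is_path_comp x y p (r : R -> R) : is_path A x y p -> continuous r ->
  (forall t, t \in `[0, 1] -> r t \in `[0, 1]) ->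
  is_path A (p (r 0)) (p (r 1)) (p \o r).
Proof.
move=> [cp pA p0 p1] cr rJ; split=> //.
  apply: (@within_square_slice (p \o (r \o snd)) 0); first by apply/mem01P; lra.
  apply: within_square_comp => //; last by move=> [u t] [] /= _ /rJ.
  apply: continuous_subspaceT => v.
  by apply: continuous_comp; [exact: cvg_snd|exact: cr].
by move=> _ [t t01 <-]; apply: pA; exists (r t) => //; exact: rJ.
Qed.

Lemma continuous_onem : continuous (fun t : R => 1 - t).
Proof. by move=> t; apply: cvgB; [exact: cvg_cst|exact: cvg_id]. Qed.

Lemma is_path_rev x y p : is_path A x y p -> is_path A y x (path_rev p).
Proof.
move=> pP; have [_ _ p0 p1] := pP.
have := @is_path_comp _ _ _ (fun t => 1 - t) pP continuous_onem.
rewrite subr0 subrr p0 p1; apply.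
by move=> t /mem01P ?; apply/mem01P; lra.
Qed.

End PathHomotopy.

(** * The fundamental groupoid and the extension of a morphism from loops to paths *)

Section FundamentalGroupoid.
Variables (R : realType) (T : topologicalType) (A : set T).
Local Notation homotopic := (@path_homotopic R T A).
Local Notation path := (@is_path R T A).
Local Notation "p ** q" := (path_concat p q) (at level 40, left associativity).
Implicit Types (p q r : R -> T) (x y z w : T).

Definition path_equiv x y p q := [/\ path x y p, path x y q & homotopic p q].

Lemma path_mem x y p t : path x y p -> t \in `[0, 1] -> A (p t).
Proof. by move=> [_ pA _ _] t01; apply: pA; exists t. Qed.

Lemma path_equiv_ext x y p q : path x y p ->
  (forall t, t \in `[0, 1] -> p t = q t) -> path_equiv x y p q.
Proof.
move=> pP pq; have [cp pA p0 p1] := pP.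
split=> //; last by apply: path_homotopic_eq => // t; apply: path_mem pP.
split.
- apply: subspace_eq_continuous cp => t; rewrite inE; exact: pq.
- by move=> _ [t t01 <-]; rewrite -pq //; apply: path_mem pP _.
- by rewrite -p0 pq // in_itv /= lexx ler01.
- by rewrite -p1 pq // in_itv /= lexx ler01.
Qed.

Lemma path_equiv_refl x y p : path x y p -> path_equiv x y p p.
Proof. by move=> pP; apply: path_equiv_ext. Qed.

Lemma path_equiv_sym x y p q : path_equiv x y p q -> path_equiv x y q p.
Proof.
move=> [pP qP pq]; split=> //; have [_ _ p0 p1] := pP; have [_ _ q0 q1] := qP.
by apply: path_homotopic_sym pq; rewrite ?p0 ?p1.
Qed.

Lemma path_equiv_trans x y p q r :
  path_equiv x y p q -> path_equiv x y q r -> path_equiv x y p r.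
Proof.
move=> [pP qP pq] [_ rP qr]; split=> //.
have [_ _ p0 p1] := pP; have [_ _ q0 q1] := qP.
by apply: path_homotopic_trans pq qr; rewrite ?p0 ?p1.
Qed.

Lemma path_equiv_concat x y z p p' q q' :
  path_equiv x y p p' -> path_equiv y z q q' ->
  path_equiv x z (p ** q) (p' ** q').
Proof.
move=> [pP pP' pp] [qP qP' qq].
split; [exact: is_path_concat pP qP|exact: is_path_concat pP' qP'|].
have [_ _ _ p1] := pP; have [_ _ q0 _] := qP.
by apply: path_homotopic_concat pp qq; rewrite p1.
Qed.

(** Each groupoid law compares two reparametrisations of one path. The path [q] agrees with
    [p \o r1] only on the unit interval, because concatenations are defined by cases and take other
    values outside. *)
Lemma path_equiv_reparam x y p q (r1 r2 : R -> R) : path x y p ->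
  continuous r1 -> continuous r2 ->
  (forall t, t \in `[0, 1] -> r1 t \in `[0, 1] /\ r2 t \in `[0, 1]) ->
  r1 0 = r2 0 -> r1 1 = r2 1 ->
  (forall t, t \in `[0, 1] -> q t = p (r1 t)) ->
  path_equiv (q 0) (q 1) q (p \o r2).
Proof.
move=> pP c1 c2 r01 r0 r1E qE.
have J0 : (0 : R) \in `[0, 1] by rewrite in_itv /= lexx ler01.
have J1 : (1 : R) \in `[0, 1] by rewrite in_itv /= lexx ler01.
have h1 := is_path_comp pP c1 (fun t tJ => (r01 t tJ).1).
have h2 := is_path_comp pP c2 (fun t tJ => (r01 t tJ).2).
have q0 : q 0 = p (r1 0) by exact: qE.
have q1 : q 1 = p (r1 1) by exact: qE.
rewrite -{}q0 -{}q1 in h1; rewrite -r0 -r1E -!qE // in h2.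
apply: (@path_equiv_trans _ _ _ (p \o r1)).
  by apply: path_equiv_sym; apply: path_equiv_ext => // t tJ; rewrite qE.
split=> //; have [cp _ _ _] := pP.
by apply: path_homotopic_reparam => // t; apply: path_mem pP.
Qed.

Let continuous_affine (a b : R) : continuous (fun t : R => a * t + b).
Proof.
move=> t; apply: cvgD; last exact: cvg_cst.
by apply: cvgM; [exact: cvg_cst|exact: cvg_id].
Qed.

Lemma path_equiv_assoc x y z w p q r : path x y p -> path y z q -> path z w r ->
  path_equiv x w (p ** q ** r) (p ** (q ** r)).
Proof.
move=> pP qP rP; have [_ _ p0 p1] := pP; have [_ _ q0 q1] := qP; have [_ _ r0 r1] := rP.
have P1 := is_path_concat (is_path_concat pP qP) rP.
have P2 := is_path_concat pP (is_path_concat qP rP).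
(* The change of parameter between the two bracketings has slopes 1/2, 1, 2 and breaks at 1/2 and
   3/4. It is convex, hence the maximum of its three affine pieces. *)
pose rho (t : R) := Num.max (2^-1 * t + 0) (Num.max (1 * t - 4^-1) (2 * t - 1)).
have crho : continuous rho.
  apply: continuous_maxr; first exact: continuous_affine.
  by apply: continuous_maxr; exact: continuous_affine.
have [_ _ P20 P21] := P2.
apply: path_equiv_sym; rewrite -{1}P20 -{1}P21.
apply: (@path_equiv_reparam x w (p ** q ** r) (p ** (q ** r)) rho id) => //.
- by move=> ?; exact: cvg_id.
- move=> t /mem01P t01; split; last exact/mem01P.
  by apply/mem01P; rewrite /rho ge_max ge_max !le_max; lra.
- by rewrite /rho; case: (lerP (1 * _ - _) _) => ?; case: lerP => ?; lra.
- by rewrite /rho; case: (lerP (1 * _ - _) _) => ?; case: lerP => ?; lra.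
move=> t /mem01P t01.
have [h1|h1] := lerP t 2^-1.
  have -> : rho t = 2^-1 * t by rewrite /rho; case: (lerP (1 * _ - _) _) => ?; case: lerP => ?; lra.
  rewrite /path_concat h1 ifT; last lra.
  rewrite ifT; last lra.
  by congr p; lra.
have [h2|h2] := lerP t (4^-1 * 3).
  have -> : rho t = t - 4^-1 by rewrite /rho; case: (lerP (1 * _ - _) _) => ?; case: lerP => ?; lra.
  rewrite /path_concat ifF; last by apply/negP; lra.
  rewrite ifT; last lra.
  rewrite ifT; last lra.
  rewrite ifF; last by apply/negP; lra.
  by congr q; lra.
have -> : rho t = 2 * t - 1 by rewrite /rho; case: (lerP (1 * _ - _) _) => ?; case: lerP => ?; lra.
rewrite /path_concat ifF; last by apply/negP; lra.
rewrite ifF; last by apply/negP; lra.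
rewrite ifF; last by apply/negP; lra.
by congr r; lra.
Qed.

Lemma path_equiv_unitl x y p : path x y p -> path_equiv x y (cst x ** p) p.
Proof.
move=> pP; have [_ _ p0 p1] := pP.
pose rho (t : R) := Num.max (0 * t + 0) (2 * t - 1).
have crho : continuous rho.
  by apply: continuous_maxr; exact: continuous_affine.
have h0 : (cst x ** p) 0 = x by rewrite /path_concat ifT; last lra.
have h1 : (cst x ** p) 1 = y.
  rewrite /path_concat ifF; last by apply/negP; lra.
  by have -> : 2 * 1 - 1 = 1 :> R by lra.
rewrite -{1}h0 -{1}h1.
apply: (@path_equiv_reparam x y p (cst x ** p) rho id) => //.
- by move=> ?; exact: cvg_id.
- move=> t /mem01P t01; split; last exact/mem01P.
  by apply/mem01P; rewrite /rho ge_max !le_max; lra.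
- by rewrite /rho; case: lerP => ?; lra.
- by rewrite /rho; case: lerP => ?; lra.
move=> t /mem01P t01; rewrite /path_concat /rho; case: (lerP t 2^-1) => ht.
  by case: lerP => h; rewrite -p0 /cst; congr p; lra.
by case: lerP => h; congr p; lra.
Qed.

(** Going out and back is [p] composed with a tent map, which is contracted to the constant
    parameter 0. *)
Lemma path_equiv_revr x y p : path x y p -> path_equiv x x (p ** path_rev p) (cst x).
Proof.
move=> pP; have [_ _ p0 p1] := pP.
pose rho (t : R) := Num.min (2 * t + 0) (- 2 * t + 2).
have crho : continuous rho.
  by apply: continuous_minr; exact: continuous_affine.
have h0 : (p ** path_rev p) 0 = x.
  rewrite /path_concat ifT; last lra.
  by rewrite mulr0.
have h1 : (p ** path_rev p) 1 = x.
  rewrite /path_concat /path_rev ifF; last by apply/negP; lra.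
  by have -> : 1 - (2 * 1 - 1) = 0 :> R by lra.
rewrite -{1}h0 -{1}h1 (_ : cst x = p \o cst 0); last by apply/funext => t /=; rewrite p0.
apply: (@path_equiv_reparam x y p _ rho (cst 0)) => //.
- exact: cst_continuous.
- move=> t /mem01P t01; split; last by apply/mem01P => /=; lra.
  by apply/mem01P; rewrite /rho le_min !ge_min; lra.
- by rewrite /rho /=; case: lerP => ?; lra.
- by rewrite /rho /=; case: lerP => ?; lra.
move=> t /mem01P t01; rewrite /path_concat /path_rev /rho.
case: (lerP t 2^-1) => ht; case: lerP => h; congr p; lra.
Qed.

Lemma path_equiv_revl x y p : path x y p -> path_equiv y y (path_rev p ** p) (cst y).
Proof.
move=> pP; have := path_equiv_revr (is_path_rev pP).
by rewrite (_ : path_rev (path_rev p) = p) //; apply/funext => t; rewrite /path_rev subKr.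
Qed.

Variables (b : T) (gT : finGroupType) (phi : (R -> T) -> gT).
Hypothesis phi_homotopic : forall p q, path b b p -> path b b q ->
  homotopic p q -> phi p = phi q.
Hypothesis phi_concat : forall p q, path b b p -> path b b q ->
  phi (p ** q) = (phi p * phi q)%g.
Hypothesis A_connected : forall x, A x -> exists p, path b x p.

Let base_path x : R -> T :=
  if pselect (exists p, path b x p) is left e then sval (cid e) else cst b.

Let base_pathP x : A x -> path b x (base_path x).
Proof.
by move=> /A_connected e; rewrite /base_path; case: pselect => // e'; exact: svalP.
Qed.

(** Closing a path up by chosen paths from the base point extends [phi] to the whole groupoid; the
    choices cancel in concatenations. *)
Definition groupoid_rep p : gT :=
  phi (base_path (p 0) ** p ** path_rev (base_path (p 1))).

Let path_ends x y p : path x y p -> A x /\ A y.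
Proof.
move=> pP; have [_ _ <- <-] := pP.
by split; apply: path_mem pP _; rewrite in_itv /= lexx ler01.
Qed.

Let conj_path x y p : path x y p ->
  path b b (base_path x ** p ** path_rev (base_path y)).
Proof.
move=> pP; have [Ax Ay] := path_ends pP.
apply: is_path_concat (is_path_rev (base_pathP Ay)).
exact: is_path_concat (base_pathP Ax) pP.
Qed.

Lemma groupoid_rep_equiv x y p q : path_equiv x y p q ->
  groupoid_rep p = groupoid_rep q.
Proof.
move=> pq; have [pP qP _] := pq; have [Ax Ay] := path_ends pP.
rewrite /groupoid_rep; have [_ _ -> ->] := pP; have [_ _ -> ->] := qP.
suff [] : path_equiv b b (base_path x ** p ** path_rev (base_path y))
                         (base_path x ** q ** path_rev (base_path y)).
  exact: phi_homotopic.
apply: path_equiv_concat; last exact/path_equiv_refl/is_path_rev/base_pathP.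
by apply: path_equiv_concat pq; exact/path_equiv_refl/base_pathP.
Qed.

Lemma groupoid_rep_concat x y z p q : path x y p -> path y z q ->
  groupoid_rep (p ** q) = (groupoid_rep p * groupoid_rep q)%g.
Proof.
move=> pP qP; have [Ax Ay] := path_ends pP; have [_ Az] := path_ends qP.
have [_ _ pq0 pq1] := is_path_concat pP qP.
rewrite /groupoid_rep pq0 pq1; have [_ _ -> ->] := pP; have [_ _ -> ->] := qP.
rewrite -phi_concat; [|exact: conj_path..].
have := base_pathP Ax; have := base_pathP Ay; have := base_pathP Az.
move: (base_path x) (base_path y) (base_path z) => u v s sP vP uP.
have rP := is_path_rev sP; set r := path_rev s in rP *.
suff : path_equiv b b (u ** p ** path_rev v ** (v ** q ** r)) (u ** (p ** q) ** r).
  by case=> h1 h2 /(phi_homotopic h1 h2) ->.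
have upP := is_path_concat uP pP; have qrP := is_path_concat qP rP.
have vr := is_path_rev vP.
apply: path_equiv_trans (path_equiv_assoc upP vr _) _.
  by apply: is_path_concat rP; apply: is_path_concat qP.
apply: (@path_equiv_trans _ _ _ (u ** p ** (q ** r))).
  apply: path_equiv_concat (path_equiv_refl upP) _.
  apply: path_equiv_trans (path_equiv_sym (path_equiv_assoc vr (is_path_concat vP qP) rP)) _.
  apply: path_equiv_concat (path_equiv_refl rP).
  apply: path_equiv_trans (path_equiv_sym (path_equiv_assoc vr vP qP)) _.
  apply: path_equiv_trans (path_equiv_unitl qP).
  exact: path_equiv_concat (path_equiv_revl vP) (path_equiv_refl qP).
apply: path_equiv_trans (path_equiv_sym (path_equiv_assoc upP qP rP)) _.
apply: path_equiv_concat (path_equiv_refl rP).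
exact: path_equiv_assoc uP pP qP.
Qed.

Lemma groupoid_rep_cst x : A x -> groupoid_rep (cst x) = 1%g.
Proof.
move=> Ax; have xP : path x x (cst x).
  split=> // [|_ [t _ <-] //].
  by apply: continuous_subspaceT => t; exact: cst_continuous.
apply: (@mulgI _ (groupoid_rep (cst x))).
rewrite mulg1 -(groupoid_rep_concat xP xP).
by apply: groupoid_rep_equiv (path_equiv_unitl xP).
Qed.

Lemma groupoid_rep_rev x y p : path x y p ->
  groupoid_rep (path_rev p) = (groupoid_rep p)^-1%g.
Proof.
move=> pP; apply: (@mulgI _ (groupoid_rep p)).
rewrite mulgV -(groupoid_rep_concat pP (is_path_rev pP)).
rewrite (groupoid_rep_equiv (path_equiv_revr pP)) groupoid_rep_cst //.
by have [] := path_ends pP.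
Qed.

(** The path chosen for [b] itself is some loop, not necessarily the constant one, and its image is
    what conjugates. When [b] is outside [A] there is no loop to consider. *)
Lemma groupoid_rep_loop : exists g, forall p, path b b p ->
  groupoid_rep p = (phi p ^ g)%g.
Proof.
have [nAb|Ab] := pselect (~ A b).
  by exists 1%g => p /path_ends[/nAb].
move/contrapT in Ab; have vP := base_pathP Ab.
have rP := is_path_rev vP.
have bP : path b b (cst b) by have [] := path_equiv_revr vP.
have phi1 : phi (cst b) = 1%g.
  apply: (@mulgI _ (phi (cst b))); rewrite mulg1 -phi_concat //.
  by have [h1 h2 h] := path_equiv_unitl bP; apply: phi_homotopic.
exists (phi (path_rev (base_path b))) => p pP.
rewrite /groupoid_rep; have [_ _ -> ->] := pP.
have vpP := is_path_concat vP pP.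
rewrite !phi_concat // conjgE mulgA; congr (_ * _ * _)%g.
apply: (@mulIg _ (phi (path_rev (base_path b)))); rewrite mulVg -phi_concat //.
by rewrite -phi1; have [h1 h2 h] := path_equiv_revr vP; apply: phi_homotopic.
Qed.

End FundamentalGroupoid.

(** * Reflections as rank one perturbations, and their normalised linear forms *)

(** Multiplying one block matrix by a unitriangular matrix, on the left and then on the right, makes
    it block triangular in two ways; the two sides are the resulting determinants. *)
Lemma det_add1_rank1 (F : fieldType) n (c : 'cV[F]_n) (r : 'rV[F]_n) :
  \det (1%:M + c *m r) = 1 + (r *m c) 0 0.
Proof.
pose A := block_mx (1%:M : 'M[F]_1) r (- c) (1%:M : 'M[F]_n).
pose L := block_mx (1%:M : 'M[F]_1) 0 c (1%:M : 'M[F]_n).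
pose U := block_mx (1%:M : 'M[F]_1) 0 c (1%:M : 'M[F]_n).
have LA : L *m A = block_mx 1%:M r 0 (1%:M + c *m r).
  rewrite /L /A mulmx_block !(mul0mx, mul1mx, mulmx1, addr0).
  by rewrite subrr addrC.
have AU : A *m U = block_mx (1%:M + r *m c) r 0 1%:M.
  rewrite /U /A mulmx_block !(mulmx0, mul1mx, mulmx1, add0r).
  by rewrite addNr.
have dLU : \det L = 1 by rewrite /L det_lblock !det1 mulr1.
have := congr1 determinant LA; rewrite det_mulmx dLU mul1r det_ublock det1 mul1r => <-.
have := congr1 determinant AU; rewrite det_mulmx -/L dLU mulr1 det_ublock det1 mulr1 => ->.
by rewrite det_mx11 !mxE eqxx.
Qed.

Section ReflectionForms.
Variables (R : realType) (gT : finGroupType) (n : nat).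
Variable V : mx_representation (Cplx R) [set: gT]%SET n.
Local Notation C := (Cplx R).
Hypothesis hW : is_2reflection_group V.

(** The group is generated by reflections of order 2, but [reflections] may a priori contain others.
    This bound on determinants restricts the nontrivial eigenvalue of all of them. *)
Lemma det_2reflection_group w : \det (V w) ^+ 2 = 1.
Proof.
pose H := [set w | \det (V w) ^+ 2 == 1]%SET.
have gH : group_set H.
  apply/group_setP; split=> [|x y]; first by rewrite inE repr_mx1 det1 expr1n.
  rewrite !inE => /eqP hx /eqP hy.
  by rewrite repr_mxM ?inE // det_mulmx exprMn hx hy mulr1.
have : ([set: gT] \subset Group gH)%SET.
  rewrite -hW.2 gen_subG; apply/fintype.subsetP => s; rewrite !inE => /andP[_ /eqP s2].
  have := expg_order s; rewrite s2 expgS expg1 => ss.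
  by rewrite expr2 -det_mulmx -repr_mxM ?inE // ss repr_mx1 det1.
by move/fintype.subsetP => /(_ w); rewrite !inE => /(_ isT) /eqP.
Qed.

(** The determinant [1 + r c] is 1 or -1, so [r c] is 0 or -2. The value 0 would give a
    transvection, whose m-th power is [1 + m c r]; in characteristic 0 it has infinite order. *)
Lemma reflection_rank1 s : s \in reflections V ->
  exists (c : 'cV[C]_n) (r : 'rV[C]_n), V s = 1%:M + c *m r /\ (r *m c) 0 0 = -2.
Proof.
rewrite inE => /eqP rk1.
have [c [r cr]] : exists (c : 'cV[C]_n) (r : 'rV[C]_n), c *m r = V s - 1%:M.
  have := mulmx_base (V s - 1%:M); move: (col_base _) (row_base _).
  by rewrite rk1 => c r cr; exists c, r.
have Vs : V s = 1%:M + c *m r by rewrite cr addrC subrK.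
exists c, r; split=> //.
have := det_2reflection_group s; rewrite Vs det_add1_rank1.
set l := (r *m c) 0 0 => /eqP; rewrite sqrf_eq1 => /orP[/eqP l0|/eqP l2]; last first.
  by apply: (addrI 1); rewrite l2; ring.
have rc : r *m c = 0.
  rewrite [LHS]mx11_scalar -/l; apply/matrixP => i j.
  by rewrite mxE !ord1 mxE (_ : l = 0) ?mul0rn //; apply: (addrI 1); rewrite l0 addr0.
have Vm m : V (s ^+ m)%g = 1%:M + m%:R *: (c *m r).
  elim: m => [|m IH]; first by rewrite expg0 repr_mx1 scale0r addr0.
  rewrite expgS repr_mxM ?inE // IH Vs mulmxDl mul1mx mulmxDr mulmx1.
  rewrite -scalemxAr -mulmxA (mulmxA r) rc mul0mx mulmx0 scaler0 addr0.
  by rewrite -addrA -[in RHS]addn1 natrD scalerDl scale1r.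
have := Vm #[s]%g; rewrite expg_order repr_mx1 => /eqP.
rewrite eq_sym -subr_eq0 addrC addKr scaler_eq0 pnatr_eq0.
case/orP=> [|/eqP cr0]; first by rewrite eqn0Ngt order_gt0.
by move: rk1; rewrite -cr cr0 mxrank0.
Qed.

Variable x0 : 'cV[C]_n.
Hypothesis hx0 : hyp_complement V x0.

(** Dividing by the value at [x0], nonzero off the hyperplane, gives all forms the same value 1 at
    the base point; the root absorbs the inverse factor together with the -2. *)
Lemma reflection_form_exists s : s \in reflections V ->
  exists uv : 'rV[C]_n * 'cV[C]_n,
  [/\ V s = 1%:M - 2 *: (uv.2 *m uv.1), (uv.1 *m uv.2) 0 0 = 1 &
      (uv.1 *m x0) 0 0 = 1].
Proof.
move=> sR; have [c [r [Vs rc]]] := reflection_rank1 sR.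
pose a := (r *m x0) 0 0.
have a0 : a != 0.
  apply/eqP => a0; apply: (hx0 sR).
  rewrite Vs mulmxDl mul1mx -mulmxA [r *m x0]mx11_scalar -/a a0.
  by rewrite raddf0 mulmx0 addr0.
exists (a^-1 *: r, - (a / 2) *: c) => /=; split.
- rewrite Vs -scalemxAl -scalemxAr !scalerA -scaleNr; congr (_ + _).
  by rewrite -[LHS]scale1r; congr (_ *: _); field; exact: a0.
- rewrite -scalemxAl -scalemxAr !scalerA mxE rc; field; exact: a0.
- by rewrite -scalemxAl mxE mulVf.
Qed.

Definition reflection_form_pair (s : gT) : 'rV[C]_n * 'cV[C]_n :=
  if pselect (s \in reflections V) is left sR
  then sval (cid (reflection_form_exists sR)) else (0, 0).

Definition reflection_root s : 'cV[C]_n := (reflection_form_pair s).2.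

Definition reflection_form s (x : 'cV[C]_n) : C :=
  ((reflection_form_pair s).1 *m x) 0 0.

Local Notation u := reflection_form.

Lemma reflection_pairP s : s \in reflections V ->
  [/\ V s = 1%:M - 2 *: (reflection_root s *m (reflection_form_pair s).1),
     u s (reflection_root s) = 1 & u s x0 = 1].
Proof.
rewrite /u /reflection_root /reflection_form_pair => sR.
by case: pselect => // sR'; case: cid.
Qed.

Lemma reflection_formD s x y : u s (x + y) = u s x + u s y.
Proof. by rewrite /u mulmxDr mxE. Qed.

Lemma reflection_formZ s a x : u s (a *: x) = a * u s x.
Proof. by rewrite /u -scalemxAr mxE. Qed.

Lemma reflectionE s x : s \in reflections V ->
  V s *m x = x - (2 * u s x) *: reflection_root s.
Proof.
move=> /reflection_pairP[-> _ _]; rewrite mulmxBl mul1mx -scalemxAl -mulmxA.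
by rewrite [(_).1 *m x]mx11_scalar -/(u s x) mul_mx_scalar scalerA.
Qed.

Lemma reflection_root_neq0 s : s \in reflections V -> reflection_root s != 0.
Proof.
move=> /reflection_pairP[_ + _]; case: eqP => // ->.
by rewrite /u mulmx0 mxE => /eqP; rewrite eq_sym oner_eq0.
Qed.

Lemma reflection_fixed s x : s \in reflections V ->
  V s *m x = x <-> u s x = 0.
Proof.
move=> sR; rewrite reflectionE //; split=> [/eqP|->]; last first.
  by rewrite mulr0 scale0r subr0.
rewrite -subr_eq0 addrC addKr oppr_eq0 scaler_eq0 (negPf (reflection_root_neq0 sR)).
by rewrite orbF mulf_eq0 pnatr_eq0 => /eqP.
Qed.

Lemma hyp_complementP x : hyp_complement V x <->
  forall s, s \in reflections V -> u s x != 0.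
Proof.
split=> h s sR; first by apply/eqP => /(reflection_fixed _ sR) /(h s sR).
by move/(reflection_fixed _ sR)/eqP; apply/negP/h.
Qed.

Lemma eq_reflection_form r s : r \in reflections V -> s \in reflections V ->
  u r =1 u s -> (hyperplane V r :=: hyperplane V s)%MS.
Proof.
suff imp r' s' : r' \in reflections V -> s' \in reflections V -> u r' =1 u s' ->
    (hyperplane V r' <= hyperplane V s')%MS.
  move=> rR sR rs; apply/eqmxP/andP; split; first exact: imp rR sR rs.
  exact: imp sR rR (fun x => esym (rs x)).
move=> rR sR rs; apply/rV_subP => y; rewrite /hyperplane.
move/eigenspaceP; rewrite scale1r => yr; apply/eigenspaceP; rewrite scale1r.
have/(reflection_fixed _ rR) : V r' *m y^T = y^T by rewrite -{1}[V r']trmxK -trmx_mul yr.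
by rewrite rs => /(reflection_fixed _ sR); rewrite -{1}[V s']trmxK -trmx_mul => /trmx_inj.
Qed.

End ReflectionForms.

(** * Uniform small constants and locally constant functions on a segment *)

Section SmallReals.
Variable R : realType.
Implicit Types (e d y : R).

Lemma small_forall (I : finType) (P : I -> R -> Prop) :
  (forall i, exists2 e, 0 < e & forall d, 0 < d <= e -> P i d) ->
  exists2 e, 0 < e & forall i d, 0 < d <= e -> P i d.
Proof.
move=> h; have /choice[f fP] : forall i, exists e, 0 < e /\ forall d, 0 < d <= e -> P i d.
  by move=> i; have [e e0 eP] := h i; exists e.
exists (\big[Num.min/1]_i f i); first by apply: lt_bigmin => // i _; case: (fP i).
move=> i d /andP[d0 dm]; apply: (fP i).2; rewrite d0 (le_trans dm) //.
exact: bigmin_le.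
Qed.

Lemma avoid_seq (s : seq R) a b : a < b -> exists2 y, a < y < b & y \notin s.
Proof.
elim: s a b => [|x s IH] a b ab; first by exists ((a + b) / 2) => //; lra.
have [xm|mx] := leP x ((a + b) / 2).
  have [y yb ys] := IH ((a + b) / 2) b ltac:(lra).
  by exists y; [lra|rewrite inE negb_or ys andbT; apply/eqP => yx; lra].
have [y yb ys] := IH a ((a + b) / 2) ltac:(lra).
by exists y; [lra|rewrite inE negb_or ys andbT; apply/eqP => yx; lra].
Qed.

(** This is connectedness of the segment, through the supremum of the points up to which [f] keeps
    its initial value. *)
Lemma locally_constant_segment (T : Type) (f : R -> T) (a b : R) : a <= b ->
  (forall x, a <= x <= b -> exists2 d, 0 < d &
     forall y, a <= y <= b -> `|y - x| < d -> f y = f x) -> f a = f b.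
Proof.
move=> ab lc; pose S := [set x | a <= x <= b /\ forall y, a <= y <= x -> f y = f a].
have Sa : S a by split; [rewrite lexx|move=> y ya; congr f; lra].
have bS : ubound S b by move=> x [] /andP[].
have supS : has_sup S by split; [exists a|exists b].
pose m := sup S.
have am : a <= m by apply: ub_le_sup => //; case: supS.
have mb : m <= b by apply: ge_sup => //; exists a.
have [|d d0 dP] := lc m; first by rewrite am mb.
have [x Sx xm] := sup_adherent d0 supS; rewrite -/m in xm.
have xlem : x <= m by apply: ub_le_sup => //; case: supS.
have fm : f m = f a.
  rewrite -(Sx.2 x); last by have := Sx.1; rewrite lexx andbT => /andP[].
  apply/esym/dP; first exact: Sx.1.
  by rewrite ltr_norml; lra.
have Sy y : a <= y <= b -> y < m + d -> f y = f a.
  move=> yab ym; have [yx|xy] := leP y x; first by apply: Sx.2; lra.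
  by rewrite dP // ?fm //; rewrite ltr_norml; lra.
have [mb'|] := ltP m b; last first.
  by move=> bm; rewrite (_ : b = m) ?fm //; lra.
have Sm : S (Num.min b (m + d / 2)).
  split; first by case: (lerP b (m + d / 2)) => ?; lra.
  by move=> y; case: (lerP b (m + d / 2)) => ? /andP[? ?]; apply: Sy; lra.
have : Num.min b (m + d / 2) <= m by apply: ub_le_sup => //; case: supS.
by case: (lerP b (m + d / 2)) => ? ?; exfalso; lra.
Qed.

(* A function on a set S that meets every subinterval, locally constant in the
   sense that nearby points of S have the same value even around points outside
   of S. *)
Lemma locally_constant_dense (T : Type) (f : R -> T) (S : R -> Prop) (b : R) :
  0 < b -> S 0 -> S b ->
  (forall x y, x < y -> exists2 z, x < z < y & S z) ->
  (forall x, 0 <= x <= b -> exists2 d, 0 < d &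
     forall y z, 0 <= y <= b -> 0 <= z <= b -> S y -> S z ->
       `|y - x| < d -> `|z - x| < d -> f y = f z) -> f 0 = f b.
Proof.
move=> b0 S0 Sb dS lc.
have dS' x d : 0 <= x <= b -> 0 < d -> exists y, [/\ 0 <= y <= b, S y & `|y - x| < d].
  move=> xb d0; have [xlt|xge] := ltP x b.
    have [|z zb Sz] := dS x (Num.min b (x + d)); first by case: (lerP b (x + d)) => ?; lra.
    exists z; split=> //; first by move: zb; case: (lerP b (x + d)) => ? ?; lra.
    by rewrite ltr_norml; move: zb; case: (lerP b (x + d)) => ? ?; lra.
  have [|z zb Sz] := dS (Num.max 0 (x - d)) x; first by case: (lerP 0 (x - d)) => ?; lra.
  exists z; split=> //; first by move: zb; case: (lerP 0 (x - d)) => ? ?; lra.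
  by rewrite ltr_norml; move: zb; case: (lerP 0 (x - d)) => ? ?; lra.
(* The common value of [f] at the points of [S] near [x] defines a locally constant function on the
   whole segment, equal to [f] on [S]. *)
have /choice[g gP] : forall x, exists w, 0 <= x <= b -> exists2 d, 0 < d &
    forall y, 0 <= y <= b -> S y -> `|y - x| < d -> f y = w.
  move=> x; have [xb|xb] := boolP (0 <= x <= b); last by exists (f 0).
  have [d d0 dP] := lc x xb; have [y [yb Sy yx]] := dS' x d xb d0.
  by exists (f y) => _; exists d => // z zb Sz zx; apply: dP.
have gf x : 0 <= x <= b -> S x -> f x = g x.
  move=> xb Sx; have [d d0 dP] := gP x xb; apply: dP => //.
  by rewrite subrr normr0.
have b0b : 0 <= (0 : R) <= b.
  by rewrite lexx ltW.
have bbb : 0 <= b <= b by lra.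
rewrite (gf 0) // (gf b) //.
apply: locally_constant_segment => [|x xb]; first exact: ltW.
have [d d0 dP] := gP x xb; exists (d / 2); first lra.
move=> y yb yx; have [d' d'0 d'P] := gP y yb.
have [|z [zb Sz zy]] := dS' y (Num.min d' (d / 2)) yb; first by case: (lerP d' (d / 2)) => ?; lra.
rewrite -(d'P z) // ?(dP z) //.
  by move: zy yx; rewrite !ltr_norml; case: (lerP d' (d / 2)) => ? ? ?; lra.
by move: zy; case: (lerP d' (d / 2)) => ? ?; lra.
Qed.

End SmallReals.

(** * A potential for transport in the complement of an arrangement *)

Section ArrangementComplement.
Variables (R : realType) (n : nat) (I : finType).
Local Notation C := (Cplx R).
Local Notation Cn := 'cV[C]_n.
Variable u : I -> Cn -> C.
Hypothesis uD : forall i x y, u i (x + y) = u i x + u i y.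
Hypothesis uZ : forall i a x, u i (a *: x) = a * u i x.
Variable x0 : Cn.
Hypothesis ux0 : forall i, u i x0 = 1.
Variable v : I -> Cn.
Hypothesis uv : forall i, u i (v i) = 1.

Let gt0_2D1 (x : R) : 0 <= x -> 0 < 2 * (x + 1).
Proof. by move=> ?; lra. Qed.

Definition re_form i (x : Cn) : R := complex.Re (u i x : R[i]).
Definition im_form i (x : Cn) : R := complex.Im (u i x : R[i]).
Local Notation re := re_form.
Local Notation im := im_form.

(* Locked: conversion would otherwise unfold the complex arithmetic. *)
Definition affine_pt : Cn -> R -> R -> Cn -> Cn :=
  locked (fun z a b w => z + ((a +i* b)%C : C) *: w).

Lemma affine_ptE z a b w : affine_pt z a b w = z + ((a +i* b)%C : C) *: w.
Proof. by rewrite /affine_pt -lock. Qed.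

Lemma re_affine i z a b w :
  re i (affine_pt z a b w) = re i z + (a * re i w - b * im i w).
Proof.
rewrite /re /im affine_ptE uD uZ.
by case: (u i z : R[i]) (u i w : R[i]) => [? ?] [? ?].
Qed.

Lemma im_affine i z a b w :
  im i (affine_pt z a b w) = im i z + (a * im i w + b * re i w).
Proof.
rewrite /re /im affine_ptE uD uZ.
by case: (u i z : R[i]) (u i w : R[i]) => [? ?] [? ?].
Qed.

Lemma form_eq0 i x : u i x = 0 <-> re i x = 0 /\ im i x = 0.
Proof.
rewrite /re /im; case: (u i x : R[i]) => a b /=.
by split=> [[-> ->]|[-> ->]].
Qed.

Lemma affine_ptA q y d : affine_pt q 0 (y + d) x0 = affine_pt (affine_pt q 0 y x0) 0 d x0.
Proof.
rewrite !affine_ptE -addrA -scalerDl; congr (_ + _ *: _).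
by apply/eqP; rewrite eq_complex /= addr0 !eqxx.
Qed.

Lemma affine_pt0 q w : affine_pt q 0 0 w = q.
Proof. by rewrite affine_ptE (_ : (0 +i* 0)%C = 0) // scale0r addr0. Qed.

Lemma re_x0 i : re i x0 = 1. Proof. by rewrite /re ux0. Qed.
Lemma im_x0 i : im i x0 = 0. Proof. by rewrite /im ux0. Qed.

(** The value [u i x] lies in the open half plane with inner normal [al + i be]. Such a half plane
    omits 0 and is convex. *)
Definition in_cone i (al be : R) (x : Cn) : bool := 0 < al * re i x + be * im i x.

(** The half plane may depend on the form but not on the point, so the convex hull of the points of
    [s] avoids every hyperplane. *)
Definition common_cone (s : seq Cn) :=
  forall i, exists al be, all (in_cone i al be) s.

Lemma common_coneS s1 s2 : {subset s1 <= s2} -> common_cone s2 -> common_cone s1.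
Proof.
move=> s12 h i; have [al [be /allP hs]] := h i.
by exists al, be; apply/allP => x /s12; apply: hs.
Qed.

Lemma cone_neq0 i al be x : in_cone i al be x -> u i x != 0.
Proof.
rewrite /in_cone; apply: contraTN => /eqP/form_eq0[-> ->].
by rewrite !mulr0 addr0 ltxx.
Qed.

(** Proximity is measured by the values of the forms alone, so that this part is independent of the
    topology of the ambient space. *)
Definition nearby (e : R) (c a : Cn) :=
  forall i, `|re i a - re i c| < e /\ `|im i a - im i c| < e.

Lemma nearby_trans e1 e2 a b c : nearby e1 a b -> nearby e2 b c ->
  nearby (e1 + e2) a c.
Proof.
move=> h1 h2 i; have [h11 h12] := h1 i; have [h21 h22] := h2 i.
by split; [move: h11 h21|move: h12 h22]; rewrite !ltr_norml; lra.
Qed.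

Lemma nearby_refl e a : 0 < e -> nearby e a a.
Proof. by move=> e0 i; rewrite !subrr normr0. Qed.

Lemma nearbyW e1 e2 a b : e1 <= e2 -> nearby e1 a b -> nearby e2 a b.
Proof. by move=> e12 h i; have [h1 h2] := h i; rewrite !(lt_le_trans _ e12). Qed.

Lemma open_cone (P : pred I) (al be : I -> R) c :
  (forall i, P i -> in_cone i (al i) (be i) c) ->
  exists2 e, 0 < e &
    forall a, nearby e c a -> forall i, P i -> in_cone i (al i) (be i) a.
Proof.
move=> hc.
have [|e e0 eP] := @small_forall R I (fun i d => P i -> forall a b : R,
    `|a - re i c| < d -> `|b - im i c| < d -> 0 < al i * a + be i * b).
  move=> i; have [Pi|] := boolP (P i); last by exists 1.
  have := hc i Pi; rewrite /in_cone; set m := (X in 0 < X) => m0.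
  (* Within this distance the linear expression changes by at most [m / 2]; the added 1 prevents a
     zero denominator. *)
  exists (m / (2 * (`|al i| + `|be i| + 1))).
    by rewrite divr_gt0 // gt0_2D1 // addr_ge0.
  move=> d /andP[d0 dm] _ a b ha hb.
  have ai : `|al i| >= 0 by []. have bi : `|be i| >= 0 by [].
  have md : d * (2 * (`|al i| + `|be i| + 1)) <= m.
    by rewrite -ler_pdivlMr //; lra.
  have ha' : `|al i * (a - re i c)| <= `|al i| * d.
    by rewrite normrM ler_wpM2l // ltW.
  have hb' : `|be i * (b - im i c)| <= `|be i| * d.
    by rewrite normrM ler_wpM2l // ltW.
  have E : al i * a + be i * b = m + al i * (a - re i c) + be i * (b - im i c).
    by rewrite /m; ring.
  rewrite E; move: ha' hb'; rewrite !ler_norml => /andP[ha' _] /andP[hb' _].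
  by nra.
by exists e => // a ha i Pi; apply: (eP i e) => //; [rewrite e0 lexx|case: (ha i)..].
Qed.

Lemma open_common_cone c s :
  (forall i, exists al be, all (in_cone i al be) (c :: s)) ->
  exists2 e, 0 < e & forall i, exists al be,
    (forall a, nearby e c a -> in_cone i al be a) /\ all (in_cone i al be) s.
Proof.
move=> /choice[al] /choice[be hal].
have [|e e0 eP] := @open_cone xpredT al be c.
  by move=> i _; have /andP[] := hal i.
exists e => // i; exists (al i), (be i); split; last by have /andP[] := hal i.
by move=> a /eP; apply.
Qed.

Lemma nearby_affine e c a b1 b2 w : nearby e c a ->
  nearby e (affine_pt c b1 b2 w) (affine_pt a b1 b2 w).
Proof.
move=> h i; have [h1 h2] := h i.
by split; rewrite ?re_affine ?im_affine opprD addrACA subrr addr0.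
Qed.

Lemma nearby_disc z w e : 0 < e -> exists2 rho, 0 < rho &
  forall a b, `|a| <= 1 -> `|b| <= 1 ->
    nearby e z (affine_pt z (rho * a) (rho * b) w).
Proof.
move=> e0.
have [|rho rho0 rhoP] := @small_forall R I (fun i d =>
    d * (`|re i w| + `|im i w|) < e).
  move=> i; exists (e / (2 * ((`|re i w| + `|im i w|) + 1))).
    by rewrite divr_gt0 // gt0_2D1 // addr_ge0.
  move=> d /andP[d0 dm]; have w0 : 0 <= `|re i w| + `|im i w| by rewrite addr_ge0.
  have : d * (2 * ((`|re i w| + `|im i w|) + 1)) <= e by rewrite -ler_pdivlMr // gt0_2D1.
  by nra.
exists rho => // a b a1 b1 i.
have bnd x y : `|rho * a * x + rho * b * y| <= rho * (`|x| + `|y|).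
  rewrite (le_trans (ler_normD _ _)) // !normrM (gtr0_norm rho0) -!mulrA -mulrDr.
  by rewrite ler_pM2l // lerD // ler_piMl.
have ei : rho * (`|re i w| + `|im i w|) < e by apply: rhoP; rewrite rho0 lexx.
rewrite re_affine im_affine !(addrC _ (_ + _)) !addrK; split.
  by rewrite -mulrN (le_lt_trans (bnd _ _)) // normrN.
by rewrite (le_lt_trans (bnd _ _)) // addrC.
Qed.

Lemma nearby_vertical e q y : `|y| < e -> nearby e q (affine_pt q 0 y x0).
Proof.
move=> ye i; rewrite re_affine im_affine re_x0 im_x0.
have e0 : 0 < e by apply: le_lt_trans ye.
by rewrite !mul0r mulr0 mulr1 subrr addr0 subrr normr0 add0r addrC addKr.
Qed.

(** On the vertical line through [a] in the direction i x0, the form [i] becomes real exactly at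
    height [- im i a]. Distinct forms thus become real at distinct heights, none of them 0. *)
Definition generic (a : Cn) := forall i,
  im i a != 0 /\ forall j, im i a = im j a -> u i =1 u j.

Variables (gT : finGroupType) (T : Cn -> Cn -> gT).

Hypothesis T_cone : forall a b c, common_cone [:: a; b; c] ->
  (T a b * T b c)%g = T a c.

(** Transport around a small square centred on the hyperplane of [i] is trivial. The alternative on
    [j] says that no other form vanishes on a box containing the square. *)
Hypothesis T_meridian : forall i z rho, 0 < rho -> u i z = 0 ->
  (forall j, u j =1 u i \/ exists al be, forall a b, `|a| <= 1 -> `|b| <= 1 ->
     in_cone j al be (affine_pt z (rho * a) (rho * b) (v i))) ->
  (T (affine_pt z rho 0 (v i)) (affine_pt z 0 rho (v i)) *
   T (affine_pt z 0 rho (v i)) (affine_pt z (- rho) 0 (v i)) *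
   T (affine_pt z (- rho) 0 (v i)) (affine_pt z 0 (- rho) (v i)) *
   T (affine_pt z 0 (- rho) (v i)) (affine_pt z rho 0 (v i)) = 1)%g.

Lemma T_cone1 a : common_cone [:: a] -> T a a = 1%g.
Proof.
move=> aC; apply: (@mulgI _ (T a a)); rewrite mulg1 T_cone //.
by apply: common_coneS aC => x; rewrite !inE !orbb.
Qed.

Lemma T_coneV a b : common_cone [:: a; b] -> (T a b * T b a = 1)%g.
Proof.
move=> aC; rewrite T_cone ?T_cone1 //; apply: common_coneS aC => x; rewrite !inE.
  by move=> ->.
by case: (x == a); case: (x == b).
Qed.

(** All forms other than [u h] stay in fixed half planes, so the question lives in the punctured
    plane of values of [u h], where [x0] is 1 and the other two points lie above or below [- m]. If
    they are on the same side of the real axis, one half plane contains the three values. Otherwise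
    the triangle encloses 0: it is cut into triangles lying in half planes and the small square with
    corners [r], [t], [l], [b], whose holonomy is trivial. *)
Let crossing_core h q z m rho y y' (sep : pred I) (al be : I -> R) :
  let G x := forall j, sep j -> in_cone j (al j) (be j) x in
  0 < m -> re h q = - m -> im h q = 0 -> u h z = 0 -> 0 < rho ->
  (forall j, ~~ sep j -> u j =1 u h) ->
  G x0 -> G z -> G (affine_pt q 0 y x0) -> G (affine_pt q 0 y' x0) ->
  (forall a b, `|a| <= 1 -> `|b| <= 1 ->
    G (affine_pt z (rho * a) (rho * b) (v h))) ->
  y <= y' -> y != 0 -> y' != 0 ->
  (T (affine_pt q 0 y x0) (affine_pt q 0 y' x0) *
     T (affine_pt q 0 y' x0) x0 = T (affine_pt q 0 y x0) x0)%g.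
Proof.
move=> G m0 rq iq uz rho0 sepN Gx0 Gz Gm Gp Gdisc yy' yn0 y'n0.
have cc A B D a b : G A -> G B -> G D -> in_cone h a b A -> in_cone h a b B ->
    in_cone h a b D -> (T A B * T B D)%g = T A D.
  move=> GA GB GD hA hB hD; apply: T_cone => j.
  have [sj|/sepN jh] := boolP (sep j).
    by exists (al j), (be j); rewrite /= GA // GB // GD.
  by exists a, b; move: hA hB hD; rewrite /= /in_cone /re /im !jh => -> -> ->.
have cval a1 b1 x c1 d1 : re h x = c1 -> im h x = d1 -> 0 < a1 * c1 + b1 * d1 ->
  in_cone h a1 b1 x by rewrite /in_cone => -> ->.
have vq w : re h (affine_pt q 0 w x0) = - m /\ im h (affine_pt q 0 w x0) = w.
  by rewrite re_affine im_affine re_x0 im_x0 rq iq; split; ring.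
have [rv iv] : re h (v h) = 1 /\ im h (v h) = 0 by rewrite /re /im uv.
have [rz0 iz0] := (form_eq0 h z).1 uz.
have vz a b : re h (affine_pt z a b (v h)) = a /\ im h (affine_pt z a b (v h)) = b.
  by rewrite re_affine im_affine rv iv rz0 iz0; split; ring.
have [vm1 vm2] := vq y; have [vp1 vp2] := vq y'.
set xm := affine_pt q 0 y x0 in Gm vm1 vm2 *.
set xp := affine_pt q 0 y' x0 in Gp vp1 vp2 *.
clearbody xm xp.
have cx0 a b : 0 < a -> in_cone h a b x0.
  by move=> a0; apply: cval; rewrite ?re_x0 ?im_x0 // mulr1 mulr0 addr0.
(* A half plane with normal [(c, 1)] or [(c, -1)] contains 1, and a small slope [c] lets it also
   contain a value at distance [w] above or below [- m]. *)
have small w : 0 < w -> exists2 c, 0 < c & c * m < w.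
  move=> w0; exists (w / (2 * m)); first by rewrite divr_gt0 // mulr_gt0.
  rewrite (_ : w / (2 * m) * m = w / 2); first lra.
  by field; rewrite gt_eqF.
have [y0|y0] := ltP 0 y.
  have [c c0 cm] := small y y0.
  by apply: (cc _ _ _ c 1) => //; [apply: cval vm1 vm2 _|apply: cval vp1 vp2 _|exact: cx0]; lra.
have {}y0 : y < 0 by rewrite lt_neqAle yn0.
have [y'0|y'0] := leP y' 0.
  have {}y'0 : y' < 0 by rewrite lt_neqAle y'n0.
  have [|c c0 cm] := small (- y'); first by rewrite oppr_gt0.
  by apply: (cc _ _ _ c (-1)) => //; [apply: cval vm1 vm2 _|apply: cval vp1 vp2 _|exact: cx0]; lra.
have n0 : `|0 : R| <= 1 by rewrite normr0.
have n1 : `|1 : R| <= 1 by rewrite normr1.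
have nN1 : `|- 1 : R| <= 1 by rewrite normrN normr1.
have Gr := Gdisc 1 0 n1 n0.
have Gt := Gdisc 0 1 n0 n1.
have Gl := Gdisc (-1) 0 nN1 n0.
have Gb := Gdisc 0 (-1) n0 nN1.
rewrite !mulr1 !mulr0 ?mulrN1 in Gr Gt Gl Gb.
have [vr1 vr2] := vz rho 0; have [vt1 vt2] := vz 0 rho.
have [vl1 vl2] := vz (- rho) 0; have [vb1 vb2] := vz 0 (- rho).
have := @T_meridian h z rho rho0 uz.
set r := affine_pt z rho 0 (v h) in Gr vr1 vr2 *.
set t := affine_pt z 0 rho (v h) in Gt vt1 vt2 *.
set l := affine_pt z (- rho) 0 (v h) in Gl vl1 vl2 *.
set b := affine_pt z 0 (- rho) (v h) in Gb vb1 vb2 *.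
move=> mer.
have {}mer : (T r t * T t l * T l b * T b r = 1)%g.
  apply: mer => j; have [sj|/sepN] := boolP (sep j); last by left.
  by right; exists (al j), (be j) => a b' a1 b1; apply: Gdisc.
clearbody r t l b.
have V A B : G A -> G B -> (exists a b, in_cone h a b A /\ in_cone h a b B) ->
    (T A B * T B A)%g = 1%g.
  move=> GA GB [a1 [b1 [hA hB]]]; apply: T_coneV => j.
  have [sj|/sepN jh] := boolP (sep j).
    by exists (al j), (be j); rewrite /= GA // GB.
  by exists a1, b1; move: hA hB; rewrite /= /in_cone /re /im !jh => -> ->.
have [|c c0 cm] := small (- y); first by rewrite oppr_gt0.
have [c' c'0 c'm] := small y' y'0.
(* Cells of the subdivision: the two numbers supplied each time are the normal of a half plane
   containing the values of [u h] at the vertices. *)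
have E1 : (T xm b * T b x0)%g = T xm x0.
  by apply: (cc _ _ _ c (-1)) => //; [apply: cval vm1 vm2 _|apply: cval vb1 vb2 _|exact: cx0]; lra.
have E2 : (T xp t * T t x0)%g = T xp x0.
  by apply: (cc _ _ _ c' 1) => //; [apply: cval vp1 vp2 _|apply: cval vt1 vt2 _|exact: cx0]; lra.
have E3 : (T xm l * T l xp)%g = T xm xp.
  by apply: (cc _ _ _ (-1) 0) => //; [apply: cval vm1 vm2 _|apply: cval vl1 vl2 _|apply: cval vp1 vp2 _]; lra.
have E3' : (T l xp * T xp l)%g = 1%g.
  by apply: V => //; exists (-1), 0; split; [apply: cval vl1 vl2 _|apply: cval vp1 vp2 _]; lra.
have E4 : (T b r * T r x0)%g = T b x0.
  by apply: (cc _ _ _ 1 (-1)) => //; [apply: cval vb1 vb2 _|apply: cval vr1 vr2 _|apply: cx0]; lra.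
have E5 : (T t r * T r x0)%g = T t x0.
  by apply: (cc _ _ _ 1 1) => //; [apply: cval vt1 vt2 _|apply: cval vr1 vr2 _|apply: cx0]; lra.
have E6 : (T xm l * T l b)%g = T xm b.
  by apply: (cc _ _ _ (-1) (-1)) => //; [apply: cval vm1 vm2 _|apply: cval vl1 vl2 _|apply: cval vb1 vb2 _]; lra.
have E7 : (T xp l * T l t)%g = T xp t.
  by apply: (cc _ _ _ (-1) 1) => //; [apply: cval vp1 vp2 _|apply: cval vl1 vl2 _|apply: cval vt1 vt2 _]; lra.
have E8 : (T t r * T r t)%g = 1%g.
  by apply: V => //; exists 1, 1; split; [apply: cval vt1 vt2 _|apply: cval vr1 vr2 _]; lra.
have E9 : (T l t * T t l)%g = 1%g.
  by apply: V => //; exists (-1), 1; split; [apply: cval vl1 vl2 _|apply: cval vt1 vt2 _]; lra.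
rewrite -E3 -E2 -E7 -E5 -E1 -E6 -E4 -!mulgA (mulgA (T l xp)) E3' mul1g.
rewrite !mulgA; congr (_ * _)%g; rewrite -!mulgA; congr (_ * _)%g.
apply: (@mulIg _ (T r t * T t l)%g).
rewrite -[RHS]mulgA [in LHS]mulgA -(mulgA (T l t)) E8 mulg1 E9.
have : (T r t * T t l * (T l b * T b r))%g = 1%g by rewrite mulgA.
by move/eqP; rewrite -eq_invg_mul => /eqP E; rewrite mulgA -E mulVg.
Qed.

(** For a form other than [u h], the value at [q] is not real, so some half plane contains it
    together with the value 1 at [x0]. By convexity it contains the value at the point [z] where the
    segment from [x0] to [q] meets the hyperplane of [h], hence those on a small disc around [z]. *)
Lemma crossing h q : re h q < 0 -> im h q = 0 ->
  (forall j, u j =1 u h \/ im j q != 0) ->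
  exists2 e, 0 < e & forall y y', y <= y' -> y != 0 -> y' != 0 ->
    `|y| < e -> `|y'| < e ->
    (T (affine_pt q 0 y x0) (affine_pt q 0 y' x0) *
     T (affine_pt q 0 y' x0) x0 = T (affine_pt q 0 y x0) x0)%g.
Proof.
move=> rq iq gen; pose sep j := `[< ~ u j =1 u h >].
have sepN j : ~~ sep j -> u j =1 u h by move/asboolPn/contrapT.
have sep_im j : sep j -> im j q != 0.
  by move/asboolP => sj; case: (gen j) => [/sj|].
pose m := - re h q; have m0 : 0 < m by rewrite /m; lra.
(* Along the segment from [x0] to [q] the form [u h] runs from 1 to [- m], and vanishes at this
   parameter. *)
pose s := (1 + m)^-1; have s0 : 0 < s by rewrite invr_gt0; lra.
have s1 : s * (1 + m) = 1 by rewrite mulVf //; apply/eqP; lra.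
pose z := affine_pt x0 s 0 (q - x0).
have reB i x y : re i (x - y) = re i x - re i y.
  rewrite /re uD -scaleN1r uZ mulN1r.
  by case: (u i x : R[i]) (u i y : R[i]) => [? ?] [? ?].
have imB i x y : im i (x - y) = im i x - im i y.
  rewrite /im uD -scaleN1r uZ mulN1r.
  by case: (u i x : R[i]) (u i y : R[i]) => [? ?] [? ?].
have rz i : re i z = 1 - s + s * re i q.
  by rewrite re_affine reB imB re_x0 im_x0; ring.
have iz i : im i z = s * im i q.
  by rewrite im_affine reB imB re_x0 im_x0; ring.
(* A positive [al j] puts the value 1 at [x0] in the half plane, and this size of it leaves at least
   half of [im j q ^+ 2] at [q]. *)
pose be j := im j q; pose al j := im j q ^+ 2 / (2 * (`|re j q| + 1)).
pose L j x := al j * re j x + be j * im j x.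
have al0 j : sep j -> 0 < al j.
  by move=> sj; rewrite divr_gt0 ?gt0_2D1 // exprn_even_gt0 //= sep_im.
have Lq j : sep j -> 0 < L j q.
  move=> sj; rewrite /L /be -expr2; have q2 : 0 < im j q ^+ 2.
    by rewrite exprn_even_gt0 //= sep_im.
  have : al j * (2 * (`|re j q| + 1)) = im j q ^+ 2.
    by rewrite mulfVK // gt_eqF // gt0_2D1.
  have a0 := al0 j sj; have : - `|re j q| <= re j q by have := ler_norm (- re j q); rewrite normrN; lra.
  have : 0 <= `|re j q| by [].
  by nra.
have Lx0 j : sep j -> 0 < L j x0.
  by move=> sj; rewrite /L re_x0 im_x0 mulr1 mulr0 addr0 al0.
have s01 : 0 < 1 - s by nra.
have Lz j : sep j -> 0 < L j z.
  move=> sj; have -> : L j z = (1 - s) * L j x0 + s * L j q.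
    by rewrite /L rz iz re_x0 im_x0; ring.
  by rewrite addr_gt0 // mulr_gt0 ?Lx0 ?Lq.
have uz : u h z = 0 by apply/form_eq0; rewrite rz iz iq mulr0 /m in s1 *; split=> //; lra.
have [d d0 dP] := open_cone Lz.
have [rho rho0 /(_ _ _ _ _)/dP rhoP] := nearby_disc z (v h) d0.
have [e e0 eP] := open_cone Lq.
exists e => // y y' yy' yn0 y'n0 ye y'e.
have Gq w : `|w| < e -> forall j, sep j -> in_cone j (al j) (be j) (affine_pt q 0 w x0).
  by move=> we; apply/eP/nearby_vertical.
apply: (@crossing_core h q z m rho y y' sep al be) => //.
- by rewrite /m opprK.
- exact: Gq.
- exact: Gq.
Qed.

Lemma cone_vertical i al be q y y' : in_cone i al be q ->
  in_cone i al be (affine_pt q 0 y x0) -> 0 <= y' <= y ->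
  in_cone i al be (affine_pt q 0 y' x0).
Proof.
rewrite /in_cone !re_affine !im_affine re_x0 im_x0.
rewrite !(mul0r, mulr0, mulr1, subr0, subrr, addr0, add0r).
move=> h0 h1 /andP[y0 yy']; have [be0|be0] := leP 0 be; nra.
Qed.

(* The segment from x0 to such a point avoids the arrangement. *)
Definition in_star (a : Cn) := forall i, im i a != 0 \/ 0 < re i a.

Lemma star_cone a : in_star a -> forall i, exists al be, all (in_cone i al be) [:: a; x0].
Proof.
move=> aS i; rewrite /= /in_cone re_x0 im_x0.
have [i0|i0] := eqVneq (im i a) 0.
  exists 1, 0; rewrite !mul1r !mul0r !addr0 ltr01 andbT.
  by rewrite andbT; case: (aS i) => //; rewrite i0 eqxx.
pose c := im i a ^+ 2 / (2 * (`|re i a| + 1)).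
have i2 : 0 < im i a ^+ 2 by rewrite exprn_even_gt0 //= i0.
have c0 : 0 < c by rewrite divr_gt0 // gt0_2D1.
exists c, (im i a); rewrite mulr1 mulr0 addr0 c0 !andbT -expr2.
have : c * (2 * (`|re i a| + 1)) = im i a ^+ 2 by rewrite mulfVK // gt_eqF // gt0_2D1.
have : - `|re i a| <= re i a by have := ler_norm (- re i a); rewrite normrN; lra.
have : 0 <= `|re i a| by [].
by move: (re i a) `|_| (im i a ^+ 2) c c0 i2 => p np q2 c *; nra.
Qed.

(** The product of the transport from [a] up to height y and of the transport from there to [x0] is
    locally constant in y over the heights where the star of [x0] is reached. The others are
    finitely many; at each of them the forms that are real coincide by genericity, and [crossing]
    compares the two sides. *)
Lemma sweep a e : 0 < e -> generic a ->
  (forall i, exists al be, all (in_cone i al be) [:: a; affine_pt a 0 e x0]) ->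
  in_star (affine_pt a 0 e x0) ->
  (T a (affine_pt a 0 e x0) * T (affine_pt a 0 e x0) x0)%g = T a x0.
Proof.
move=> e0 ga va Se; pose pt y := affine_pt a 0 y x0.
pose S y := in_star (pt y).
have vert y y' : 0 <= y <= e -> 0 <= y' <= e -> (T a (pt y) * T (pt y) (pt y'))%g = T a (pt y').
  move=> ye y'e; apply: T_cone => i; have [al [be]] := va i.
  move=> /and3P[h0 h1 _]; exists al, be.
  by rewrite /= h0 !(cone_vertical h0 h1).
have rpt i y : re i (pt y) = re i a.
  by rewrite re_affine re_x0 im_x0 !(mul0r, mulr0, mulr1, subr0, subrr, addr0, add0r).
have ipt i y : im i (pt y) = im i a + y.
  by rewrite im_affine re_x0 im_x0 !(mul0r, mulr0, mulr1, subr0, subrr, addr0, add0r).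
have ptD y0 y : pt y = affine_pt (pt y0) 0 (y - y0) x0 by rewrite -affine_ptA addrC subrK.
pose f y := (T a (pt y) * T (pt y) x0)%g.
suff -> : T a x0 = f 0.
  apply/esym; apply: (@locally_constant_dense R _ f S e); [exact: e0| |exact: Se| |].
  - by move=> i; left; rewrite ipt addr0; case: (ga i).
  - move=> x y xy; have [z zxy zs] := avoid_seq [seq - im i a | i <- enum I] xy.
    exists z; [exact: zxy|move=> i; left; rewrite ipt]; 
      apply: contra zs => /eqP iz.
    by apply/mapP; exists i; rewrite ?mem_enum //; lra.
  move=> y0 y0e.
  have key : exists2 d, 0 < d & forall y y', 0 <= y <= e -> 0 <= y' <= e -> S y -> S y' ->
      y <= y' -> `|y - y0| < d -> `|y' - y0| < d ->
      (T (pt y) (pt y') * T (pt y') x0)%g = T (pt y) x0.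
    have [Sy0|/existsNP[h]] := pselect (S y0).
      have /open_common_cone[d d0 dP] := star_cone Sy0.
      exists d => // y y' _ _ _ _ _ yd y'd; apply: T_cone => i.
      have [al [be [nrP /andP[cx _]]]] := dP i; exists al, be.
      have nr w : `|w - y0| < d -> nearby d (pt y0) (pt w).
        by rewrite (ptD y0 w); apply: nearby_vertical.
      by rewrite /= cx !andbT; apply/andP; split; apply: nrP; exact: nr.
    move=> /not_orP[/negP]; rewrite negbK ipt rpt => /eqP ih /negP; rewrite -leNgt => rh.
    have iy0 : im h (pt y0) = 0 by rewrite ipt.
    have rh0 : re h (pt y0) < 0.
      rewrite rpt lt_neqAle rh andbT; have [al [be]] := va h.
      move=> /and3P[h0 h1 _]; have := cone_vertical h0 h1 y0e.
      rewrite /in_cone -/(pt y0) iy0 rpt mulr0 addr0.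
      by apply: contraTN => /eqP ->; rewrite mulr0 ltxx.
    have [|d d0 dP] := crossing rh0 iy0.
      move=> j; have [ij|] := eqVneq (im j (pt y0)) 0; last by right.
      left; apply: (ga j).2; move: ij iy0; rewrite !ipt; lra.
    exists d => // y y' _ _ Sy Sy' yy' yd y'd.
    have nz w : S w -> w - y0 != 0.
      move=> /(_ h); rewrite ipt rpt => -[|]; last by rewrite ltNge rh.
      by apply: contra; rewrite subr_eq0 => /eqP ->; rewrite ih.
    by rewrite (ptD y0 y) (ptD y0 y'); apply: dP; rewrite ?nz // lerD2r.
  have [d d0 dP] := key; exists d; first exact: d0.
  move=> y y' ye y'e Sy Sy' yd y'd.
  rewrite /f; have [yy'|/ltW y'y] := leP y y'.
    by rewrite -(dP y y' ye y'e Sy Sy' yy' yd y'd) mulgA (vert y y' ye y'e).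
  by rewrite -(dP y' y y'e ye Sy' Sy y'y y'd yd) mulgA (vert y' y y'e ye).
rewrite /f /pt affine_pt0 T_cone1 ?mul1g // => i; have [al [be]] := va i.
by move=> /and3P[h0 _ _]; exists al, be; rewrite /= h0.
Qed.

Lemma cone_star a : (forall i, exists al be, all (in_cone i al be) [:: a; x0]) ->
  in_star a.
Proof.
move=> h i; have [al [be]] := h i; rewrite /= /in_cone re_x0 im_x0 mulr1 mulr0 addr0 andbT.
case/andP=> ha al0; have [i0|] := eqVneq (im i a) 0; last by left.
by right; move: ha; rewrite i0 mulr0 addr0 pmulr_rgt0.
Qed.

(** By induction, one linear form at a time: moving along a direction where the new form is nonzero,
    each form excludes at most one parameter, and the forms constant in that direction keep their
    nonzero value. *)
Lemma avoid_hyperplanes (K : eqType) (g : K -> Cn -> R) (s : seq K) c e : 0 < e ->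
  (forall k x r w, g k (affine_pt x r 0 w) = g k x + r * g k w) ->
  (forall k, k \in s -> exists x, g k x != 0) ->
  exists2 a, nearby e c a & forall k, k \in s -> g k a != 0.
Proof.
move=> + gD; elim: s e => [|k s IH] e e0 gn0.
  by exists c; first exact: nearby_refl.
have [||a ca sa] := IH (e / 2); first by rewrite divr_gt0.
  by move=> k' ks; apply: gn0; rewrite inE ks orbT.
have [|x kx] := gn0 k; first by rewrite inE eqxx.
have e20 : 0 < e / 2 by rewrite divr_gt0.
have [rho rho0 rhoP] := nearby_disc a x e20.
have [r /andP[r0 rrho] rs] := avoid_seq [seq - g k' a / g k' x | k' <- k :: s] rho0.
have E : rho * (r / rho) = r by rewrite mulrCA divff ?mulr1 // gt_eqF.
have r1 : `|r / rho| <= 1.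
  by rewrite ger0_norm ?ler_pdivrMr ?mul1r ?divr_ge0 // ltW.
exists (affine_pt a r 0 x).
  rewrite (splitr e); apply: (nearby_trans ca).
  by have := rhoP _ 0 r1; rewrite E normr0 mulr0 ler01; apply.
move=> k' k's; rewrite gD; have [kx0|kx0] := eqVneq (g k' x) 0.
  rewrite kx0 mulr0 addr0; apply: sa; move: k's; rewrite inE => /orP[/eqP kk'|//].
  by rewrite -kk' kx0 eqxx in kx.
apply: contra rs => /eqP ar; apply/mapP; exists k' => //.
apply: (mulIf kx0); rewrite divfK //; lra.
Qed.

Lemma generic_exists c e : 0 < e -> exists2 a, generic a & nearby e c a.
Proof.
(* [K] lists the real linear forms to keep away from 0: each [im i], and [im i - im j] for the pairs
   with distinct forms, selected by [P]. *)
move=> e0; pose K : finType := (I + I * I)%type.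
pose g (k : K) x := match k with inl i => im i x | inr (i, j) => im i x - im j x end.
pose P (k : K) := match k with inl i => true | inr (i, j) => `[< ~ u i =1 u j >] end.
have [||a ca ha] := @avoid_hyperplanes K g [seq k <- enum K | P k] c e e0.
- by case=> [i|[i j]] x r w; rewrite /= !im_affine; ring.
- case=> [i|[i j]]; rewrite mem_filter => /andP[/= Pk _].
    exists (affine_pt (v i) 0 1 (v i)); rewrite im_affine /im /re uv /=.
    by rewrite mul0r mulr1 !add0r oner_eq0.
  move/asboolP: Pk => /existsNP[x /eqP uij].
  have [imE|imN] := eqVneq (im i x) (im j x); last by exists x; rewrite subr_eq0.
  (* At [(1 + i) x] the imaginary parts become sums of real and imaginary parts. These differ, since
     the two values at [x] differ and have the same imaginary part. *)
  exists (affine_pt x 0 1 x); rewrite !im_affine imE; apply: contra uij => /eqP h.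
  have rE : re i x = re j x by lra.
  move: rE imE; rewrite /re /im; case: (u i x : R[i]) (u j x : R[i]) => [? ?] [? ?] /=.
  by move=> -> ->.
exists a => // i; split.
  by apply: (ha (inl i)); rewrite mem_filter mem_enum.
move=> j ij; apply: contrapT => nij.
have := ha (inr (i, j)); rewrite mem_filter mem_enum /= ij subrr eqxx => /(_ _)/negP.
by apply=> //; rewrite andbT; apply/asboolP.
Qed.

(** A shift smaller than every nonzero [im i c] in absolute value preserves the signs of these and
    makes the vanishing imaginary parts positive, so the segment to [x0] becomes safe. *)
Lemma upward_shift c : (forall i, u i c != 0) ->
  exists2 d, 0 < d & common_cone [:: c; affine_pt c 0 d x0] /\
                     in_star (affine_pt c 0 d x0).
Proof.
move=> uc.
have [|d d0 dP] := @small_forall R I (fun i d => im i c != 0 -> d < `|im i c|).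
  move=> i; have [i0|i0] := eqVneq (im i c) 0; first by exists 1.
  have n0 : 0 < `|im i c| by rewrite normr_gt0.
  by exists (`|im i c| / 2); [lra|move=> d dd _; lra].
have {}dP i : im i c != 0 -> d < `|im i c| by apply: dP; rewrite d0 lexx.
exists d => //; split=> i.
  rewrite /= /in_cone re_affine im_affine re_x0 im_x0.
  rewrite !(mul0r, mulr0, mulr1, subr0, subrr, addr0, add0r).
  have [i0|i0] := eqVneq (im i c) 0.
    exists (re i c), 0; rewrite !mul0r !addr0 -expr2 exprn_even_gt0 //=.
    by have -> : re i c != 0 by apply: contraNneq (uc i) => r0; apply/eqP/form_eq0.
  exists 0, (im i c); rewrite !mul0r !add0r -expr2 exprn_even_gt0 //= i0 andbT.
  have := dP i i0; case: (ltrgt0P (im i c)) i0 => // im0 _; rewrite ?gtr0_norm ?ltr0_norm // => h.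
    by rewrite mulr_gt0 // addr_gt0.
  by rewrite nmulr_rgt0 //; lra.
left; rewrite im_affine re_x0 im_x0 mulr0 mulr1 add0r.
have [->|i0] := eqVneq (im i c) 0; first by rewrite add0r gt_eqF.
apply: contraTneq (dP i i0) => i0'; rewrite -leNgt.
have -> : im i c = - d by lra.
by rewrite normrN gtr0_norm.
Qed.

(** For generic [a], [sweep] replaces the transport from [a] to [x0] by the one through the shifted
    point. The shifts of all points near [c] and [x0] share half planes, so the outcome no longer
    depends on [a]. *)
Lemma local_potential c : (forall i, u i c != 0) ->
  exists w, exists2 e, 0 < e & forall a, nearby e c a ->
    (forall b, nearby e c b -> (T c a * T a b)%g = T c b) /\
    (generic a -> (T c a * T a x0)%g = w).
Proof.
move=> uc.
have [d d0 [vert star]] := upward_shift uc.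
pose sh a := affine_pt a 0 d x0.
have /choice[al] : forall i, exists al, exists be, in_cone i al be c /\ in_cone i al be (sh c).
  by move=> i; have [al [be /and3P[h1 h2 _]]] := vert i; exists al, be.
move=> /choice[be ab].
have [e1 e10 e1P] := open_cone (P := xpredT) (fun i _ => (ab i).1).
have [e2 e20 e2P] := open_cone (P := xpredT) (fun i _ => (ab i).2).
have [e3 e30 e3P] := open_common_cone (s := [:: x0]) (star_cone star).
exists (T c (sh c) * T (sh c) x0)%g, (Num.min e1 (Num.min e2 e3)).
  by rewrite !lt_min e10 e20.
set e := Num.min _ _.
have e0 : 0 < e by rewrite /e !lt_min e10 e20.
have ee1 : e <= e1 by rewrite /e ge_min lexx.
have ee2 : e <= e2 by rewrite /e !ge_min lexx orbT.
have ee3 : e <= e3 by rewrite /e !ge_min lexx !orbT.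
have C1 a : nearby e c a -> forall i, in_cone i (al i) (be i) a.
  by move=> ca i; apply: e1P => //; apply: nearbyW ca.
have C2 a : nearby e c a -> forall i, in_cone i (al i) (be i) (sh a).
  by move=> ca i; apply: e2P => //; apply: nearby_affine; apply: nearbyW ca.
have C3 a : nearby e c a -> nearby e3 (sh c) (sh a).
  by move=> ca; apply: nearby_affine; apply: nearbyW ca.
have cc : nearby e c c := nearby_refl c e0.
move=> a ca; split=> [b cb|ga].
  by apply: T_cone => i; exists (al i), (be i); rewrite /= !C1.
have h1 : (T c a * T a (sh a))%g = T c (sh a).
  by apply: T_cone => i; exists (al i), (be i); rewrite /= (C1 _ cc) (C1 _ ca) (C2 _ ca).
have h2 : (T c (sh c) * T (sh c) (sh a))%g = T c (sh a).
  by apply: T_cone => i; exists (al i), (be i); rewrite /= (C1 _ cc) (C2 _ cc) (C2 _ ca).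
have h3 : (T (sh c) (sh a) * T (sh a) x0)%g = T (sh c) x0.
  apply: T_cone => i; have [al' [be' [h /andP[hx0 _]]]] := e3P i; exists al', be'.
  by rewrite /= hx0 (h _ (C3 _ cc)) (h _ (C3 _ ca)).
have h4 : (T a (sh a) * T (sh a) x0)%g = T a x0.
  apply: sweep => // [i|]; first by exists (al i), (be i); rewrite /= (C1 _ ca) (C2 _ ca).
  apply: cone_star => i; have [al' [be' [h /andP[hx0 _]]]] := e3P i; exists al', be'.
  by rewrite /= hx0 (h _ (C3 _ ca)).
by rewrite -h4 mulgA h1 -h2 -mulgA h3.
Qed.

(** A generic point close to both [c] and [c'] computes both values of [E], and they differ by the
    transport between [c] and [c']. *)
Lemma potential_exists : exists E : Cn -> gT, forall c, (forall i, u i c != 0) ->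
  exists2 e, 0 < e & forall c', (forall i, u i c' != 0) -> nearby e c c' ->
    (T c c' * E c')%g = E c.
Proof.
have /choice[E EP] : forall c, exists w, (forall i, u i c != 0) ->
  exists2 e, 0 < e & forall a, nearby e c a ->
    (forall b, nearby e c b -> (T c a * T a b)%g = T c b) /\
    (generic a -> (T c a * T a x0)%g = w).
  move=> c; have [uc|nuc] := pselect (forall i, u i c != 0).
    by have [w h] := local_potential uc; exists w.
  by exists 1%g.
exists E => c uc; have [e e0 eP] := EP c uc.
exists (e / 2); first by rewrite divr_gt0.
move=> c' uc' cc'; have [e' e'0 e'P] := EP c' uc'.
have m0 : 0 < Num.min e' (e / 2) by rewrite lt_min e'0 divr_gt0.
have [a ga c'a] := generic_exists c' m0.
have c'a' : nearby e' c' a by apply: nearbyW c'a; rewrite ge_min lexx.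
have ca : nearby e c a.
  rewrite (splitr e); apply: (nearby_trans cc'); apply: nearbyW c'a.
  by rewrite ge_min lexx orbT.
have cc'e : nearby e c c' by apply: nearbyW cc'; lra.
rewrite -((e'P a c'a').2 ga) mulgA ((eP c' cc'e).1 a ca).
exact: (eP a ca).2.
Qed.

End ArrangementComplement.

(** * Continuity of complex coordinates *)

Lemma scaled_line (F : pzRingType) (W : lmodType F) (z w : W) (a b t : F) :
  z + a *: w + t *: (z + b *: w - (z + a *: w)) = z + (a + t * (b - a)) *: w.
Proof.
by rewrite opprD addrACA subrr add0r -scalerBl scalerA -addrA -scalerDl.
Qed.

Section ComplexContinuity.
Variable R : realType.

Lemma continuous_real_complex : continuous (fun t : R => t%:C%C : Cplx R).
Proof.
move=> t; apply/cvgrPdist_lt => -[e e'] /=.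
rewrite ltcE /= => /andP[/eqP -> e0].
near=> s.
rewrite -(rmorphB (real_complex R)) normc_def /= expr0n addr0 sqrtr_sqr.
rewrite ltcR; near: s; apply: cvgr_dist_lt => //; exact: cvg_id.
Unshelve. all: by end_near. Qed.

Lemma continuous_complex (S : topologicalType) (f g : S -> R) :
  continuous f -> continuous g -> continuous (fun x => (f x +i* g x)%C : Cplx R).
Proof.
move=> cf cg x.
rewrite (_ : (fun x => _) = fun x => (f x)%:C%C + 'i%C * (g x)%:C%C :> Cplx R); last first.
  by apply/funext => y; exact: (complexE (f y +i* g y)%C).
apply: cvgD.
  by apply: (@continuous_comp _ _ _ f (fun t : R => t%:C%C : Cplx R)); [exact: cf|exact: continuous_real_complex].
apply: cvgM; first exact: cvg_cst.
by apply: (@continuous_comp _ _ _ g (fun t : R => t%:C%C : Cplx R)); [exact: cg|exact: continuous_real_complex].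
Qed.

Lemma continuous_Re : continuous (fun z : Cplx R => complex.Re (z : R[i])).
Proof.
move=> z A /nbhs_ballP[e /= e0 eA]; apply/nbhs_ballP.
exists (e%:C%C : Cplx R); first by rewrite /= ltcR.
move=> w zw; apply: eA; rewrite /ball /= -ltcR -raddfB.
exact: le_lt_trans (normc_ge_Re _) zw.
Qed.

Lemma continuous_Im : continuous (fun z : Cplx R => complex.Im (z : R[i])).
Proof.
move=> z A /nbhs_ballP[e /= e0 eA]; apply/nbhs_ballP.
exists (e%:C%C : Cplx R); first by rewrite /= ltcR.
move=> w zw; apply: eA; rewrite /ball /= -ltcR -raddfB.
apply: le_lt_trans zw; rewrite normc_def lecR -sqrtr_sqr ler_wsqrtr //.
by rewrite lerDr sqr_ge0.
Qed.

Lemma continuous_row_form n (r : 'rV[Cplx R]_n) :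
  continuous (fun x : 'cV[Cplx R]_n => (r *m x) 0 0).
Proof.
have cD (f g : 'cV[Cplx R]_n -> Cplx R) :
    continuous f -> continuous g -> continuous (fun x => f x + g x).
  by move=> cf cg x; apply: (cvgD (cf x) (cg x)).
have cM (f g : 'cV[Cplx R]_n -> Cplx R) :
    continuous f -> continuous g -> continuous (fun x => f x * g x).
  by move=> cf cg x; apply: (cvgM (cf x) (cg x)).
have cs (s : seq 'I_n) :
    continuous (fun x : 'cV[Cplx R]_n => \sum_(j <- s) r 0 j * x j 0).
  elim: s => [|j s IH].
    by rewrite (_ : (fun x => _) = cst 0); [exact: cst_continuous|apply/funext => y; rewrite big_nil].
  rewrite (_ : (fun x => _) =
    fun x : 'cV[Cplx R]_n => r 0 j * x j 0 + \sum_(j <- s) r 0 j * x j 0); last first.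
    by apply/funext => y; rewrite big_cons.
  apply: cD IH; apply: cM; [exact: cst_continuous|exact: coord_continuous].
by rewrite (_ : (fun x => _) = fun x : 'cV[Cplx R]_n => \sum_j r 0 j * x j 0);
  [exact: cs|apply/funext => y; rewrite mxE].
Qed.

End ComplexContinuity.

(** * Triviality of pure braids in the reflection group *)

Section PureBraids.
Variables (R : realType) (gT : finGroupType) (n : nat).
Variable V : mx_representation (Cplx R) [set: gT]%SET n.
Local Notation C := (Cplx R).
Local Notation Cn := 'cV[C]_n.
Hypothesis hW : is_2reflection_group V.
Variable x0 : Cn.
Hypothesis hx0 : hyp_complement V x0.

Local Notation J := (`[0, 1]%classic : set R).
Local Notation X := (hyp_complement V).
Local Notation A := (@hyp_complement_quotient R gT n V).
Local Notation proj := (@orbit_proj R gT n V).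
Local Notation "p ** q" := (path_concat p q) (at level 40, left associativity).

Let u (i : refl V) : Cn -> C := reflection_form hW hx0 (val i).
Let v (i : refl V) : Cn := reflection_root hW hx0 (val i).

Let uD i x y : u i (x + y) = u i x + u i y.
Proof. exact: reflection_formD. Qed.
Let uZ i a x : u i (a *: x) = a * u i x.
Proof. exact: reflection_formZ. Qed.
Let ux0 i : u i x0 = 1.
Proof. by have [] := reflection_pairP hW hx0 (valP i). Qed.
Let uv i : u i (v i) = 1.
Proof. by have [] := reflection_pairP hW hx0 (valP i). Qed.

Let XP x : X x <-> forall i, u i x != 0.
Proof.
split=> [/(hyp_complementP hW hx0) h i|h]; first by apply: h; exact: valP.
apply/(hyp_complementP hW hx0) => s sR; exact: (h (exist _ s sR)).
Qed.

Local Notation re := (re_form u).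
Local Notation im := (im_form u).
Local Notation in_cone := (in_cone u).
Local Notation common_cone := (common_cone u).
Local Notation nearby := (nearby u).

Let continuous_re i : continuous (re i).
Proof.
move=> x; apply: (@continuous_comp _ _ _ (u i) (fun z : C => complex.Re (z : R[i]))).
  exact: continuous_row_form.
exact: continuous_Re.
Qed.

Let continuous_im i : continuous (im i).
Proof.
move=> x; apply: (@continuous_comp _ _ _ (u i) (fun z : C => complex.Im (z : R[i]))).
  exact: continuous_row_form.
exact: continuous_Im.
Qed.

Lemma continuous_affine_pt (S : topologicalType) (f g : S -> Cn) (a b : S -> R) :
  continuous f -> continuous g -> continuous a -> continuous b ->
  continuous (fun x => affine_pt (f x) (a x) (b x) (g x)).
Proof.
move=> cf cg ca cb x.
rewrite (_ : (fun x => _) = fun x => f x + ((a x +i* b x)%C : C) *: g x); last first.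
  by apply/funext => y; rewrite affine_ptE.
have cz : continuous (fun y => (a y +i* b y)%C : C) by exact: continuous_complex.
have := @cvgD _ _ _ (nbhs x) _ _ _ _ _ (cf x) (@cvgZ _ _ _ (nbhs x) _ _ _ _ _ (cz x) (cg x)).
by apply; exact: nbhs_filter.
Qed.

Definition segment_path (a b : Cn) : R -> Cn := fun t => affine_pt a t 0 (b - a).

Let cone_mix i al be a b t : in_cone i al be a -> in_cone i al be b ->
  t \in `[0, 1] -> in_cone i al be (affine_pt a t 0 (b - a)).
Proof.
move=> ha hb /mem01P t01; rewrite /in_cone re_affine // im_affine //.
have -> : re i (b - a) = re i b - re i a.
  rewrite /re_form uD -scaleN1r uZ mulN1r.
  by case: (u i a : R[i]) (u i b : R[i]) => [? ?] [? ?].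
have -> : im i (b - a) = im i b - im i a.
  rewrite /im_form uD -scaleN1r uZ mulN1r.
  by case: (u i a : R[i]) (u i b : R[i]) => [? ?] [? ?].
move: ha hb; rewrite /in_cone.
move: (re i a) (im i a) (re i b) (im i b) => p q p' q' ha hb.
have -> : al * (p + (t * (p' - p) - 0 * (q' - q))) +
          be * (q + (t * (q' - q) + 0 * (p' - p))) =
          (1 - t) * (al * p + be * q) + t * (al * p' + be * q') by ring.
move: (_ + _ * q) (_ + _ * q') ha hb => c d c0 d0.
have [/andP[t0 t1]] := t01; have [t0'|t0'] := ltP 0 t; nra.
Qed.

Let common_cone_X x : common_cone [:: x] -> X x.
Proof.
move=> cx; apply/XP => i; have [al [be /andP[h _]]] := cx i.
exact: cone_neq0 h.
Qed.

Lemma segment_path_ends a b : segment_path a b 0 = a /\ segment_path a b 1 = b.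
Proof.
rewrite /segment_path affine_pt0; split=> //.
by rewrite affine_ptE (_ : (1 +i* 0)%C = 1) // scale1r addrC subrK.
Qed.

Lemma continuous_segment_path a b : continuous (segment_path a b).
Proof.
apply: continuous_affine_pt => x; by [exact: cst_continuous|exact: cvg_id].
Qed.

Let segment_is_path a b : common_cone [:: a; b] -> is_path X a b (segment_path a b).
Proof.
move=> cab; have [s0 s1] := segment_path_ends a b; split=> //.
  by apply: continuous_subspaceT; exact: continuous_segment_path.
move=> _ [t t01 <-]; apply: common_cone_X => i; have [al [be /and3P[ha hb _]]] := cab i.
by exists al, be; rewrite /= cone_mix.
Qed.

(** The straight line homotopy works: at each time the two points share half planes, so the segment
    joining them avoids the arrangement. *)
Let homotopy_cone a b (p q : R -> Cn) : is_path X a b p -> is_path X a b q ->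
  (forall t, t \in `[0, 1] -> common_cone [:: p t; q t]) ->
  path_equiv X a b p q.
Proof.
move=> pP qP pq; have [cp pX p0 p1] := pP; have [cq qX q0 q1] := qP; split=> //.
have seg_in (s t : R) : s \in `[0, 1] -> t \in `[0, 1] ->
    X (affine_pt (p t) s 0 (q t - p t)).
  move=> s01 t01; apply: common_cone_X => i; have [al [be /and3P[ha hb _]]] := pq t t01 i.
  by exists al, be; rewrite /= cone_mix.
have deg a' s : affine_pt a' s 0 (a' - a') = a'.
  by rewrite affine_ptE subrr scaler0 addr0.
exists (fun x => affine_pt (p x.2) x.1 0 (q x.2 - p x.2)); split.
- rewrite within_square; move/within01P in cp; move/within01P in cq.
  have c2 (f : R -> Cn) : continuous (f \o @clamp R) ->
      continuous (fun x : R * R => f (clamp x.2)).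
    by move=> cf x; apply: (@continuous_comp _ _ _ snd (f \o @clamp R)); [exact: cvg_snd|exact: cf].
  apply: (@continuous_affine_pt _ (fun x : R * R => p (clamp x.2))
    (fun x => q (clamp x.2) - p (clamp x.2)) (fun x => clamp x.1) (fun=> 0)).
  + exact: (c2 p cp).
  + by move=> x; exact: (cvgB (c2 q cq x) (c2 p cp x)).
  + by move=> x; apply: (@continuous_comp _ _ _ fst (@clamp R)); [exact: cvg_fst|exact: continuous_clamp].
  + exact: cst_continuous.
- by move=> _ [[s t] [/= s01 t01] <-]; apply: seg_in.
- move=> t t01 /=; rewrite affine_pt0; split=> //.
  by rewrite affine_ptE (_ : (1 +i* 0)%C = 1) // scale1r addrC subrK.
- by move=> s s01 /=; rewrite p0 p1 q0 q1 !deg.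
Qed.

Lemma continuous_orbit_proj : continuous proj.
Proof. exact: pi_continuous. Qed.

Let proj_path (a b : Cn) (p : R -> Cn) : is_path X a b p -> is_path A (proj a) (proj b) (proj \o p).
Proof.
move=> [cp pX p0 p1]; split; last 2 first.
- by rewrite /= p0.
- by rewrite /= p1.
- apply/within01P; move/within01P in cp => t.
  by apply: (@continuous_comp _ _ _ (p \o @clamp R) proj); [exact: cp|exact: continuous_orbit_proj].
- by move=> _ [t t01 <-]; exists (p t) => //; apply: pX; exists t.
Qed.

Let proj_equiv (a b : Cn) (p q : R -> Cn) : path_equiv X a b p q ->
  path_equiv A (proj a) (proj b) (proj \o p) (proj \o q).
Proof.
move=> [pP qP [H [cH HX H01 Hpq]]]; split; [exact: proj_path pP|exact: proj_path qP|].
exists (proj \o H); split.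
- apply/within_square; move/within_square in cH => t.
  by apply: (@continuous_comp _ _ _ (fun x => H (clamp x.1, clamp x.2)) proj); [exact: cH|exact: continuous_orbit_proj].
- by move=> _ [t t01 <-]; exists (H t) => //; apply: HX; exists t.
- by move=> t /H01 /= [-> ->].
- by move=> s /Hpq /= [-> ->].
Qed.

Let proj_concat (p q : R -> Cn) : proj \o (p ** q) = (proj \o p) ** (proj \o q).
Proof. by apply/funext => t; rewrite /path_concat /=; case: ifP. Qed.

Lemma orbit_projV w x : proj (V w *m x) = proj x.
Proof.
apply/eqmodP; apply/existsP; exists (w^-1)%g.
by rewrite mulmxA -repr_mxM ?inE // mulVg repr_mx1 mul1mx.
Qed.

(** A point is joined to its upward shift, and the shift to [x0], by segments of X. *)
Let path_connected_X a : X a -> exists p : R -> Cn, is_path X x0 a p.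
Proof.
move=> /XP ua.
have [d d0 [ab star]] := upward_shift uD uZ ux0 ua.
set b := affine_pt a 0 d x0 in ab star.
have {}ab : common_cone [:: b; a].
  by apply: (common_coneS _ ab) => y; rewrite !inE orbC.
have bx : common_cone [:: x0; b].
  apply: (common_coneS (s2 := [:: b; x0])) => [y|]; first by rewrite !inE orbC.
  exact: star_cone.
exists (segment_path x0 b ** segment_path b a).
exact: is_path_concat (segment_is_path bx) (segment_is_path ab).
Qed.

Let path_connected_A y : A y -> exists p : R -> orbit_space V, is_path A (proj x0) y p.
Proof.
by move=> [a Xa <-]; have [p pP] := path_connected_X Xa; exists (proj \o p); exact: proj_path.
Qed.

Variable phi : (R -> orbit_space V) -> gT.
Hypothesis phi_homotopic : forall b c, braid_loop x0 b -> braid_loop x0 c ->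
  braid_homotopic b c -> phi b = phi c.
Hypothesis phi_concat : forall b c, braid_loop x0 b -> braid_loop x0 c ->
  phi (b ** c) = (phi b * phi c)%g.
Hypothesis phi_braided : forall s b, braided_reflection x0 s b -> phi b = s.

Let tau (p : R -> Cn) : gT := groupoid_rep A (proj x0) phi (proj \o p).

Let tau_equiv a b p q : path_equiv X a b p q -> tau p = tau q.
Proof.
move=> /proj_equiv.
exact: (groupoid_rep_equiv phi_homotopic path_connected_A).
Qed.

Let tau_concat a b c p q : is_path X a b p -> is_path X b c q ->
  tau (p ** q) = (tau p * tau q)%g.
Proof.
move=> /proj_path pP /proj_path qP; rewrite /tau proj_concat.
exact: (groupoid_rep_concat phi_homotopic phi_concat path_connected_A pP qP).
Qed.

Let tau_cst a : X a -> tau (cst a) = 1%g.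
Proof.
move=> Xa; rewrite /tau (_ : proj \o cst a = cst (proj a)) //.
by apply: (groupoid_rep_cst phi_homotopic phi_concat path_connected_A); exists a.
Qed.

(** The value carries information only when the segment lies in X, which the cone conditions
    ensure. *)
Let T a b := tau (segment_path a b).

Let T_cone a b c : common_cone [:: a; b; c] -> (T a b * T b c)%g = T a c.
Proof.
move=> abc.
have sub x y : x \in [:: a; b; c] -> y \in [:: a; b; c] -> common_cone [:: x; y].
  move=> xs ys; apply: common_coneS abc => z; rewrite inE => /orP[/eqP->//|].
  by rewrite inE => /eqP ->.
have [ab bc ac] : [/\ common_cone [:: a; b], common_cone [:: b; c] & common_cone [:: a; c]].
  by split; apply: sub; rewrite !inE eqxx ?orbT.
have [P Q S] := And3 (segment_is_path ab) (segment_is_path bc) (segment_is_path ac).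
rewrite /T -(tau_concat P Q); apply: (@tau_equiv a c); apply: homotopy_cone => //.
  exact: is_path_concat P Q.
move=> t t01 i; have [al [be /and4P[ha hb hc _]]] := abc i.
exists al, be; rewrite /= [in_cone i al be (segment_path a c t)]cone_mix // !andbT.
move/mem01P: t01 => t01; rewrite /path_concat; case: (lerP t 2^-1) => ht.
  by apply: cone_mix => //; apply/mem01P; lra.
by apply: cone_mix => //; apply/mem01P; lra.
Qed.

Lemma reflection_order2 s : s \in reflections V -> (s * s = 1)%g.
Proof.
move=> sR; apply: (mx_faithful_inj hW.1); rewrite ?inE //.
rewrite repr_mx1 repr_mxM ?inE //; have [c [r [-> rc]]] := reflection_rank1 hW sR.
rewrite mulmxDr mulmx1 mulmxDl mul1mx -mulmxA (mulmxA r) [r *m c]mx11_scalar rc.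
rewrite mul_scalar_mx -scalemxAr -addrA -[RHS]addr0; congr (_ + _).
by rewrite addrA -mulr2n -scaler_nat -scalerDl subrr scale0r.
Qed.

Lemma hyp_complementV w x : X x -> X (V w *m x).
Proof.
move=> Xx r rR Vr; apply: (Xx (r ^ w)%g); first by rewrite reflectionsJ.
rewrite conjgE !repr_mxM ?inE // -!mulmxA Vr mulmxA -repr_mxM ?inE //.
by rewrite mulVg repr_mx1 mul1mx.
Qed.

Let continuous_reflection (i : refl V) : continuous (fun x : Cn => V (val i) *m x).
Proof.
rewrite (_ : (fun x => _) =
  fun x => affine_pt x (- 2 * re i x) (- 2 * im i x) (v i)); last first.
  apply/funext => x; rewrite (reflectionE hW hx0 _ (valP i)) affine_ptE -/(u i x).
  rewrite -/(v i) -scaleNr; congr (_ + _ *: _); rewrite /re_form /im_form.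
  case: (u i x : R[i]) => p q; apply/eqP; rewrite eq_complex /=.
  by apply/andP; split; apply/eqP; ring.
apply: continuous_affine_pt.
- by move=> x; exact: cvg_id.
- exact: cst_continuous.
- by move=> x; exact: (cvgM (@cst_continuous Cn R (-2) x) (@continuous_re i x)).
- by move=> x; exact: (cvgM (@cst_continuous Cn R (-2) x) (@continuous_im i x)).
Qed.

Let V_affine i z a b : u i z = 0 ->
  V (val i) *m affine_pt z a b (v i) = affine_pt z (- a) (- b) (v i).
Proof.
move=> uz; rewrite !affine_ptE mulmxDr -scalemxAr.
rewrite !(reflectionE hW hx0 _ (valP i)) -/(u i z) -/(v i) uz mulr0 scale0r subr0.
rewrite -/(u i (v i)) uv mulr1 -[X in X - _]scale1r -scalerBl scalerA.
congr (_ + _ *: _); rewrite -[RHS]opprK; apply/eqP.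
by rewrite eq_complex /=; apply/andP; split; apply/eqP; rewrite /=; ring.
Qed.

(** A segment and its image by [w] have the same projection to the orbit space, where transport is
    computed. *)
Let T_V w a b : T (V w *m a) (V w *m b) = T a b.
Proof.
rewrite /T /tau; congr groupoid_rep; apply/funext => t /=.
rewrite -(orbit_projV w (segment_path a b t)); congr proj.
by rewrite /segment_path !affine_ptE mulmxDr -scalemxAr mulmxBr.
Qed.

Let segment_affine z a b c d w t :
  segment_path (affine_pt z a b w) (affine_pt z c d w) t =
  affine_pt z (a + t * (c - a)) (b + t * (d - b)) w.
Proof.
rewrite /segment_path !affine_ptE scaled_line; congr (_ + _ *: _); apply/eqP.
by rewrite eq_complex /=; apply/andP; split; apply/eqP; rewrite /=; ring.
Qed.

(** The reflection maps the first half of the square to the second, so the holonomy is the square of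
    the transport along a half turn. Prolonged by a path from [x0] and its reflected image, the half
    turn becomes a braided reflection; its transport is thus conjugate to an element of order 2. *)
Let T_meridian i z rho : 0 < rho -> u i z = 0 ->
  (forall j, u j =1 u i \/ exists al be, forall a b, `|a| <= 1 -> `|b| <= 1 ->
     in_cone j al be (affine_pt z (rho * a) (rho * b) (v i))) ->
  (T (affine_pt z rho 0 (v i)) (affine_pt z 0 rho (v i)) *
   T (affine_pt z 0 rho (v i)) (affine_pt z (- rho) 0 (v i)) *
   T (affine_pt z (- rho) 0 (v i)) (affine_pt z 0 (- rho) (v i)) *
   T (affine_pt z 0 (- rho) (v i)) (affine_pt z rho 0 (v i)) = 1)%g.
Proof.
move=> rho0 uz cone.
have n0 : `|0 : R| <= 1 by rewrite normr0.
have n1 : `|1 : R| <= 1 by rewrite normr1.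
have nN1 : `|- 1 : R| <= 1 by rewrite normrN normr1.
pose D a b := affine_pt z (rho * a) (rho * b) (v i).
have [rz iz] := (form_eq0 u i z).1 uz.
have [rv iv] : re i (v i) = 1 /\ im i (v i) = 0.
  by rewrite /re_form /im_form uv.
have reD j a b : u j =1 u i -> re j (D a b) = rho * a /\ im j (D a b) = rho * b.
  move=> ji; rewrite /re_form /im_form ji -/(re i (D a b)) -/(im i (D a b)).
  by rewrite (re_affine uD uZ) (im_affine uD uZ) rv iv rz iz; split; ring.
(* points of the disc on one side of a line through its centre *)
have coneD a b c d al be : `|a| <= 1 -> `|b| <= 1 -> `|c| <= 1 -> `|d| <= 1 ->
    0 < al * a + be * b -> 0 < al * c + be * d -> common_cone [:: D a b; D c d].
  move=> a1 b1 c1 d1 h1 h2 j; case: (cone j) => [ji|[al' [be' h]]]; last first.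
    by exists al', be'; rewrite /= !h.
  exists al, be; have [r1 i1] := reD j a b ji; have [r2 i2] := reD j c d ji.
  rewrite /= /in_cone r1 i1 r2 i2 !(mulrCA _ rho) -!mulrDr andbT.
  by rewrite !pmulr_rgt0 // h1 h2.
have XD a b : `|a| <= 1 -> `|b| <= 1 -> (a != 0) || (b != 0) -> X (D a b).
  move=> a1 b1 ab; have [c cx] : exists c, c = D a b by eexists.
  apply: common_cone_X; apply: (@common_coneS _ _ _ _ _ [:: D a b; D a b]) => [y|].
    by rewrite !inE orbb.
  have ab0 : 0 < a * a + b * b.
    rewrite -!expr2; case/orP: ab => h.
      by rewrite ltr_wpDr ?sqr_ge0 // exprn_even_gt0.
    by rewrite ltr_wpDl ?sqr_ge0 // exprn_even_gt0.
  exact: (coneD _ _ _ _ a b).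
set r := affine_pt z rho 0 (v i); set t := affine_pt z 0 rho (v i).
set l := affine_pt z (- rho) 0 (v i); set b := affine_pt z 0 (- rho) (v i).
have rD : r = D 1 0 by rewrite /D mulr1 mulr0.
have tD : t = D 0 1 by rewrite /D mulr1 mulr0.
have lD : l = D (-1) 0 by rewrite /D mulrN1 mulr0.
have Vr : V (val i) *m r = l by rewrite V_affine // oppr0.
have Vt : V (val i) *m t = b by rewrite V_affine // oppr0.
have Vl : V (val i) *m l = r by rewrite V_affine // oppr0 opprK.
have -> : T l b = T r t by rewrite -Vr -Vt T_V.
have -> : T b r = T t l by rewrite -Vt -Vl T_V.
pose w := (rho%:C%C : C) *: v i.
have half_in tt : half_turn z w tt = D (cos (pi * tt)) (sin (pi * tt)).
  rewrite /half_turn /D affine_ptE /w scalerA; congr (_ + _ *: _); apply/eqP.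
  by rewrite eq_complex /=; apply/andP; split; apply/eqP; rewrite /=; ring.
have cs1 x : `|cos x : R| <= 1 /\ `|sin x : R| <= 1.
  by rewrite !ler_norml cos_geN1 cos_le1 sin_geN1 sin_le1.
have halfP : is_path X r l (half_turn z w).
  split.
  - apply: continuous_subspaceT; rewrite (_ : half_turn z w =
      fun tt => affine_pt z (rho * cos (pi * tt)) (rho * sin (pi * tt)) (v i)); last first.
      by apply/funext => tt; exact: half_in.
    have cpi : continuous (fun tt : R => pi * tt).
      by move=> x; exact: (cvgM (@cst_continuous R R pi x) (@cvg_id _ (nbhs x))).
    have cc : continuous (fun tt : R => cos (pi * tt)).
      by move=> x; apply: continuous_comp; [exact: cpi|exact: continuous_cos].
    have cs : continuous (fun tt : R => sin (pi * tt)).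
      by move=> x; apply: continuous_comp; [exact: cpi|exact: continuous_sin].
    apply: continuous_affine_pt; [exact: cst_continuous|exact: cst_continuous| |].
      by move=> x; exact: (cvgM (@cst_continuous R R rho x) (cc x)).
    by move=> x; exact: (cvgM (@cst_continuous R R rho x) (cs x)).
  - move=> _ [tt tt01 <-]; rewrite half_in; apply: XD; [exact: (cs1 _).1|exact: (cs1 _).2|].
    rewrite -negb_and; apply/negP => /andP[/eqP c0 /eqP s0].
    by have := cos2Dsin2 (pi * tt); rewrite c0 s0 expr0n addr0 => /eqP; rewrite eq_sym oner_eq0.
  - by rewrite half_in mulr0 cos0 sin0 rD.
  - by rewrite half_in mulr1 cospi sinpi lD.
have tauhalf : tau (half_turn z w) = (T r t * T t l)%g.
  have rt : common_cone [:: r; t].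
    by rewrite rD tD; apply: (coneD _ _ _ _ 1 1) => //; rewrite ?mulr1 ?mulr0; lra.
  have tl : common_cone [:: t; l].
    by rewrite lD tD; apply: (coneD _ _ _ _ (-1) 1) => //; rewrite ?mulrN1 ?mulr1 ?mulr0; lra.
  have [P Q] := (segment_is_path rt, segment_is_path tl).
  rewrite /T -(tau_concat P Q); apply: (tau_equiv (a := r) (b := l)).
  apply: homotopy_cone => //; first exact: is_path_concat P Q.
  move=> tt /mem01P tt01; rewrite half_in.
  have [c1 s1] := cs1 (pi * tt); have cs2 := cos2Dsin2 (pi * tt).
  have pi0 := pi_gt0 R.
  have s0 : 0 <= sin (pi * tt) by apply: sin_ge0_pi; apply/andP; split; nra.
  (* On the two quarter turns, the arc and its chord lie in the half planes with normals (1, 1) and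
     (-1, 1). *)
  rewrite /path_concat; case: (lerP tt 2^-1) => ht.
    have c0 : 0 <= cos (pi * tt) by apply: cos_ge0_pihalf; apply/andP; split; nra.
    have -> : segment_path r t (2 * tt) = D (1 - 2 * tt) (2 * tt).
      by rewrite /r /t segment_affine /D; congr affine_pt; ring.
    apply: (coneD _ _ _ _ 1 1) => //.
    - by rewrite ler_norml; lra.
    - by rewrite ler_norml; lra.
    - by move: cs2; rewrite !mul1r; move: (cos _) (sin _) c0 s0 => x y; nra.
    - by lra.
  have c0 : cos (pi * tt) <= 0.
    rewrite -oppr_ge0 -sinBpihalf; apply: sin_ge0_pi.
    by apply/andP; split; nra.
  have -> : segment_path t l (2 * tt - 1) = D (1 - 2 * tt) (2 - 2 * tt).
    by rewrite /l /t segment_affine /D; congr affine_pt; ring.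
  apply: (coneD _ _ _ _ (-1) 1) => //.
  - by rewrite ler_norml; lra.
  - by rewrite ler_norml; lra.
  - by move: cs2; rewrite mul1r; move: (cos _) (sin _) c0 s0 => x y; nra.
  - by lra.
rewrite -mulgA -tauhalf.
have Xr : X r by rewrite rD; apply: XD; rewrite ?oner_eq0.
have [g gP] := path_connected_X Xr.
pose sg tt := V (val i) *m g tt.
have sgP : is_path X (V (val i) *m x0) l sg.
  have [cg gX g0 g1] := gP; split.
  - apply/within01P; move/within01P in cg => x.
    by apply: (@continuous_comp _ _ _ (g \o @clamp R) (fun y : Cn => V (val i) *m y)); [exact: cg|exact: continuous_reflection].
  - by move=> _ [tt tt01 <-]; apply: hyp_complementV; apply: gX; exists tt.
  - by rewrite /sg g0.
  - by rewrite /sg g1.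
pose b0 := (g ** half_turn z w) ** path_rev sg.
have gh := is_path_concat gP halfP; have rsg := is_path_rev sgP.
have b0P : is_path X x0 (V (val i) *m x0) b0 by exact: is_path_concat gh rsg.
have loopb : braid_loop x0 (proj \o b0).
  by have := proj_path b0P; rewrite orbit_projV.
have zw : z + w = r by rewrite /r affine_ptE.
have br : braided_reflection x0 (val i) (proj \o b0).
  split; first exact: valP.
  split; first exact: loopb.
  exists z, w, g; split.
  - by apply/(reflection_fixed hW hx0 _ (valP i)).
  - rewrite /w -scalemxAr (reflectionE hW hx0 _ (valP i)) -/(u i _) -/(v i) uv mulr1.
    by rewrite -[X in X - _]scale1r -scalerBl -scalerN -scaleN1r; congr (_ *: (_ *: _)); ring.
  - case=> a c /andP[l0 l1].
    have -> : z + ((a +i* c)%C : C) *: w = D a c.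
      rewrite /D affine_ptE /w scalerA; congr (_ + _ *: _); apply/eqP.
      by rewrite eq_complex /=; apply/andP; split; apply/eqP; rewrite /=; ring.
    have ac : a ^+ 2 + c ^+ 2 <= 1.
      move: l1; rewrite normc_def /= -[1 in X in X -> _]/(1%:C%C) lecR.
      by rewrite -[X in _ <= X]sqrtr1 ler_psqrt ?nnegrE ?addr_ge0 ?sqr_ge0.
    have sq1 x y : x ^+ 2 + y ^+ 2 <= 1 -> `|x : R| <= 1.
      move=> xy; rewrite -(@ler_pXn2r _ 2) ?nnegrE // expr1n real_normK ?num_real //.
      by rewrite (le_trans _ xy) // lerDl sqr_ge0.
    apply: XD; [exact: sq1 ac|by apply: (sq1 _ a); rewrite addrC|].
    rewrite -negb_and; apply: contraTN l0 => /andP[/eqP -> /eqP ->].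
    by rewrite (_ : (0 +i* 0)%C = 0 :> C) // normr0 ltxx.
  - move=> q qR qz; have q0 := (reflection_fixed hW hx0 z qR).1 qz.
    have qi : reflection_form hW hx0 q =1 reflection_form hW hx0 (val i).
      case: (cone (exist _ q qR)) => [h|[al [be h]]]; first exact: h.
      have := cone_neq0 (h 0 0 n0 n0).
      by rewrite !mulr0 affine_pt0 => /eqP; case.
    exact: (eq_reflection_form qR (valP i) qi).
  - split; first by rewrite zw.
    by have [] := path_equiv_refl (proj_path b0P).
have [g0 g0P] := groupoid_rep_loop phi_homotopic phi_concat path_connected_A.
have tb : tau b0 = (val i ^ g0)%g by rewrite /tau g0P // (phi_braided br).
have tb2 : tau b0 = (tau g * tau (half_turn z w) * (tau g)^-1)%g.
  rewrite (tau_concat gh rsg) (tau_concat gP halfP); congr (_ * _)%g.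
  rewrite /tau (_ : proj \o path_rev sg = path_rev (proj \o g)); last first.
    by apply/funext => tt; rewrite /path_rev /= /sg orbit_projV.
  exact: (groupoid_rep_rev phi_homotopic phi_concat path_connected_A (proj_path gP)).
have : (tau b0 * tau b0 = 1)%g by rewrite tb -conjMg (reflection_order2 (valP i)) conj1g.
rewrite tb2 -!mulgA mulKg => /(congr1 (fun x => (tau g)^-1 * x * tau g)%g).
by rewrite mulKg mulg1 mulVg -!mulgA mulVg mulg1.
Qed.

Let subpath (g : R -> Cn) (a b : R) : R -> Cn := fun t => g (a + t * (b - a)).

Let subpath_is_path g x y a b : is_path X x y g ->
  a \in `[0, 1] -> b \in `[0, 1] -> is_path X (g a) (g b) (subpath g a b).
Proof.
move=> gP /mem01P a01 /mem01P b01.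
have := @is_path_comp _ _ X x y g (fun t => a + t * (b - a)) gP.
have -> : a + 0 * (b - a) = a by ring.
have -> : a + 1 * (b - a) = b by ring.
apply=> [t|t /mem01P t01]; last by apply/mem01P; nra.
apply: cvgD; first exact: cvg_cst.
by apply: cvgM; [exact: cvg_id|exact: cvg_cst].
Qed.

Let tau_subpath g x y a b c : is_path X x y g ->
  a \in `[0, 1] -> b \in `[0, 1] -> c \in `[0, 1] ->
  tau (subpath g a c) = (tau (subpath g a b) * tau (subpath g b c))%g.
Proof.
move=> gP aJ bJ cJ.
have P := subpath_is_path gP aJ bJ; have Q := subpath_is_path gP bJ cJ.
rewrite -(tau_concat P Q); apply/esym; apply: (tau_equiv (a := g a) (b := g c)).
have [_ _ e0 e1] := is_path_concat P Q; rewrite -{1}e0 -{1}e1.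
move/mem01P: aJ => a01; move/mem01P: bJ => b01; move/mem01P: cJ => c01.
pose r1 (t : R) := a + Num.min (2 * t) 1 * (b - a) + Num.max 0 (2 * t - 1) * (c - b).
have c2 : continuous (fun t : R => 2 * t).
  by move=> t; exact: (cvgM (@cst_continuous R R 2 t) (@cvg_id _ (nbhs t))).
have cmin : continuous (fun t : R => Num.min (2 * t) 1).
  by apply: continuous_minr => //; exact: cst_continuous.
have cmax : continuous (fun t : R => Num.max 0 (2 * t - 1)).
  apply: continuous_maxr; first exact: cst_continuous.
  by move=> t; exact: (cvgB (c2 t) (@cst_continuous R R 1 t)).
apply: (@path_equiv_reparam _ _ X x y g _ r1 (fun t => a + t * (c - a))) => //.
- move=> t; apply: cvgD; last first.
    exact: (cvgM (cmax t) (@cst_continuous R R (c - b) t)).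
  apply: cvgD; first exact: cvg_cst.
  exact: (cvgM (cmin t) (@cst_continuous R R (b - a) t)).
- move=> t; apply: cvgD; first exact: cvg_cst.
  by apply: cvgM; [exact: cvg_id|exact: cvg_cst].
- move=> t /mem01P t01; split; apply/mem01P; last nra.
  rewrite /r1; case: (lerP (2 * t) 1) => h1; case: (lerP 0 (2 * t - 1)) => h2; nra.
- by rewrite /r1; case: (lerP (2 * 0) 1) => h1; case: (lerP 0 (2 * 0 - 1)) => h2; lra.
- by rewrite /r1; case: (lerP (2 * 1) 1) => h1; case: (lerP 0 (2 * 1 - 1)) => h2; lra.
move=> t /mem01P t01; rewrite /path_concat /subpath /r1.
case: (lerP t 2^-1) => h; case: (lerP (2 * t) 1) => h1; case: (lerP 0 (2 * t - 1)) => h2;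
  congr g; nra.
Qed.

(** The transport along [g] up to time t, multiplied by the potential at [g t], is locally constant.
    Its values at 0 and 1 involve the same [E x0], which cancels. *)
Lemma pure_braid_trivial g : is_path X x0 x0 g -> phi (proj \o g) = 1%g.
Proof.
move=> gP; have [E EP] := potential_exists uD uZ ux0 uv T_cone T_meridian.
have [cg gX g0 g1] := gP.
have near_g t e : t \in `[0, 1] -> 0 < e -> exists2 d, 0 < d &
    forall s, s \in `[0, 1] -> `|s - t| < d -> nearby e (g t) (g s).
  move=> tJ e0.
  have [|d d0 dP] := @small_forall R (refl V) (fun i d => forall s, s \in `[0, 1] ->
      `|s - t| < d -> `|re i (g s) - re i (g t)| < e /\ `|im i (g s) - im i (g t)| < e).
    move=> i; move/within01P in cg.
    have cf (f : Cn -> R) : continuous f -> exists2 d, 0 < d & forall s, s \in `[0, 1] ->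
        `|s - t| < d -> `|f (g s) - f (g t)| < e.
      move=> cf; have cfg : continuous (f \o (g \o @clamp R)).
        by move=> y; apply: continuous_comp; [exact: cg|exact: cf].
      have /cvgrPdist_lt/(_ e e0)/nbhs_ballP[d d0 dP] := cfg t.
      exists d => // s sJ st; have := dP s; rewrite /= (clampE tJ) (clampE sJ) distrC.
      by apply; rewrite /ball /= distrC.
    have [d1 d10 d1P] := cf _ (@continuous_re i).
    have [d2 d20 d2P] := cf _ (@continuous_im i).
    exists (Num.min d1 d2); first by rewrite lt_min d10.
    move=> d /andP[d0 dm] s sJ st; split; [apply: d1P|apply: d2P] => //.
      by rewrite (lt_le_trans st) // (le_trans dm) // ge_min lexx.
    by rewrite (lt_le_trans st) // (le_trans dm) // ge_min lexx orbT.
  by exists d => // s sJ st i; apply: (dP i d) => //; rewrite d0 lexx.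
pose f t := (tau (subpath g 0 t) * E (g t))%g.
have J0 : (0 : R) \in `[0, 1] by apply/mem01P; lra.
have J1 : (1 : R) \in `[0, 1] by apply/mem01P; lra.
have ff : f 0 = f 1.
  apply: locally_constant_segment => [|t t01]; first exact: ler01.
  have tJ : t \in `[0, 1] by apply/mem01P.
  have Xt : X (g t) by apply: gX; exists t.
  have ut := (XP (g t)).1 Xt.
  have [e e0 eP] := EP (g t) ut.
  (* The value of each form at [g t] is taken as the normal of a half plane containing it. *)
  have [|e' e'0 e'P] := @open_cone R n _ u xpredT (fun i => re i (g t)) (fun i => im i (g t)) (g t).
    move=> i _; rewrite /in_cone -!expr2 lt0r addr_ge0 ?sqr_ge0 // andbT.
    rewrite paddr_eq0 ?sqr_ge0 // !sqrf_eq0; apply: contra (ut i) => /andP[/eqP h1 /eqP h2].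
    by apply/eqP/form_eq0.
  have m0 : 0 < Num.min e e' by rewrite lt_min e0.
  have [d d0 dP] := near_g t _ tJ m0.
  exists d => // s s01 st; have sJ : s \in `[0, 1] by apply/mem01P.
  have ts : nearby e (g t) (g s).
    by apply: nearbyW (dP s sJ st); rewrite ge_min lexx.
  have between w : w \in `[0, 1] -> forall i, in_cone i (re i (g t)) (im i (g t)) (subpath g t s w).
    move=> /mem01P w01 i; apply: e'P => //.
    apply: (@nearbyW _ _ _ _ (Num.min e e')); first by rewrite ge_min lexx orbT.
    move/mem01P: tJ sJ => tJ /mem01P sJ.
    apply: dP; first by apply/mem01P; nra.
    have -> : t + w * (s - t) - t = w * (s - t) by ring.
    rewrite normrM (le_lt_trans _ st) // ler_piMl // ger0_norm; by case/andP: w01.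
  have tauts : tau (subpath g t s) = T (g t) (g s).
    have bt : forall i, in_cone i (re i (g t)) (im i (g t)) (g t).
      by move=> i; have := between 0 J0 i; rewrite /subpath mul0r addr0.
    have bs : forall i, in_cone i (re i (g t)) (im i (g t)) (g s).
      by move=> i; have := between 1 J1 i; rewrite /subpath mul1r addrC subrK.
    apply: (tau_equiv (a := g t) (b := g s)); apply: homotopy_cone.
    - exact: subpath_is_path gP tJ sJ.
    - by apply: segment_is_path => i; exists (re i (g t)), (im i (g t)); rewrite /= bt bs.
    - move=> w wJ i; exists (re i (g t)), (im i (g t)).
      by rewrite /= between // cone_mix.
  have us : forall i, u i (g s) != 0 by apply/XP; apply: gX; exists s.
  rewrite /f (tau_subpath gP J0 tJ sJ) tauts -mulgA eP //.
have sub0 : tau (subpath g 0 0) = 1%g.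
  rewrite (_ : subpath g 0 0 = cst x0) ?tau_cst //.
  by apply/funext => t; rewrite /subpath subrr mulr0 addr0.
have sub1 : subpath g 0 1 = g.
  by apply/funext => t; rewrite /subpath subr0 mulr1 add0r.
have tg : tau g = 1%g.
  move: ff; rewrite /f sub0 sub1 g0 g1 => /esym; exact: (@mulIg _ (E x0)).
have [c cP] := groupoid_rep_loop phi_homotopic phi_concat path_connected_A.
move: tg; rewrite /tau cP; last exact: proj_path gP.
by move/(congr1 (fun x => x ^ c^-1)%g); rewrite conjgK conj1g.
Qed.

End PureBraids.

(** * Exponentials of noncommutative series *)

Section NCExponential.
Variables (k : fieldType) (L : eqType).
Local Notation A := (nc_series k L).
Implicit Types (a b x : A) (w : seq L).

Lemma nc_mulE a b w :
  (a * b) w = \sum_(i < (size w).+1) a (take i w) * b (drop i w).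
Proof. by []. Qed.

Lemma nc_addE a b w : (a + b) w = a w + b w.
Proof. by []. Qed.

Lemma nc_oppE a w : (- a) w = - a w.
Proof. by []. Qed.

Lemma nc_scaleE (c : k) a w : (c *: a) w = c * a w.
Proof. by []. Qed.

Lemma nc_scalerAr (c : k) a b : a * (c *: b) = c *: (a * b).
Proof.
apply/funext => w; rewrite nc_scaleE !nc_mulE mulr_sumr.
by apply: eq_bigr => i _; rewrite nc_scaleE mulrCA.
Qed.

(* The antiautomorphism with t |-> - t on letters; it is - id on Lie series. *)
Definition nc_flip a : A := fun w => (-1) ^+ size w * a (rev w).

Lemma nc_flipD a b : nc_flip (a + b) = nc_flip a + nc_flip b.
Proof. by apply/funext => w; rewrite nc_addE /nc_flip nc_addE mulrDr. Qed.

Lemma nc_flipN a : nc_flip (- a) = - nc_flip a.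
Proof. by apply/funext => w; rewrite nc_oppE /nc_flip nc_oppE mulrN. Qed.

Lemma nc_flipZ (c : k) a : nc_flip (c *: a) = c *: nc_flip a.
Proof. by apply/funext => w; rewrite nc_scaleE /nc_flip nc_scaleE mulrCA. Qed.

Lemma nc_flipM a b : nc_flip (a * b) = nc_flip b * nc_flip a.
Proof.
apply/funext => w; rewrite nc_mulE /nc_flip nc_mulE size_rev mulr_sumr.
rewrite (reindex_inj rev_ord_inj) /=; apply: eq_bigr => i _.
have le_iw : (i <= size w)%N by rewrite -ltnS.
rewrite subSS take_rev drop_rev (subKn le_iw) size_drop (size_takel le_iw).
by rewrite -{1}(subnKC le_iw) exprD; ring.
Qed.

Lemma nc_flip1 : nc_flip 1 = 1.
Proof.
apply/funext => w; rewrite /nc_flip /GRing.one /= /nc_one size_rev.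
by case: eqP => [->|_]; rewrite ?expr0 ?mulr1 ?mulr0.
Qed.

Lemma nc_flipX a m : nc_flip (a ^+ m) = nc_flip a ^+ m.
Proof. by elim: m => [|m IH]; rewrite ?nc_flip1 // exprS nc_flipM IH -exprSr. Qed.

Lemma nc_flip_lie_polynomial a : lie_polynomial a -> nc_flip a = - a.
Proof.
elim=> [|s|{}a b _ IHa _ IHb|c {}a _ IH|{}a b _ IHa _ IHb].
- by apply/funext => w; rewrite /nc_flip nc_oppE mulr0 oppr0.
- apply/funext => w; rewrite /nc_flip nc_oppE /nc_letter.
  rewrite -(inj_eq (can_inj revK)) revK.
  by case: eqP => [->|_]; rewrite ?expr1 ?mulN1r ?mulr1 // mulr0 oppr0.
- by rewrite nc_flipD IHa IHb opprD.
- by rewrite nc_flipZ IH scalerN.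
- by rewrite nc_flipD nc_flipN !nc_flipM IHa IHb !mulrNN opprB.
Qed.

Lemma nc_flip_lie_series x : lie_series x -> nc_flip x = - x.
Proof.
move=> xL; apply/funext => w.
have := congr1 (@^~ w) (nc_flip_lie_polynomial (xL (size w))).
by rewrite /= /nc_flip !nc_oppE /homogeneous_part size_rev eqxx.
Qed.

Lemma lie_polynomial_nil a : lie_polynomial a -> a [::] = 0.
Proof.
elim=> [|s|{}a b _ IHa _ IHb|c {}a _ IH|{}a b _ IHa _ IHb] //.
- by rewrite nc_addE IHa IHb addr0.
- by rewrite nc_scaleE IH mulr0.
- by rewrite nc_addE nc_oppE !nc_mulE /= !big_ord_recl !big_ord0 /= IHa IHb !mul0r !addr0 subrr.
Qed.

Lemma lie_series_nil x : lie_series x -> x [::] = 0.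
Proof. by move=> /(_ 0%N)/lie_polynomial_nil. Qed.

Lemma nc_powN x q : (- x) ^+ q = (-1) ^+ q *: x ^+ q.
Proof.
elim: q => [|q IH]; first by rewrite scale1r.
by rewrite !exprS IH nc_scalerAr mulN1r scaleNr (mulNr x) scalerN.
Qed.

Lemma nc_pow_small x m w : x [::] = 0 -> (size w < m)%N -> (x ^+ m) w = 0.
Proof.
move=> x0; elim: m w => // m IH w wm; rewrite exprS nc_mulE.
apply: big1 => -[[|i] /= iw] _; first by rewrite take0 x0 mul0r.
rewrite IH ?mulr0 // size_drop; case: (size w) iw wm => // p _ pm.
by rewrite subSS (leq_ltn_trans (leq_subr _ _)).
Qed.

(** Any large enough bound may replace the one depending on the word, so the two factors of a
    product can be expanded with a common bound. *)
Lemma nc_expE x w D : x [::] = 0 -> (size w < D)%N ->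
  nc_exp x w = \sum_(m < D) (m`!%:R)^-1 * (x ^+ m) w.
Proof.
move=> x0 wD; rewrite /nc_exp (big_ord_widen D (fun m => (m`!%:R)^-1 * (x ^+ m) w)) //.
rewrite [RHS](bigID (fun m : 'I_D => (m < (size w).+1)%N)) /= [X in _ + X]big1 ?addr0 //.
by move=> m; rewrite -leqNgt => mw; rewrite nc_pow_small ?mulr0.
Qed.

Lemma nc_exp_nil x : nc_exp x [::] = 1.
Proof. by rewrite /nc_exp big_ord_recl big_ord0 addr0 fact0 invr1 mul1r expr0. Qed.

Lemma nc_flip_exp x : nc_flip (nc_exp x) = nc_exp (nc_flip x).
Proof.
apply/funext => w; rewrite /nc_flip /nc_exp size_rev mulr_sumr.
by apply: eq_bigr => m _; rewrite -nc_flipX /nc_flip mulrCA.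
Qed.

Hypothesis k0 : [pchar k] =i pred0.

(** This is the binomial expansion of [(-1 + 1) ^+ m] divided by the factorial of m, which is
    invertible in characteristic 0. *)
Lemma sum_inv_fact_alt m :
  \sum_(p < m.+1) (p`!%:R)^-1 * (((m - p)`!%:R)^-1 * (-1) ^+ (m - p)) = (m == 0)%:R :> k.
Proof.
have nz p : p`!%:R != 0 :> k by rewrite ((pcharf0P k).1 k0) -lt0n fact_gt0.
transitivity ((m`!%:R)^-1 * (-1 + 1) ^+ m : k); last first.
  by case: m => [|m]; rewrite addNr ?expr0 ?fact0 ?invr1 ?mulr1 // expr0n mulr0.
rewrite exprDn mulr_sumr; apply: eq_bigr => p _.
have pm : (p <= m)%N by rewrite -ltnS.
rewrite expr1n mulr1 -(bin_fact pm) !natrM -mulr_natr.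
have bz : 'C(m, p)%:R != 0 :> k by rewrite ((pcharf0P k).1 k0) -lt0n bin_gt0.
by move: (nz p) (nz (m - p)%N) bz => *; field; apply/and3P.
Qed.

(** Only powers of [x] occur, so the double sum can be regrouped by total exponent; terms with
    exponent beyond the length of the word vanish, and the alternating sum of inverse factorials
    removes every positive exponent. *)
Lemma nc_expN x : x [::] = 0 -> nc_exp x * nc_exp (- x) = 1.
Proof.
move=> x0; apply/funext => w; set D := (size w).+1.
have x0' : (- x) [::] = 0 by rewrite nc_oppE x0 oppr0.
pose c p : k := (p`!%:R)^-1.
pose F p q := c p * (c q * (-1) ^+ q) * (x ^+ (p + q)) w.
have F0 p q : (D <= p + q)%N -> F p q = 0.
  by move=> h; rewrite /F nc_pow_small ?mulr0.
transitivity (\sum_(0 <= p < D) \sum_(0 <= q < D) F p q).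
  rewrite nc_mulE.
  under eq_bigr => i _.
    rewrite (nc_expE (D := D)) //; last first.
      by rewrite size_take_min ltnS geq_minr.
    rewrite (nc_expE (w := drop i w) (D := D)) //; last first.
      by rewrite size_drop ltnS leq_subr.
    rewrite mulr_suml; over.
  rewrite exchange_big big_mkord; apply: eq_bigr => p _ /=.
  under eq_bigr do rewrite mulr_sumr.
  rewrite exchange_big big_mkord; apply: eq_bigr => q _ /=.
  have -> : F p q = c p * c q * (x ^+ p * (- x) ^+ q) w.
    by rewrite nc_powN nc_scalerAr nc_scaleE -exprD /F !mulrA.
  rewrite nc_mulE mulr_sumr; apply: eq_bigr => i _; rewrite /c; ring.
transitivity (\sum_(0 <= p < D) \sum_(0 <= m < D | (p <= m)%N) F p (m - p)%N).
  rewrite big_nat [RHS]big_nat; apply: eq_bigr => p /andP[_ pD].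
  rewrite -[RHS](@big_nat_widenl _ _ _ p 0 D xpredT) //.
  transitivity (\sum_(0 <= q < D - p) F p q + \sum_(D - p <= q < D) F p q).
    by rewrite -big_cat_nat // leq_subr.
  rewrite [X in _ + X]big_nat.
  rewrite [X in _ + X]big1 ?addr0 => [|q /andP[h _]]; last by rewrite F0 -?leq_subLR.
  transitivity (\sum_(0 + p <= m < D) F p (m - p)%N) => //; rewrite big_addn.
  by apply: eq_bigr => q _; rewrite addnK.
rewrite (exchange_big_dep_nat xpredT) //=.
transitivity (\sum_(0 <= m < D) (m == 0)%:R * (x ^+ m) w).
  rewrite big_nat [RHS]big_nat; apply: eq_bigr => m /andP[_ mD].
  rewrite -(@big_nat_widen _ _ _ 0 m.+1 D xpredT) // big_mkord -sum_inv_fact_alt mulr_suml.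
  by apply: eq_bigr => p _; rewrite /F subnKC // -ltnS.
rewrite big_ltn // expr0 mul1r big_nat big1 ?addr0 // => -[|m] // _.
by rewrite mul0r.
Qed.

End NCExponential.

(** * Evaluation of series at the reflections *)

Section SeriesRep.
Variables (R : realType) (gT : finGroupType) (n : nat).
Variable V : mx_representation (Cplx R) [set: gT]%SET n.
Variables (k : fieldType) (N : nat) (rho : mx_representation k [set: gT]%SET N).
Local Notation L := (refl V).
Local Notation A := (nc_series k L).
Local Notation M := 'M[fps k]_N.
Local Notation t_ := (@nc_letter k L).
Implicit Types (a b x : A) (w : seq L).

Lemma fps_sumE (I : Type) (r : seq I) (P : pred I) (F : I -> fps k) d :
  (\sum_(i <- r | P i) F i) d = \sum_(i <- r | P i) F i d.
Proof. by elim/big_rec2: _ => // i y f _ <-. Qed.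

Lemma fps_const_zmod : zmod_morphism (@fps_const k).
Proof.
by move=> a b; apply/funext => -[|d]; rewrite /fps_const /GRing.add/= /GRing.opp/= ?subr0.
Qed.

Lemma fps_const_monoid : monoid_morphism (@fps_const k).
Proof.
split=> // a b; apply/funext => d; rewrite fps_mulE big_ord_recl big1 => [|i _].
  by rewrite /fps_const subn0 addr0; case: eqP; rewrite ?mulr0.
by rewrite /fps_const mul0r.
Qed.

HB.instance Definition _ :=
  GRing.isZmodMorphism.Build k (fps k) (@fps_const k) fps_const_zmod.
HB.instance Definition _ :=
  GRing.isMonoidMorphism.Build k (fps k) (@fps_const k) fps_const_monoid.

Lemma fps_hME (f : fps k) d : (fps_h k * f) d = if d is d'.+1 then f d' else 0.
Proof.
rewrite fps_mulE; case: d => [|d]; first by rewrite big_ord1 /fps_h mul0r.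
rewrite !big_ord_recl big1 => [|i _]; first by rewrite /fps_h /= mul0r mul1r subSS subn0 add0r addr0.
by rewrite /fps_h /= mul0r.
Qed.

Let word_mx w : 'M[k]_N := \big[mulmx/1%:M]_(s <- w) rho (val s).

Let word_mx_cat w1 w2 : word_mx (w1 ++ w2) = word_mx w1 *m word_mx w2.
Proof.
rewrite /word_mx; elim: w1 => [|s w1 IH]; first by rewrite big_nil mul1mx.
by rewrite cat_cons !big_cons IH mulmxA.
Qed.

Let word_mx_nil : word_mx [::] = 1%:M.
Proof. exact: big_nil. Qed.

Let word_mx_seq1 s : word_mx [:: s] = rho (val s).
Proof. by rewrite /word_mx big_cons big_nil mulmx1. Qed.

Lemma sum_tuple_cat (T : finType) (B : nmodType) e f (F : seq T -> B) :
  \sum_(w : (e + f).-tuple T) F w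
    = \sum_(u : e.-tuple T) \sum_(v : f.-tuple T) F (u ++ v).
Proof.
rewrite pair_big; pose g (p : e.-tuple T * f.-tuple T) := cat_tuple p.1 p.2.
rewrite (reindex g) //; apply/onW_bij/inj_card_bij.
  move=> [u v] [u' v'] /(congr1 val) /= /eqP; rewrite eqseq_cat ?size_tuple //.
  by case/andP => /eqP/val_inj -> /eqP/val_inj ->.
by rewrite card_prod !card_tuple expnD.
Qed.

Lemma series_repE a i j d :
  series_rep rho a i j d = \sum_(w : d.-tuple L) a w * word_mx w i j.
Proof. by rewrite mxE. Qed.

Lemma series_rep_zmod : zmod_morphism (@series_rep _ _ _ V k N rho).
Proof.
move=> a b; apply/matrixP => i j; apply/funext => d.
rewrite !mxE /GRing.add/= /GRing.opp/= -sumrB; apply: eq_bigr => w _.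
exact: mulrBl.
Qed.

HB.instance Definition _ :=
  GRing.isZmodMorphism.Build A M (@series_rep _ _ _ V k N rho) series_rep_zmod.

Lemma series_repM a b : series_rep rho (a * b) = series_rep rho a *m series_rep rho b.
Proof.
apply/matrixP => i j; apply/funext => d; rewrite series_repE mxE fps_sumE.
transitivity (\sum_(w : d.-tuple L) \sum_(e < d.+1)
   a (take e w) * b (drop e w) * word_mx w i j).
  by apply: eq_bigr => w _; rewrite nc_mulE size_tuple mulr_suml.
under [RHS]eq_bigr do rewrite fps_mulE.
rewrite exchange_big [RHS]exchange_big; apply: eq_bigr => e _ /=.
have : (e <= d)%N by rewrite -ltnS.
move: (nat_of_ord e) => {}e /subnKC; move: (d - e)%N => f <-.
rewrite (sum_tuple_cat _ _ (fun w => a (take e w) * b (drop e w) * word_mx w i j)).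
under [RHS]eq_bigr => l _ do rewrite !series_repE mulr_suml.
rewrite [RHS]exchange_big; apply: eq_bigr => u _ /=.
under [RHS]eq_bigr => l _ do rewrite mulr_sumr.
rewrite [RHS]exchange_big; apply: eq_bigr => v _ /=.
rewrite take_size_cat ?drop_size_cat ?size_tuple // word_mx_cat mxE mulr_sumr.
by apply: eq_bigr => l _; rewrite mulrACA.
Qed.

Lemma series_rep1 : series_rep rho (1 : A) = 1%:M.
Proof.
apply/matrixP => i j; apply/funext => -[|d]; rewrite series_repE.
  rewrite (big_pred1 [tuple]) => [|w]; last exact/esym/eqP/val_inj/size0nil/size_tuple.
  by rewrite mul1r word_mx_nil !mxE; case: (i == j).
rewrite big1 => [|w _]; first by rewrite mxE; case: (i == j).
by rewrite /GRing.one /= /nc_one size_tuple mul0r.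
Qed.

Lemma series_rep_letter s :
  series_rep rho (t_ s) = fps_h k *: map_mx (@fps_const k) (rho (val s)).
Proof.
apply/matrixP => i j; apply/funext => d; rewrite series_repE !mxE fps_hME.
case: d => [|[|d]].
- by apply: big1 => w _; rewrite tuple0 mul0r.
- rewrite (bigD1 [tuple s]) //= big1 => [|w ws].
    by rewrite addr0 /nc_letter eqxx mul1r word_mx_seq1.
  rewrite /nc_letter; have /negPf -> : tval w != [:: s]; last by rewrite mul0r.
  by apply: contra ws => /eqP h; apply/eqP/val_inj.
- apply: big1 => w _; rewrite /nc_letter.
  by case: eqP => [/(congr1 size)|_]; rewrite ?size_tuple // mul0r.
Qed.

Lemma series_rep_letterM s u : series_rep rho (t_ s) *m series_rep rho (t_ u)
  = (fps_h k * fps_h k) *: map_mx (@fps_const k) (rho (val s * val u)%g).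
Proof.
rewrite !series_rep_letter -scalemxAl -scalemxAr scalerA.
by rewrite repr_mxM ?inE // map_mxM.
Qed.

Lemma hyperplane_subP m (Z : 'M[Cplx R]_(m, n)) s :
  reflect (Z *m (V s)^T = Z) (Z <= hyperplane V s)%MS.
Proof. by rewrite /hyperplane -[X in _ = X]scale1r; exact: eigenspaceP. Qed.

(** Since s fixes Z pointwise, conjugation by s permutes the reflections u whose hyperplane contains
    Z. The identity s (s^-1 u s) = u s then turns one product into the other after reindexing the
    sum. *)
Lemma holonomy_relation_rep a : holonomy_relation a -> series_rep rho a = 0.
Proof.
case=> F [s] [_ Zs ->]; set Z := (\bigcap_(_ in F) _)%MS in Zs *.
rewrite raddfB /= !series_repM !raddf_sum mulmx_suml /=.
have cs : Z *m (V (val s))^T = Z by apply/hyperplane_subP.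
have conjP u : (Z <= hyperplane V (val (refl_conj (val s) u)))%MS
             = (Z <= hyperplane V (val u))%MS.
  have csV : Z *m (V (val s)^-1%g)^T = Z.
    rewrite -[in LHS]cs -mulmxA -trmx_mul -repr_mxM ?inE // mulVg repr_mx1.
    by rewrite trmx1 mulmx1.
  have uE : Z *m (V (val (refl_conj (val s) u)))^T
          = Z *m (V (val u))^T *m (V (val s)^-1%g)^T.
    by rewrite /= conjgE !repr_mxM ?inE // !trmx_mul !mulmxA cs.
  apply/hyperplane_subP/hyperplane_subP => [h|h]; last by rewrite uE h.
  have : Z *m (V (val u))^T *m (V (val s)^-1%g)^T *m (V (val s))^T = Z.
    by rewrite -uE h.
  rewrite -mulmxA -trmx_mul -repr_mxM ?inE // mulgV repr_mx1 trmx1 mulmx1.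
  exact.
apply/eqP; rewrite subr_eq0; apply/eqP.
rewrite (reindex_inj (h := refl_conj (val s))) /=; last first.
  by move=> u v /(congr1 val) /= /conjg_inj /val_inj.
apply: eq_big => [u|u _]; first exact: conjP.
by rewrite !series_rep_letterM /= conjgE !mulgA mulgV mul1g.
Qed.

Lemma ideal_span_rep a : ideal_span (@holonomy_relation R gT n V k) a -> series_rep rho a = 0.
Proof.
elim=> [|{}a|{}a b _ IHa _ IHb|{}a b c _ IH].
- exact: raddf0.
- exact: holonomy_relation_rep.
- by rewrite raddfD /= IHa IHb addr0.
- by rewrite !series_repM IH mulmx0 mul0mx.
Qed.

(** The coefficient of h^d sees only the part of degree d, so a membership in the ideal that holds
    degree by degree is enough. *)
Lemma holonomy_cong_rep a b : holonomy_cong a b -> series_rep rho a = series_rep rho b.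
Proof.
move=> ab; apply/eqP; rewrite -subr_eq0 -raddfB /=; apply/eqP/matrixP => i j.
apply/funext => d; have /matrixP/(_ i j)/(congr1 (@^~ d)) /= := ideal_span_rep (ab d).
rewrite !mxE => E; rewrite -[RHS]E; apply: eq_bigr => w _.
by rewrite /homogeneous_part size_tuple eqxx.
Qed.

Lemma series_rep_coef0 a :
  map_mx (fun f : fps k => f 0%N) (series_rep rho a) = (a [::])%:M.
Proof.
apply/matrixP => i j; rewrite mxE series_repE.
rewrite (big_pred1 [tuple]) => [|w]; last exact/esym/eqP/val_inj/size0nil/size_tuple.
by rewrite word_mx_nil !mxE mulr_natr.
Qed.

Hypothesis rho_orth : orthogonal_rep rho.
Hypothesis order2 : forall s, s \in reflections V -> (s * s = 1)%g.

(** An orthogonal involution is its own inverse, hence its own transpose. *)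
Lemma rho_refl_sym s : s \in reflections V -> (rho s)^T = rho s.
Proof.
move=> /order2 ss; rewrite -[LHS]mulmx1 -(repr_mx1 rho) -ss repr_mxM ?inE //.
by rewrite mulmxA rho_orth mul1mx.
Qed.

Let word_mx_rev w : (word_mx w)^T = word_mx (rev w).
Proof.
elim: w => [|s w IH]; first by rewrite word_mx_nil trmx1.
rewrite rev_cons -cats1 -cat1s !word_mx_cat !word_mx_seq1 trmx_mul IH.
by rewrite rho_refl_sym // (valP s).
Qed.

(** The length of a word is the exponent of h, so the sign of [nc_flip] is [sigma]; reversing a word
    of symmetric matrices transposes their product. *)
Lemma series_rep_flip a :
  (map_mx (@fps_sigma k) (series_rep rho a))^T = series_rep rho (nc_flip a).
Proof.
apply/matrixP => i j; apply/funext => d; rewrite !mxE /fps_sigma mulr_sumr.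
rewrite (reindex_inj (h := fun w : d.-tuple L => [tuple of rev w])) /=; last first.
  by move=> u v /(congr1 val) /= /(can_inj revK) /val_inj.
apply: eq_bigr => w _; rewrite -/(word_mx _) -word_mx_rev mxE /nc_flip.
by rewrite size_tuple mulrA.
Qed.

Hypothesis k0 : [pchar k] =i pred0.

Lemma series_rep_exp_unitary x : lie_series x ->
  series_rep rho (nc_exp x)
    *m (map_mx (@fps_sigma k) (series_rep rho (nc_exp x)))^T = 1%:M.
Proof.
move=> xL; rewrite series_rep_flip nc_flip_exp nc_flip_lie_series //.
by rewrite -series_repM nc_expN ?series_rep1 // lie_series_nil.
Qed.

End SeriesRep.

(** * Algebras of functions stable under polynomial operations *)

Section FunctionAlgebras.
Import -(notations) mpoly.
Variables (F : fieldType) (S : subringClosed F).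

(** Stated for predicates, so that one induction on polynomials serves regular functions after
    restriction of scalars, polynomial functions, functions regular on U, and sequences polynomial
    in their index. *)
Definition fun_subalgebra (X : Type) (P : set (X -> F)) : Prop :=
  [/\ forall a, a \in S -> P (fun=> a),
      forall f g, P f -> P g -> P (fun x => f x + g x)
    & forall f g, P f -> P g -> P (fun x => f x * g x)].

Variables (X : Type) (P : set (X -> F)).
Hypothesis Palg : fun_subalgebra P.

Lemma fun_subalgebra_const a : a \in S -> P (fun=> a).
Proof. by case: Palg => h _ _; exact: h. Qed.

Lemma fun_subalgebraD f g : P f -> P g -> P (fun x => f x + g x).
Proof. by case: Palg => _ h _; exact: h. Qed.

Lemma fun_subalgebraM f g : P f -> P g -> P (fun x => f x * g x).
Proof. by case: Palg => _ _ h; exact: h. Qed.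

Lemma fun_subalgebra_sum (I : Type) (r : seq I) (Q : pred I) (f : I -> X -> F) :
  (forall i, P (f i)) -> P (fun x => \sum_(i <- r | Q i) f i x).
Proof.
move=> Pf; elim: r => [|i r IH].
  by under eq_fun do rewrite big_nil; apply: fun_subalgebra_const; exact: rpred0.
under eq_fun do rewrite big_cons; case: (Q i) => //; exact: fun_subalgebraD.
Qed.

Lemma fun_subalgebra_prod (I : Type) (r : seq I) (Q : pred I) (f : I -> X -> F) :
  (forall i, P (f i)) -> P (fun x => \prod_(i <- r | Q i) f i x).
Proof.
move=> Pf; elim: r => [|i r IH].
  by under eq_fun do rewrite big_nil; apply: fun_subalgebra_const; exact: rpred1.
under eq_fun do rewrite big_cons; case: (Q i) => //; exact: fun_subalgebraM.
Qed.

Lemma fun_subalgebraX f d : P f -> P (fun x => f x ^+ d).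
Proof.
move=> Pf; elim: d => [|d IH].
  by under eq_fun do rewrite expr0; apply: fun_subalgebra_const; exact: rpred1.
by under eq_fun do rewrite exprS; exact: fun_subalgebraM.
Qed.

Lemma fun_subalgebra_meval m (v : X -> 'I_m -> F) (p : mpoly m F) :
  (forall i, P (v^~ i)) -> p \is a mpolyOver m S -> P (fun x => meval (v x) p).
Proof.
move=> Pv /mpolyOverP pS; under eq_fun do rewrite mevalE.
apply: fun_subalgebra_sum => e; apply: fun_subalgebraM; first exact: fun_subalgebra_const.
by apply: fun_subalgebra_prod => i; exact: fun_subalgebraX.
Qed.

Lemma fun_subalgebra_det d (M : X -> 'M[F]_d) :
  (forall i j, P (fun x => M x i j)) -> P (fun x => \det (M x)).
Proof.
move=> PM; apply: fun_subalgebra_sum => s; apply: fun_subalgebraM.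
  by apply: fun_subalgebra_const; rewrite rpredX // rpredN rpred1.
by apply: fun_subalgebra_prod => i.
Qed.

Lemma fun_subalgebra_adj d (M : X -> 'M[F]_d) i j :
  (forall i j, P (fun x => M x i j)) -> P (fun x => (\adj (M x)) i j).
Proof.
move=> PM; under eq_fun do rewrite mxE /cofactor.
apply: fun_subalgebraM; first by apply: fun_subalgebra_const; rewrite rpredX // rpredN rpred1.
by apply: fun_subalgebra_det => a b; under eq_fun do rewrite !mxE.
Qed.

End FunctionAlgebras.

(** * Closure and connectedness in the Zariski topology *)

Section ZariskiTopology.
Import -(notations) mpoly.
Variables (F : fieldType) (S : subringClosed F) (m : nat) (T : choiceType).
Variable c : T -> 'rV[F]_m.
Local Notation Z := (zariski_space S c).

Lemma zariski_closedP (A : set Z) : closed A <-> zariski_closed A.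
Proof. by rewrite -openC /open /= /zariski_open setCK. Qed.

Lemma closure_zariskiP (A : set Z) x : closure A x <->
  forall p, p \is a mpolyOver m S ->
    (forall y, A y -> meval (c y 0) p = 0) -> meval (c x 0) p = 0.
Proof.
split=> [Ax p pS pA|xP].
  have : closed (zero_locus (T := T) (c := c) (S := S) [set p]).
    by apply/zariski_closedP; exists [set p] => // q ->.
  move=> /closure_id cl; have : closure (zero_locus [set p] : set Z) x.
    by apply: closureS Ax => y Ay q ->; exact: pA.
  by rewrite -cl => /(_ p erefl).
have /zariski_closedP[E ES AE] := @closed_closure Z A.
rewrite AE => p Ep; apply: xP => [|y Ay]; first exact: ES.
have : closure A y by exact: subset_closure.
by rewrite AE => /(_ p Ep).
Qed.

(** The hypothesis makes every infinite set of indices dense in the range. Of a relatively open and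
    closed part and its complement, one contains terms of arbitrarily large index and is therefore
    everything. *)
Lemma connected_zariski_sequence (z : nat -> Z) :
  (forall p, p \is a mpolyOver m S ->
    (forall n, exists2 n', (n <= n')%N & meval (c (z n') 0) p = 0) ->
    forall n, meval (c (z n) 0) p = 0) ->
  connected (range z).
Proof.
move=> zP B [b Bb] [C Co BC] [D /zariski_closedP[E ES DE] BD].
have /zariski_closedP[E' E'S CE'] : closed (~` C) by rewrite closedC.
rewrite BD; apply/setIidPl => _ [n _ <-].
have [inf|] := pselect (forall n, exists2 n', (n <= n')%N & B (z n')).
  rewrite DE => p Ep; apply: zP => [|l]; first exact: ES.
  have [n' ln'] := inf l; rewrite BD DE => -[_ zn']; exists n' => //; exact: zn'.
move=> /existsNP[l /forall2NP lP].
have : B b := Bb; rewrite BC => -[[j _ <-]] Czj; exfalso.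
suff : (~` C) (z j) by [].
rewrite CE' => p Ep; apply: zP => [|i]; first exact: E'S.
exists (maxn i l); first exact: leq_maxl.
have [/negP|nB] := lP (maxn i l); first by rewrite leq_maxr.
have : (~` C) (z (maxn i l)) by move=> Cz; apply: nB; rewrite BC; split => //; exists (maxn i l).
by rewrite CE'; exact.
Qed.

End ZariskiTopology.

(** * Restriction of scalars along the quadratic extension *)

Section QuadraticExtension.
Variable F : fieldType.
Implicit Types x y h : F.

Lemma half_sum_difference x y h : 2 != 0 :> F -> h != 0 ->
  x = 2^-1 * (x + y) + h * ((2 * h)^-1 * (x - y)).
Proof. by move=> t0 h0; field; rewrite h0. Qed.

Lemma half_difference_sum x y h : 2 != 0 :> F -> h != 0 ->
  y = 2^-1 * (x + y) - h * ((2 * h)^-1 * (x - y)).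
Proof. by move=> t0 h0; field; rewrite h0. Qed.

Lemma quadratic_mul a b c d h :
  (a + h * b) * (c + h * d) = a * c + h * h * (b * d) + h * (a * d + b * c) :> F.
Proof. by ring. Qed.

End QuadraticExtension.

(** * Closures of sets of unitary matrices over K and over K^sigma *)

Section UnitaryClosure.
Import -(notations) mpoly.
Variables (k : fieldType) (N : nat).
Hypothesis k0 : [pchar k] =i pred0.
Local Notation K := (laurent k).
Local Notation M := 'M[K]_N.
Local Notation U := (@unitary_sigma k N).
Local Notation h := (tolaurent (fps_h k)).

Let natk_neq0 n : n.+1%:R != 0 :> k.
Proof. by rewrite ((pcharf0P k).1 k0). Qed.

Lemma laurent_two_neq0 : 2 != 0 :> K.
Proof.
rewrite -(rmorph_nat (@tolaurent k)) tolaurent_eq0; apply/eqP => /(congr1 (@^~ 0%N)).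
by rewrite -(rmorph_nat (@fps_const k)) /fps_const /=; apply/eqP; exact: natk_neq0.
Qed.

Lemma laurent_h_neq0 : h != 0.
Proof.
rewrite tolaurent_eq0; apply/eqP => /(congr1 (@^~ 1%N)) /eqP.
by rewrite /fps_h /= oner_eq0.
Qed.

Lemma sigma_h : sigma h = - h.
Proof.
rewrite sigma_tolaurent -rmorphN; congr tolaurent; apply/funext => d.
rewrite /fps_sigma {2}/GRing.opp/= /fps_h; case: (d =P 1%N) => [->|_]; last by rewrite mulr0 oppr0.
by rewrite expr1 mulN1r.
Qed.

Lemma sigmaK : involutive (@sigma k).
Proof.
move=> x; rewrite [in LHS](laurent_numden x) [RHS]laurent_numden.
move: (denom_ratioP (repr x)); move: (frac (repr x)) => [a b] /= b0.
by rewrite !sigmaE ?fps_sigma_eq0 // !fps_sigmaK.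
Qed.

Lemma real_part_Ksigma x : 2^-1 * (x + sigma x) \in @Ksigma k.
Proof.
by rewrite inE rmorphM rmorphD fmorphV rmorph_nat /= sigmaK [sigma x + x]addrC.
Qed.

Lemma imag_part_Ksigma x : (2 * h)^-1 * (x - sigma x) \in @Ksigma k.
Proof.
rewrite inE rmorphM rmorphB fmorphV rmorphM rmorph_nat /= sigmaK sigma_h.
by rewrite mulrN invrN mulNr -mulrN opprB.
Qed.

Lemma real_imag_decomposition x :
  x = 2^-1 * (x + sigma x) + h * ((2 * h)^-1 * (x - sigma x)).
Proof. exact: half_sum_difference laurent_two_neq0 laurent_h_neq0. Qed.

(** Applying [sigma], which negates h, yields the conjugate equation; the half sum and half
    difference separate the two parts. *)
Lemma Ksigma_independent a b : a \in @Ksigma k -> b \in @Ksigma k ->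
  a + h * b = 0 -> a = 0 /\ b = 0.
Proof.
rewrite !inE => /eqP sa /eqP sb e.
have e' : a - h * b = 0.
  by rewrite -mulNr -sigma_h -{1}sa -{1}sb -rmorphM -rmorphD e rmorph0.
have a0 : a = 0.
  apply: (mulfI laurent_two_neq0); rewrite mulr0.
  by rewrite -[RHS](addr0 0) -{1}e -e'; ring.
split=> //; move: e; rewrite a0 add0r => /eqP.
by rewrite mulf_eq0 (negPf laurent_h_neq0) => /eqP.
Qed.

Lemma coord_Ksigma_fun (X : Type) (P : set (X -> K)) (A : X -> M) l :
  fun_subalgebra (@Kfull k) P ->
  (forall i j, P (fun x => A x i j)) -> (forall i j, P (fun x => sigma (A x i j))) ->
  P (fun x => coord_Ksigma (A x) 0 l).
Proof.
move=> Palg PA PsA; have Pc a : P (fun=> a) by exact: (fun_subalgebra_const Palg (a := a) isT).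
rewrite /coord_Ksigma; case: (split_ordP l) => l' ->.
  under eq_fun do rewrite row_mxEl; case/mxvec_indexP: l' => i j.
  under eq_fun do rewrite mxvecE !mxE.
  by apply: (fun_subalgebraM Palg) => //; exact: (fun_subalgebraD Palg).
under eq_fun do rewrite row_mxEr; case/mxvec_indexP: l' => i j.
under eq_fun do rewrite mxvecE !mxE.
apply: (fun_subalgebraM Palg) => //; apply: (fun_subalgebraD Palg) => //.
under eq_fun do rewrite -mulN1r.
exact: (fun_subalgebraM Palg).
Qed.

(* The functions which are polynomial over K^sigma after restriction of
   scalars, in the basis (1, h). *)
Definition weil_regular : set (M -> K) := [set f | exists p q,
  [/\ p \is a mpolyOver (N * N + N * N) (@Ksigma k),
      q \is a mpolyOver (N * N + N * N) (@Ksigma k)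
    & forall A, f A = meval (coord_Ksigma A 0) p + h * meval (coord_Ksigma A 0) q]].

Lemma weil_regular_subalgebra : fun_subalgebra (@Kfull k) weil_regular.
Proof.
have hh : h * h \in @Ksigma k by rewrite inE rmorphM /= sigma_h mulrNN.
split=> [a _|f g [p [q [pS qS fE]]] [p' [q' [p'S q'S gE]]]|f g [p [q [pS qS fE]]] [p' [q' [p'S q'S gE]]]].
- exists (mpolyC (N * N + N * N) (2^-1 * (a + sigma a))).
  exists (mpolyC (N * N + N * N) ((2 * h)^-1 * (a - sigma a))).
  split; rewrite ?mpolyOverC ?real_part_Ksigma ?imag_part_Ksigma // => A.
  by rewrite !mevalC -real_imag_decomposition.
- exists (p + p'), (q + q'); split; rewrite ?rpredD // => A.
  by rewrite fE gE !mevalD mulrDr addrACA.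
- exists (p * p' + mpolyC (N * N + N * N) (h * h) * (q * q')), (p * q' + q * p').
  split=> [||A]; first by rewrite rpredD ?rpredM // mpolyOverC.
    by rewrite rpredD ?rpredM.
  by rewrite fE gE !mevalD !mevalM mevalC quadratic_mul.
Qed.

Lemma weil_regular_entry i j :
  weil_regular (fun A => A i j) /\ weil_regular (fun A => sigma (A i j)).
Proof.
pose l := lshift (N * N) (mxvec_index i j); pose r := rshift (N * N) (mxvec_index i j).
have El (A : M) : coord_Ksigma A 0 l = 2^-1 * (A i j + sigma (A i j)).
  by rewrite /coord_Ksigma row_mxEl mxvecE !mxE.
have Er (A : M) : coord_Ksigma A 0 r = (2 * h)^-1 * (A i j - sigma (A i j)).
  by rewrite /coord_Ksigma row_mxEr mxvecE !mxE.
have XS e : mpolyX K (mnm1 e) \is a mpolyOver (N * N + N * N) (@Ksigma k).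
  exact: mpolyOverX.
split; [exists (mpolyX K (mnm1 l)), (mpolyX K (mnm1 r))|exists (mpolyX K (mnm1 l)), (- mpolyX K (mnm1 r))];
  split; rewrite ?rpredN // => A.
  by rewrite !mevalXU El Er -real_imag_decomposition.
rewrite mevalN !mevalXU El Er.
rewrite mulrN; exact: half_difference_sum laurent_two_neq0 laurent_h_neq0.
Qed.

Lemma coord_Ksigma_Ksigma (A : M) l : coord_Ksigma A 0 l \in @Ksigma k.
Proof.
rewrite /coord_Ksigma; case: (split_ordP l) => l' ->.
  by rewrite row_mxEl; case/mxvec_indexP: l' => i j; rewrite mxvecE !mxE real_part_Ksigma.
by rewrite row_mxEr; case/mxvec_indexP: l' => i j; rewrite mxvecE !mxE imag_part_Ksigma.
Qed.

(** The coordinates of points lie in K^sigma, so the two components of [f] in the basis (1, h)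
    vanish separately on [G], and each is a polynomial over K^sigma. *)
Lemma weil_regular_closure (G : set M) f A : weil_regular f ->
  (forall B, G B -> f B = 0) -> closure (G : set (zariski_Ksigma k N)) A -> f A = 0.
Proof.
move=> [p [q [pS qS fE]]] fG /closure_zariskiP GA.
have mK B r : r \is a mpolyOver (N * N + N * N) (@Ksigma k) ->
    meval (coord_Ksigma B 0) r \in @Ksigma k.
  move=> rS; apply: rpred_mhorner => //.
  by apply/forallP => i; exact: coord_Ksigma_Ksigma.
have pq B : G B -> meval (coord_Ksigma B 0) p = 0 /\ meval (coord_Ksigma B 0) q = 0.
  by move=> GB; apply: Ksigma_independent; rewrite ?mK // -fE fG.
by rewrite fE (GA p pS (fun B GB => (pq B GB).1)) (GA q qS (fun B GB => (pq B GB).2)) mulr0 addr0.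
Qed.

Lemma closure_Ksigma_sub_K (G : set M) :
  closure (G : set (zariski_Ksigma k N)) `<=` closure (G : set (zariski_K k N)).
Proof.
move=> A GA; apply/closure_zariskiP => p pK pG.
apply: (weil_regular_closure (f := fun B => meval (coord_K B 0) p)) GA => //.
apply: (fun_subalgebra_meval weil_regular_subalgebra) pK => l.
rewrite /coord_K; case/mxvec_indexP: l => i j; under eq_fun do rewrite mxvecE.
by have [] := weil_regular_entry i j.
Qed.

Lemma unitary_sigmaP (A : M) : U A <-> A *m (map_mx (@sigma k) A)^T = 1%:M.
Proof.
split=> [[_ e]|e]; first exact: e.
by split; [exact: (mulmx1_unit e).1|exact: e].
Qed.

Lemma closure_unitary (G : set M) : G `<=` U ->
  closure (G : set (zariski_Ksigma k N)) `<=` U.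
Proof.
move=> GU A GA; apply/unitary_sigmaP/matrixP => i j.
pose f (B : M) := (B *m (map_mx (@sigma k) B)^T) i j + - (1%:M : M) i j.
apply/eqP; rewrite -subr_eq0; apply/eqP.
apply: (weil_regular_closure (f := f)) GA => [|B /GU/unitary_sigmaP]; last first.
  by rewrite /f => ->; rewrite subrr.
have alg := weil_regular_subalgebra; rewrite /f.
under eq_fun do rewrite mxE.
apply: (fun_subalgebraD alg); last exact: fun_subalgebra_const alg _ _.
apply: (fun_subalgebra_sum alg) => l; under eq_fun do rewrite !mxE.
by apply: (fun_subalgebraM alg); [have [] := weil_regular_entry i l|have [] := weil_regular_entry j l].
Qed.

Definition polynomial_fun : set (M -> K) := [set f | exists2 p,
  p \is a mpolyOver (N * N) (@Kfull k) & forall A, f A = meval (coord_K A 0) p].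

Lemma polynomial_fun_subalgebra : fun_subalgebra (@Kfull k) polynomial_fun.
Proof.
split=> [a aK|f g [p pS fE] [q qS gE]|f g [p pS fE] [q qS gE]].
- by exists (mpolyC (N * N) a) => [|A]; rewrite ?mpolyOverC ?mevalC.
- by exists (p + q) => [|A]; rewrite ?rpredD // mevalD fE gE.
- by exists (p * q) => [|A]; rewrite ?rpredM // mevalM fE gE.
Qed.

Lemma polynomial_fun_entry i j : polynomial_fun (fun A => A i j).
Proof.
exists (mpolyX K (mnm1 (mxvec_index i j))) => [|A]; first exact: mpolyOverX.
by rewrite mevalXU /coord_K mxvecE.
Qed.

(* On U the inverse of A is the transpose of sigma A, so that functions which
   are polynomial over K^sigma become polynomial over K, up to powers of det. *)
Definition unitary_regular : set (M -> K) := [set f | exists e : nat,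
  exists2 g : M -> K, polynomial_fun g & forall A, U A -> f A * \det A ^+ e = g A].

Lemma unitary_regular_subalgebra : fun_subalgebra (@Kfull k) unitary_regular.
Proof.
have alg := polynomial_fun_subalgebra.
have det e : polynomial_fun (fun A => \det A ^+ e).
  by apply: (fun_subalgebraX alg); apply: (fun_subalgebra_det alg) => i j; exact: polynomial_fun_entry.
split=> [a aK|f g [e [f' Pf fE]] [d [g' Pg gE]]|f g [e [f' Pf fE]] [d [g' Pg gE]]].
- exists 0%N; exists (fun=> a); first exact: fun_subalgebra_const alg _ aK.
  by move=> A _; rewrite mulr1.
- exists (e + d)%N; exists (fun A => f' A * \det A ^+ d + g' A * \det A ^+ e).
    by apply: (fun_subalgebraD alg); apply: (fun_subalgebraM alg).
  by move=> A UA; rewrite -fE // -gE // exprD; ring.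
- exists (e + d)%N; exists (fun A => f' A * g' A); first exact: (fun_subalgebraM alg).
  by move=> A UA; rewrite -fE // -gE // exprD; ring.
Qed.

Lemma unitary_regular_entry i j :
  unitary_regular (fun A => A i j) /\ unitary_regular (fun A => sigma (A i j)).
Proof.
split.
  exists 0%N; exists (fun A => A i j); first exact: polynomial_fun_entry.
  by move=> A _; rewrite mulr1.
(* On U the adjugate is the determinant times the transpose of [sigma] of the matrix, whence the
   exponent 1. *)
exists 1%N; exists (fun A => (\adj A) j i).
  by apply: (fun_subalgebra_adj polynomial_fun_subalgebra); exact: polynomial_fun_entry.
move=> A /unitary_sigmaP /(congr1 (mulmx (\adj A))); rewrite mulmx1 mulmxA mul_adj_mx.
by rewrite mul_scalar_mx => <-; rewrite !mxE expr1 mulrC.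
Qed.

(** For the harder inclusion, a K^sigma-polynomial vanishing on [G] agrees on U, up to a power of
    the determinant, with a K-polynomial that also vanishes on [G]. The determinant is then
    cancelled at an invertible point. *)
Lemma zclosure_Ksigma_unitary (G : set M) : G `<=` U ->
  zclosure_Ksigma G = zclosure_K G `&` U.
Proof.
move=> GU; apply/seteqP; split=> A [].
  by move=> AG GA; split; [split=> //; exact: closure_Ksigma_sub_K|exact: (closure_unitary GU)].
move=> [AG /closure_zariskiP GA] UA; split=> //; apply/closure_zariskiP => p pS pG.
have [e [g [q qK gE] qE]] : unitary_regular (fun A => meval (coord_Ksigma A 0) p).
  apply: (fun_subalgebra_meval unitary_regular_subalgebra) => [l|]; last first.
    by apply: mpolyOverS pS.
  by apply: (coord_Ksigma_fun (A := id)) unitary_regular_subalgebra _ _ => i j;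
    have [] := unitary_regular_entry i j.
have dA : \det A ^+ e != 0.
  by rewrite expf_neq0 // -unitfE; move: AG; rewrite /GL /= unitmxE.
apply: (mulIf dA); rewrite mul0r (qE _ UA) gE; apply: GA => // B GB.
by rewrite -gE -(qE _ (GU _ GB)) (pG _ GB) mul0r.
Qed.

End UnitaryClosure.

(** * Powers of matrices congruent to 1 modulo h *)

Section UnipotentSequences.
Import -(notations) mpoly.
Variable k : fieldType.
Hypothesis k0 : [pchar k] =i pred0.
Local Notation K := (laurent k).

Let natk_eq0 n : (n%:R == 0 :> k) = (n == 0%N).
Proof. exact: ((pcharf0P k).1 k0). Qed.

Lemma natr_inj_char0 : injective (fun n : nat => n%:R : k).
Proof.
move=> a b /= ab; wlog le_ab : a b ab / (a <= b)%N.
  by move=> H; case: (leqP a b) => [|/ltnW] /H; [exact|move=> ->].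
apply/eqP; rewrite eqn_leq le_ab -subn_eq0 -natk_eq0.
by rewrite natrB // ab subrr eqxx.
Qed.

Lemma poly_eq0_nat (q : {poly k}) :
  (forall n, exists2 n', (n <= n')%N & q.[n'%:R] = 0) -> q = 0.
Proof.
move=> qinf; have [s [us ss qs]] : exists s : seq nat,
    [/\ uniq s, size s = size q & all (fun n => q.[n%:R] == 0) s].
  elim: (size q) => [|l [s [us sl qs]]]; first by exists [::].
  have [n' ln' qn'] := qinf (\max_(i <- s) i).+1.
  exists (n' :: s); split=> /=; rewrite ?sl ?qn' ?eqxx // us andbT.
  by apply: contraTN ln' => n's; rewrite -leqNgt; exact: leq_bigmax_seq.
apply: (roots_geq_poly_eq0 (rs := [seq (n%:R : k) | n <- s])).
- by rewrite all_map; apply: sub_all qs => n; rewrite /root.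
- by rewrite map_inj_uniq //; exact: natr_inj_char0.
- by rewrite size_map ss.
Qed.

Definition binomial_poly e : {poly k} := (e`!%:R)^-1 *: \prod_(l < e) ('X - (l%:R)%:P).

Lemma binomial_polyE e n : (binomial_poly e).[n%:R] = 'C(n, e)%:R.
Proof.
have e0 : e`!%:R != 0 :> k by rewrite natk_eq0 -lt0n fact_gt0.
apply: (mulfI e0); rewrite /binomial_poly hornerZ mulVKf // -natrM mulnC bin_ffact.
elim: e {e0} => [|e IH]; first by rewrite big_ord0 hornerC.
rewrite big_ord_recr hornerM IH ffactnSr natrM /= hornerXsubC.
have [en|ne] := leqP e n; first by rewrite natrB.
by rewrite ffact_small ?mul0r.
Qed.

(* Sequences in K with a common denominator, each coefficient of whose
   numerators depends polynomially on the index. *)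
Definition polynomial_sequence : set (nat -> K) := [set f | exists (F : nat -> fps k) (d : fps k),
  [/\ d != 0, forall n, f n = tolaurent (F n) / tolaurent d
    & forall e, exists q : {poly k}, forall n, F n e = q.[n%:R]]].

Lemma polynomial_sequence_subalgebra : fun_subalgebra (@Kfull k) polynomial_sequence.
Proof.
have nz (d : fps k) : d != 0 -> tolaurent d != 0 by rewrite tolaurent_eq0.
split=> [a _|f g [F [d [d0 fE FP]]] [G [c [c0 gE GP]]]|f g [F [d [d0 fE FP]]] [G [c [c0 gE GP]]]].
- exists (fun=> (frac (repr a)).1), (frac (repr a)).2; split.
  + exact: denom_ratioP.
  + by move=> _; exact: laurent_numden.
  + by move=> e; exists ((frac (repr a)).1 e)%:P => n; rewrite hornerC.
- have mulP (H H' : nat -> fps k) : (forall e, exists q : {poly k}, forall n, H n e = q.[n%:R]) ->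
      (forall e, exists q : {poly k}, forall n, H' n e = q.[n%:R]) ->
      forall e, exists q : {poly k}, forall n, (H n * H' n) e = q.[n%:R].
    move=> /choice[q qE] /choice[q' q'E] e.
    exists (\sum_(i < e.+1) q i * q' (e - i)%N) => n.
    rewrite fps_mulE horner_sum; apply: eq_bigr => i _.
    by rewrite hornerM qE q'E.
  have cstP (x : fps k) : forall e, exists q : {poly k}, forall n : nat, x e = q.[n%:R].
    by move=> e; exists (x e)%:P => n; rewrite hornerC.
  exists (fun n => F n * c + G n * d), (d * c); split; first by rewrite mulf_neq0.
    by move=> n; rewrite fE gE addf_div ?nz // rmorphD !rmorphM.
  move=> e; have [q qE] := mulP _ _ FP (cstP c) e; have [q' q'E] := mulP _ _ GP (cstP d) e.
  by exists (q + q') => n; rewrite hornerD -qE -q'E.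
- exists (fun n => F n * G n), (d * c); split; first by rewrite mulf_neq0.
    by move=> n; rewrite fE gE mulf_div !rmorphM.
  move=> e; have /choice[q qE] := FP; have /choice[q' q'E] := GP.
  exists (\sum_(i < e.+1) q i * q' (e - i)%N) => n.
  rewrite fps_mulE horner_sum; apply: eq_bigr => i _.
  by rewrite hornerM qE q'E.
Qed.

(** A zero of [f] kills all coefficients of the numerator at that index, so each coefficient is a
    polynomial over k with infinitely many integral zeros. *)
Lemma polynomial_sequence_eq0 f : polynomial_sequence f ->
  (forall n, exists2 n', (n <= n')%N & f n' = 0) -> forall n, f n = 0.
Proof.
move=> [F [d [d0 fE FP]]] finf n; have d0' : tolaurent d != 0 by rewrite tolaurent_eq0.
suff -> : f n = tolaurent 0 / tolaurent d by rewrite rmorph0 mul0r.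
rewrite fE; congr (tolaurent _ / _); apply/funext => e; have [q qE] := FP e.
rewrite qE (poly_eq0_nat (q := q)) ?horner0 // => l.
have [n' ln' fn'] := finf l; exists n' => //; rewrite -qE.
move: fn'; rewrite fE => /eqP; rewrite mulf_eq0 invr_eq0 (negPf d0') orbF tolaurent_eq0.
by move/eqP ->.
Qed.

Variable N : nat.
Local Notation M := 'M[K]_N.

Lemma fps_mx_pow_small (E : 'M[fps k]_N) i j e m :
  (forall i j, E i j 0%N = 0) -> (m < e)%N -> (E ^+ e) i j m = 0.
Proof.
move=> E0; elim: e m i j => // e IH m i j me; rewrite exprS mxE fps_sumE big1 // => l _.
rewrite fps_mulE big1 // => -[[|a] /= am] _; first by rewrite E0 mul0r.
rewrite IH ?mulr0 //; case: m me am => // m; rewrite ltnS subSS => me _.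
by rewrite (leq_ltn_trans (leq_subr _ _)).
Qed.

(** Write [E = 1 + D] with [D] divisible by h. In the binomial expansion, powers of [D] beyond [m]
    do not reach the coefficient of h^m, and each remaining one is weighted by a binomial
    coefficient, a polynomial in [n]. *)
Lemma unipotent_pow_coef (E : 'M[fps k]_N) i j m :
  map_mx (fun f : fps k => f 0%N) E = 1%:M ->
  exists q : {poly k}, forall n, (E ^+ n) i j m = q.[n%:R].
Proof.
move=> /matrixP E1; pose D := E - 1.
have D0 a b : D a b 0%N = 0.
  have -> : D a b 0%N = E a b 0%N - (1%:M : 'M[fps k]_N) a b 0%N by rewrite mxE [in LHS]mxE.
  have := E1 a b; rewrite mxE => ->; rewrite !mxE.
  by case: (a == b); rewrite subrr.
exists (\sum_(e < m.+1) ((D ^+ e) i j m) *: binomial_poly e) => n.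
rewrite horner_sum; under eq_bigr do rewrite hornerZ binomial_polyE mulr_natr.
have -> : E = D + 1 by rewrite subrK.
rewrite exprD1n summxE fps_sumE.
have fpsMn (f : fps k) a : (f *+ a) m = f m *+ a.
  by elim: a => // a IHa; rewrite !mulrS -IHa.
have mxMn (B : 'M[fps k]_N) a : (B *+ a) i j = B i j *+ a.
  by elim: a => [|a IHa]; rewrite ?mulr0n ?mxE // !mulrS mxE IHa.
transitivity (\sum_(e < n.+1) (D ^+ e) i j m *+ 'C(n, e)).
  apply: eq_bigr => e _; rewrite -fpsMn; congr (_ m); exact: mxMn.
pose G e := (D ^+ e) i j m *+ 'C(n, e).
(* The sum stopped at [n] and the sum stopped at [m] are both prolonged to a common bound: the
   binomial coefficient vanishes beyond [n], the power of [D] contributes nothing beyond [m]. *)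
have ext a b : (a <= b)%N -> (forall e, (a <= e)%N -> G e = 0) ->
    \sum_(e < a) G e = \sum_(e < b) G e.
  move=> ab G0; rewrite -(subnKC ab) big_split_ord /= [X in _ + X]big1 ?addr0 // => e _.
  by rewrite G0 // leq_addr.
rewrite (ext n.+1 (n + m).+1) ?(ext m.+1 (n + m).+1) ?ltnS ?leq_addl ?leq_addr // => e he.
  by rewrite /G (fps_mx_pow_small i j D0 he) mul0rn.
by rewrite /G bin_small.
Qed.

Lemma connected_unipotent_powers (E : 'M[fps k]_N) :
  map_mx (fun f : fps k => f 0%N) E = 1%:M ->
  connected (range (fun n => map_mx (@tolaurent k) (E ^+ n) : zariski_Ksigma k N)).
Proof.
move=> E1; apply: connected_zariski_sequence => p pS.
apply: (polynomial_sequence_eq0 (f := fun n =>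
  meval (coord_Ksigma (map_mx (@tolaurent k) (E ^+ n)) 0) p)).
have ratP (F : nat -> fps k) : (forall e, exists q : {poly k}, forall n, F n e = q.[n%:R]) ->
    polynomial_sequence (fun n => tolaurent (F n)).
  move=> FP; exists F, 1; split; rewrite ?oner_neq0 // => n.
  by rewrite rmorph1 divr1.
apply: (fun_subalgebra_meval polynomial_sequence_subalgebra); last by apply: mpolyOverS pS.
move=> l; apply: (coord_Ksigma_fun l (A := fun n => map_mx (@tolaurent k) (E ^+ n))
    polynomial_sequence_subalgebra) => i j.
  by under eq_fun do rewrite mxE; apply: ratP => e; exact: unipotent_pow_coef.
under eq_fun do rewrite mxE sigma_tolaurent; apply: ratP => e.
have [q qE] := unipotent_pow_coef i j e E1; exists ((-1) ^+ e *: q) => n.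
by rewrite hornerZ -qE.
Qed.

End UnipotentSequences.

(** * The closure of a unitary monoid congruent to 1 modulo h *)

Section UnipotentMonoid.
Variables (k : fieldType) (N : nat).
Hypothesis k0 : [pchar k] =i pred0.
Local Notation M := 'M[laurent k]_N.
Local Notation tomx := (map_mx (@tolaurent k)).

Lemma zclosure_unipotent_monoid (G : set M) :
  G `<=` @unitary_sigma k N -> G 1%:M ->
  (forall A B, G A -> G B -> G (A *m B)) ->
  (forall A, G A -> exists2 E : 'M[fps k]_N,
     map_mx (fun f : fps k => f 0%N) E = 1%:M & A = tomx E) ->
  zclosure_Ksigma G =
    identity_component_Ksigma (zclosure_K G `&` @unitary_sigma k N).
Proof.
move=> GU G1 GM GE; rewrite -zclosure_Ksigma_unitary //.
have GP E n : G (tomx E) -> G (tomx (E ^+ n)).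
  move=> GtE; elim: n => [|n IH]; first by rewrite expr0 map_mx1.
  by rewrite exprS map_mxM; exact: GM.
pose P (E : 'M[fps k]_N) := map_mx (fun f : fps k => f 0%N) E = 1%:M /\ G (tomx E).
have Gcup : G = \bigcup_(E in P) range (fun n => tomx (E ^+ n)).
  apply/seteqP; split=> [A GA|_ [E [_ GtE] [n _ <-]]]; last exact: GP.
  by have [E E1 AE] := GE _ GA; exists E; [split=> //; rewrite -AE|exists 1%N].
have Gconn : connected (G : set (zariski_Ksigma k N)).
  rewrite Gcup; apply: bigcup_connected.
    by exists 1%:M => E _; exists 0%N => //; rewrite expr0 map_mx1.
  by move=> E [E1 _]; exact: connected_unipotent_powers.
(* The unitary equation is closed in the space of all matrices and forces invertibility, so the
   closure already lies in GL. *)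
have -> : zclosure_Ksigma G = closure (G : set (zariski_Ksigma k N)).
  apply/seteqP; split=> [A []//|A GA]; split=> //.
  by have [] := closure_unitary k0 GU GA.
rewrite /identity_component_Ksigma connected_component_id //.
  exact: subset_closure.
exact: connected_closure.
Qed.

End UnipotentMonoid.

(** * The monodromy of pure braids *)

Section HolonomyMonodromy.
Variables (R : realType) (gT : finGroupType) (n : nat).
Variable V : mx_representation (Cplx R) [set: gT]%SET n.
Hypothesis hW : is_2reflection_group V.
Variable k : fieldType.
Hypothesis k0 : [pchar k] =i pred0.
Variable x0 : 'cV[Cplx R]_n.
Hypothesis hx0 : hyp_complement V x0.
Variable Phi : (R -> orbit_space V) -> gT * nc_series k (refl V).
Hypothesis hPhi : holonomy_morphism x0 Phi.
Variables (N : nat) (rho : mx_representation k [set: gT]%SET N).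
Local Notation Psi := (fun b : R -> orbit_space V => sd_rep rho (Phi b)).
Local Notation pure := (pure_braid_loop (V := V) x0).

Lemma projected_loop g : is_path (hyp_complement V) x0 x0 g ->
  braid_loop x0 (orbit_proj V \o g).
Proof.
move=> [cg gX g0 g1]; split; rewrite /= ?g0 ?g1 //.
  by move=> t; apply: continuous_comp; [exact: cg|exact: continuous_orbit_proj].
by move=> _ [t t01 <-]; exists (g t) => //; apply: gX; exists t.
Qed.

Lemma pure_braid_cst : pure (cst (orbit_proj V x0)).
Proof.
have Px0 : is_path (hyp_complement V) x0 x0 (cst x0 : R -> _).
  by split=> // [t|_ [t _ <-]]; [exact: cvg_cst|].
have L0 := projected_loop Px0; split=> //; exists (cst x0); split=> //.
have [c0 cX _ _] := L0; apply: path_homotopic_eq => // t t01.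
by apply: cX; exists t.
Qed.

Lemma pure_braid_concat b c : pure b -> pure c -> pure (path_concat b c).
Proof.
move=> [bL [g [gP bg]]] [cL [g' [gP' cg]]]; split; first exact: is_path_concat bL cL.
exists (path_concat g g'); split; first exact: is_path_concat gP gP'.
have -> : orbit_proj V \o path_concat g g'
        = path_concat (orbit_proj V \o g) (orbit_proj V \o g').
  by apply/funext => t; rewrite /path_concat /=; case: ifP.
apply: path_homotopic_concat => //.
by case: bL cL => _ _ _ -> [_ _ -> _].
Qed.

Lemma holonomy_pure_trivial b : pure b -> (Phi b).1 = 1%g.
Proof.
have [_ Phi_homotopic Phi_concat Phi_braided] := hPhi.
move=> [bL [g [gP bg]]]; have [-> _] := Phi_homotopic _ _ bL (projected_loop gP) bg.
apply: (pure_braid_trivial hW hx0 (phi := fun b => (Phi b).1)) gP.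
- by move=> c d cL dL cd; have [] := Phi_homotopic _ _ cL dL cd.
- by move=> c d cL dL; have [] := Phi_concat _ _ cL dL.
- move=> s c cs; have [sR _] := cs.
  (* The conjugating element has trivial component in W, so the first components give the image of
     [c] exactly, without conjugation. *)
  by have [x _ [/= + _]] := Phi_braided (exist _ s sR) c cs; rewrite mulg1 mul1g.
Qed.

Lemma pure_monodromy b : pure b ->
  Psi b = map_mx (@tolaurent k) (series_rep rho (Phi b).2).
Proof.
by move=> /holonomy_pure_trivial b1; rewrite /sd_rep b1 repr_mx1 map_mx1 mul1mx.
Qed.

Lemma W_act1 (a : nc_series k (refl V)) : W_act 1%g a = a.
Proof.
apply/funext => w; rewrite /W_act; congr a; apply: map_id_in => s _.
by apply: val_inj; rewrite /= conjg1.
Qed.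

(** For pure braids the twist in the semidirect product is trivial, and the product reduces to that
    of series. *)
Lemma pure_monodromy_concat b c : pure b -> pure c ->
  Psi (path_concat b c) = Psi b *m Psi c.
Proof.
move=> bP cP; have [_ _ Phi_concat _] := hPhi.
have [_] := Phi_concat _ _ bP.1 cP.1.
rewrite /sd_mul /= holonomy_pure_trivial // invg1 W_act1 => /(holonomy_cong_rep rho) E.
by rewrite !pure_monodromy ?E ?series_repM ?map_mxM //; exact: pure_braid_concat.
Qed.

Lemma pure_series_rep b : braid_loop x0 b -> exists2 x : nc_series k (refl V), lie_series x &
  series_rep rho (Phi b).2 = series_rep rho (nc_exp x).
Proof.
have [Phi_exp _ _ _] := hPhi.
by move=> /Phi_exp[x xL /(holonomy_cong_rep rho) E]; exists x.
Qed.

Hypothesis rho_orth : orthogonal_rep rho.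

Lemma pure_monodromy_unitary b : pure b -> unitary_sigma (Psi b).
Proof.
move=> bP; have [x xL E] := pure_series_rep bP.1.
apply/unitary_sigmaP; rewrite pure_monodromy // E.
have -> (A : 'M[fps k]_N) : map_mx (@sigma k) (map_mx (@tolaurent k) A)
    = map_mx (@tolaurent k) (map_mx (@fps_sigma k) A).
  by apply/matrixP => i j; rewrite !mxE sigma_tolaurent.
rewrite map_trmx -map_mxM series_rep_exp_unitary ?map_mx1 //.
exact: reflection_order2.
Qed.

Lemma pure_monodromy_coef0 b : pure b ->
  map_mx (fun f : fps k => f 0%N) (series_rep rho (Phi b).2) = 1%:M.
Proof.
by move=> bP; have [x _ ->] := pure_series_rep bP.1; rewrite series_rep_coef0 nc_exp_nil.
Qed.

(** The constant loop equals its own square under concatenation, so its image is an idempotent;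
    being unitary it is invertible, hence 1. *)
Lemma pure_monodromy_cst : Psi (cst (orbit_proj V x0)) = 1%:M.
Proof.
have cP := pure_braid_cst; set e := cst _ in cP *.
have ee : path_concat e e = e by apply/funext => t; rewrite /path_concat; case: ifP.
have [eU _] := pure_monodromy_unitary cP.
have := pure_monodromy_concat cP cP; rewrite ee /=.
by move=> /(congr1 (mulmx (invmx (Psi e)))); rewrite mulmxA mulVmx // mul1mx.
Qed.

End HolonomyMonodromy.

Theorem proposition5p8 (R : realType) (gT : finGroupType) (n : nat)
  (V : mx_representation (Cplx R) [set: gT]%SET n)
  (hW : is_2reflection_group V)
  (k : fieldType) (hk : [pchar k] =i pred0)
  (x0 : 'cV[Cplx R]_n) (hx0 : hyp_complement V x0)
  (Phi : (R -> orbit_space V) -> gT * nc_series k (refl V))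
  (hPhi : holonomy_morphism x0 Phi)
  (N : nat) (rho : mx_representation k [set: gT]%SET N)
  (hrho : orthogonal_rep rho) :
  let Psi := fun b : R -> orbit_space V => sd_rep rho (Phi b) in
  let PsiP := Psi @` pure_braid_loop (V := V) x0 in
  zclosure_Ksigma PsiP =
    identity_component_Ksigma (zclosure_K PsiP `&` @unitary_sigma k N).
Proof.
move=> Psi PsiP; apply: (zclosure_unipotent_monoid hk).
- by move=> _ [b bP <-]; exact: (pure_monodromy_unitary hW hk hx0 hPhi hrho).
- exists (cst (orbit_proj V x0)); first exact: pure_braid_cst.
  exact: (pure_monodromy_cst hW hk hx0 hPhi hrho).
- move=> _ _ [b bP <-] [c cP <-]; exists (path_concat b c); first exact: pure_braid_concat.
  exact: (pure_monodromy_concat hW hx0 hPhi).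
- move=> _ [b bP <-]; exists (series_rep rho (Phi b).2).
    exact: (pure_monodromy_coef0 hPhi).
  exact: (pure_monodromy hW hx0 hPhi).
Qed.
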